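(* Let $n\ge1$, let $R$ be the $n\times(n+1)$ rectangle, and let $T\in\mathsf{SYT}(R)$ be a standard Young tableau with entries from $\{1,\dots,M,1',\dots,M'\}$ ordered $1<2<\dots<M<M'<\dots<2'<1'$, where $M=\frac{n(n+1)}2$. Then $T\in\mathsf{AST}(R)$ if and only if $\mathsf{fold}(T)\in\mathsf{DST}(R)$.
   Context: $R$ has $n$ rows and $n+1$ columns. $\mathsf{SYT}(R)$ denotes standard Young tableaux of shape $R$ with entries from the given totally ordered alphabet with $2M$ elements (rows and columns increasing, each letter used once). $\mathsf{AST}(R)$ (antidiagonally symmetrical tableaux): tableaux in $\mathsf{SYT}(R)$ with entries ordered $1<2<\dots<M<M'<\dots<2'<1'$ such that whenever the entry $k$ is in row $i$, column $j$, the entry $k'$ is in row $n+1-j$, column $n+2-i$. $\mathsf{DST}(R)$ (diagonally symmetrical tableaux): tableaux in $\mathsf{SYT}(R)$ with entries ordered $1'<1<2'<2<\dots<M'<M$ such that for all $i\ge j$, if the entry in row $i$, column $j$ is $k$ (resp. $k'$), then the entry in row $j$, column $i+1$ is $k'$ (resp. $k$). Folding: given $T\in\mathsf{SYT}(R)$ with entries ordered $1<\dots<M<M'<\dots<1'$, $\mathsf{fold}(T)$ is obtained as follows. For each $k=1,2,\dots,M$ in turn, slide the box containing $k'$ (which is at that moment in the lower right corner) through the subtableau formed by the entries $\{k,k+1,\dots,M,M',\dots,(k+1)'\}$ by jeu de taquin: repeatedly interchange $k'$ with the larger of the entries directly above it and directly to its left that belong to this subtableau, until there is no such entry. After the $k$-th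 step the order on the entries becomes $1'<1<\dots<k'<k<k+1<\dots<M<M'<\dots<(k+1)'$. At the end the entries of $\mathsf{fold}(T)$ are ordered $1'<1<2'<2<\dots<M'<M$, and $\mathsf{fold}(T)\in\mathsf{SYT}(R)$ with this order. *)

(* Defs.v *)
From mathcomp Require Import all_boot perm zify.
Set Implicit Arguments.
Unset Strict Implicit.
Unset Printing Implicit Defensive.

(* The letter k (resp. k'), 1 <= k <= M, is encoded as (k-1, false)
   (resp. (k-1, true)). *)
Notation letter M := ('I_M * bool)%type.

Notation cell n := ('I_n * 'I_n.+1)%type.

Definition tableau (n M : nat) := {ffun cell n -> letter M}.

(* 1 < 2 < ... < M < M' < ... < 2' < 1' *)
Definition lt_unfolded (M : nat) : rel (letter M) := fun a b =>
  match a.2, b.2 with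
  | false, false => a.1 < b.1
  | false, true  => true
  | true,  false => false
  | true,  true  => b.1 < a.1
  end.

(* 1' < 1 < 2' < 2 < ... < M' < M *)
Definition lt_folded (M : nat) : rel (letter M) := fun a b =>
  (a.1 < b.1) || [&& a.1 == b.1, a.2 & ~~ b.2].

Definition SYT (n M : nat) (lt : rel (letter M)) (T : tableau n M) : Prop :=
  [/\ bijective T,
      forall (i : 'I_n) (j1 j2 : 'I_n.+1), j1 < j2 -> lt (T (i, j1)) (T (i, j2))
    & forall (i1 i2 : 'I_n) (j : 'I_n.+1), i1 < i2 -> lt (T (i1, j)) (T (i2, j))].

(* Here rows and columns are numbered from 1; the proposition is false when
   (i, j) lies outside the rectangle. *)
Definition entry (n M : nat) (T : tableau n M) (i j : nat) (a : letter M) : Prop :=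
  exists (r : 'I_n) (c : 'I_n.+1), [/\ r.+1 = i, c.+1 = j & T (r, c) = a].

(* The subtractions never truncate: i <= n and j <= n + 1 whenever the
   hypothesis holds. *)
Definition AST (n M : nat) (T : tableau n M) : Prop :=
  SYT (@lt_unfolded M) T /\
  forall (i j : nat) (k : 'I_M),
    entry T i j (k, false) -> entry T (n + 1 - j) (n + 2 - i) (k, true).

Definition DST (n M : nat) (T : tableau n M) : Prop :=
  SYT (@lt_folded M) T /\
  forall (i j : nat) (k : 'I_M) (b : bool),
    j <= i -> entry T i j (k, b) -> entry T j (i + 1) (k, ~~ b).

(* q is directly above or directly to the left of p. *)
Definition up_or_left (n : nat) (p q : cell n) : bool :=
  (q.1.+1 == p.1 :> nat) && (q.2 == p.2)
  || (q.1 == p.1) && (q.2.+1 == p.2 :> nat).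

(* a is one of k, k+1, ..., M, M', ..., (k+1)'. *)
Definition active (M : nat) (k : 'I_M) (a : letter M) : bool :=
  if a.2 then k < a.1 else k <= a.1.

(* All the orders occurring during the folding process agree with
   lt_unfolded on the active letters. *)
Definition slide_target (n M : nat) (k : 'I_M) (T : tableau n M) (p q : cell n) :
    bool :=
  [&& up_or_left p q, active k (T q)
    & [forall q', up_or_left p q' && active k (T q') ==>
                  ~~ lt_unfolded (T q) (T q')]].

Definition slide_step (n M : nat) (k : 'I_M) (T : tableau n M) : tableau n M :=
  if [pick p | T p == (k, true)] is Some p then
    if [pick q | slide_target k T p q] is Some q then [ffun x => T (tperm p q x)]
    else T
  else T.

(* n + n.+1 steps are enough for the slide to come to rest, see slide_stuck. *)
Definition slide (n M : nat) (k : 'I_M) (T : tableau n M) : tableau n M :=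
  iter (n + n.+1) (slide_step k) T.

Definition fold (n M : nat) (T : tableau n M) : tableau n M :=
  foldl (fun T k => slide k T) T (enum 'I_M).

Lemma slide_target_exists (n M : nat) (k : 'I_M) (T : tableau n M) (p q : cell n) :
  up_or_left p q -> active k (T q) -> exists q', slide_target k T p q'.
Proof.
move=> pq aq.
pose rk (a : letter M) : nat := if a.2 then M + M - a.1 else a.1.
have Pq : (fun q => up_or_left p q && active k (T q)) q by apply/andP.
case: (@arg_maxnP _ q (fun q => up_or_left p q && active k (T q))
         (fun q => rk (T q)) Pq) => r /andP[pr ar] rmax.
exists r; rewrite /slide_target pr ar /=; apply/forallP => s; apply/implyP => Ps.
have := rmax s Ps; rewrite /rk /lt_unfolded.
case: (T r) => a [] /=; case: (T s) => b [] //=;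
  have := ltn_ord a; have := ltn_ord b; lia.
Qed.

Lemma slide_stuck (n M : nat) (k : 'I_M) (T : tableau n M) (p q : cell n) :
  injective T -> slide k T p = (k, true) -> up_or_left p q ->
  ~~ active k (slide k T q).
Proof.
move=> injT.
have [p0 Tp0|noT] := pickP [pred p | T p == (k, true)]; last first.
  suff -> : slide k T = T by move=> Tp; move: (noT p); rewrite /= Tp eqxx.
  rewrite /slide; elim: (n + _) => // m IH; rewrite iterS IH /slide_step.
  by case: pickP => // p1; have := noT p1; rewrite /= => ->.
have : p0.1 + p0.2 <= n + n.+1 by rewrite leq_add // ltnW.
rewrite /slide; move: (n + n.+1) => m; move/eqP: Tp0.
elim: m T injT p0 => [|m IH] T injT p0 Tp0 le_m.
  rewrite /= => Tp; have -> : p = p0 by apply: injT; rewrite Tp.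
  by rewrite /up_or_left; move: le_m; rewrite leqn0 addn_eq0 => /andP[/eqP-> /eqP->];
     rewrite andbF.
rewrite iterSr.
have stepE : slide_step k T =
    if [pick q | slide_target k T p0 q] is Some q
    then [ffun x => T (tperm p0 q x)] else T.
  rewrite /slide_step; case: pickP => [p1 /eqP Tp1|/(_ p0)]; last by rewrite Tp0 eqxx.
  by have -> : p1 = p0 by apply: injT; rewrite Tp1.
case: pickP stepE => [q0 tq0|notarget] stepE; last first.
  have -> : iter m (slide_step k) (slide_step k T) = T.
    by rewrite stepE; elim: m {IH le_m} => // m IH; rewrite iterS IH.
  move=> Tp pq; apply/negP => /(slide_target_exists pq)[q' tq'].
  have p0E : p = p0 by apply: injT; rewrite Tp.
  by move: tq'; rewrite p0E notarget.
rewrite stepE; apply: (IH _ _ q0).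
- by move=> x y; rewrite !ffunE => /injT /perm_inj.
- by rewrite ffunE tpermR.
- case/and3P: tq0 => + _ _; rewrite /up_or_left.
  by case/orP => /andP[/eqP e1 /eqP e2]; move: le_m;
    rewrite -e1 -e2 ?addSn ?addnS ltnS.
Qed.

(* Main.v *)
Require Import Defs.
From mathcomp Require Import all_boot perm zify.
From Stdlib Require Import FunctionalExtensionality.
Set Implicit Arguments.
Unset Strict Implicit.
Unset Printing Implicit Defensive.

(** Only the contents of the cells matter. List the letters of a tableau from the
largest to the smallest and write down the contents of their cells, shifted to
lie between 1 and 2n: this word records the removal of the boxes of the
rectangle one after another. For T, ordered by 1 < .. < M < M' < .. < 1', it
is V ++ W, where V comes from 1', .., M' and W from M, .., 1. For fold T,
ordered by 1' < 1 < .. < M' < M, it is a sequence of pairs, those of M and M',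
.., 1 and 1'. On each diagonal the letters increase, so that the place of a
letter is determined by its content and by the number of letters that precede
it on its diagonal. Therefore T is antidiagonally symmetrical if and only if
the content of k' is always one more than that of k, that is, W transposed is V
rotated by 180 degrees ([antidiagonal_contents]); and fold T is diagonally
symmetrical if and only if the contents of k and k' always add up to 2n+1, in
which case they are called twins ([diagonal_contents]).

A slide of the folding exchanges k' with each active letter in turn by a
Bender-Knuth move ([slide_carry]), which on contents is the switch [sw]. Give
each step of a word one of two colours and allow switches of neighbours of
different colours: this is tableau switching, here the relation [conn]. The
folded word with alternating colours is connected to evac V in the second
colour followed by W in the first ([fold_pairs_conn]). By Schutzenberger's
theorem the evacuation of V ++ W, a rectangular tableau, is its rotation
([evac_rots]); hence the folded word is also connected to a word of the first
colour followed by the rotation of V in the second ([half_square]).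

What switching preserves is seen by letting another word us enter from the
side, one step at a time, and pass along the coloured word by the local rules
of Schensted insertion: by rows at the steps of one colour and by columns at
those of the other. A step can disappear when an insertion ends at it. By the
cube lemma [cube] switching does not change which step of each colour
disappears at which time ([grid_conn]), and since insertion is injective, a
word of one colour is determined by these deaths ([deaths_inj]). In this way
the deaths of the folded word know both W, through its first colour, and the
rotation of V, through its second.

Take for us a word of twin pairs that empties the rectangle. If the folded word
consists of twins, then each two by two block of the grid is symmetric
([block_fwd]), and the deaths of the two colours coincide up to a delay of one
unit of time ([grid_fwd]). Transposition exchanges the rules for rows and for
columns, so W transposed and the rotation of V have the same deaths and are
equal ([twin_core], [twin_fold_antisym]). Conversely, if they are equal, then
the deaths of the two colours are related in this way, the blocks can be
inverted from the end of the grid ([block_inv], [grid_inv]), and the folded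
word consists of twins ([antisym_twin_fold]). This direction also needs that
the deaths occur at every other time only. That depends only on what us has
become after passing evac V, and can be read off the word us itself in place
of the folded word, because in both cases the shape in the middle is the
staircase, the only shape whose rotation is its transpose ([stair_unique]). *)

(** * Boundaries of shapes and the two local rules *)

(** The boundary of a shape, read from the lower left to the upper right: [true]
    is a horizontal edge, [false] a vertical one. *)
Definition config := nat -> bool.
(** Removal of the box of content [x]: its corner is formed by a horizontal edge
    at [x] and a vertical one at [x.+1]. *)
Definition hop (x : nat) (f : config) : config :=
  fun z => if z == x then false else if z == x.+1 then true else f z.
Arguments hop : simpl never.
(** [None] is a step at which no box is removed. *)
Definition step := option nat.
Definition can (f : config) (h : step) : bool :=
  if h is Some x then f x && ~~ f x.+1 else true.
Definition act (h : step) (f : config) : config := if h is Some x then hop x f else f.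

Lemma hopE x f z :
  hop x f z = if z == x then false else if z == x.+1 then true else f z.
Proof. by []. Qed.

Lemma hop_lo x f : hop x f x = false.
Proof. by rewrite hopE eqxx. Qed.

Lemma hop_hi x f : hop x f x.+1 = true.
Proof. by rewrite hopE eqxx; case: eqP => //; lia. Qed.

Lemma hop_out x f z : z != x -> z != x.+1 -> hop x f z = f z.
Proof. by rewrite hopE => /negPf -> /negPf ->. Qed.

Lemma can_neq f x y : can f (Some x) -> can f (Some y) -> (x.+1 != y) && (y.+1 != x).
Proof.
move=> /andP[fx fx1] /andP[fy fy1]; apply/andP; split; apply/eqP => e.
  by rewrite e fy in fx1.
by rewrite e fx in fy1.
Qed.

Lemma hopC x y f : x.+1 != y -> y.+1 != x -> hop x (hop y f) = hop y (hop x f).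
Proof.
move=> xy yx; apply: functional_extensionality => z; rewrite !hopE.
by do ![case: eqP => //] => *; lia.
Qed.

Lemma can_hop f x y : x.+1 != y -> y.+1 != x -> x != y ->
  can (hop x f) (Some y) = can f (Some y).
Proof.
move=> xy yx nxy; rewrite /can !hop_out //; lia.
Qed.

Lemma hop_inj x f g : can f (Some x) -> can g (Some x) -> hop x f = hop x g -> f = g.
Proof.
move=> /andP[fx fx1] /andP[gx gx1] e; apply: functional_extensionality => z.
have := congr1 (fun h => h z) e; rewrite !hopE.
case: eqP => [->|_]; first by rewrite fx gx.
by case: eqP => [->|//]; rewrite (negPf fx1) (negPf gx1).
Qed.

Lemma act_inj h f g : can f h -> can g h -> act h f = act h g -> f = g.
Proof. by case: h => //= x; apply: hop_inj. Qed.

Fixpoint seek_right (f : config) (x d : nat) : step :=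
  if d is d'.+1 then if f x.+2 then seek_right f x.+1 d' else Some x.+1 else None.
Fixpoint seek_left (f : config) (x : nat) : step :=
  if x is x'.+1 then if f x' then Some x' else seek_left f x' else None.
(** Schensted insertion run backwards: when a bump leaves the corner of content
    [x], the next box to be removed ends the next row above ([t = true]) or the
    next column to the left ([t = false]). The bound [K] is the end of the frame
    beyond which all edges are horizontal; without a box there, the insertion
    ends. *)
Definition landing (K : nat) (t : bool) (f : config) (x : nat) : step :=
  if t then seek_right f x (K - x.+2) else seek_left f x.
Arguments landing : simpl never.

(** The minimality conditions that characterise [landing]; all later facts on it
    come from this description. *)
Definition landing_spec (K : nat) (t : bool) (f : config) (x : nat) (b : step) : Prop :=
  match t, b with
  | true, Some y => [/\ x < y, y.+1 < K, ~~ f y.+1 & forall z, x.+1 < z <= y -> f z]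
  | true, None => forall z, x.+1 < z < K -> f z
  | false, Some y => [/\ y < x, f y & forall z, y < z < x -> ~~ f z]
  | false, None => forall z, z < x -> ~~ f z
  end.

Lemma landingP K t f x : landing_spec K t f x (landing K t f x).
Proof.
case: t; rewrite /landing.
  have [d dE] : exists d, K - x.+2 = d by eexists.
  elim: d x dE => [|d IH] x dE; rewrite dE /=; first by move=> z; lia.
  case fx: (f x.+2); last first.
    by split; [| lia | rewrite fx | move=> z; lia].
  have dE' : K - x.+3 = d by lia.
  have := IH x.+1 dE'; rewrite dE'; case: (seek_right _ _ _) => [y|] /= IHx.
    have [xy yK fy H] := IHx; split => //; first lia.
    move=> z Hz; have [->//|nz] := eqVneq z x.+2; apply: H; lia.
  move=> z Hz; have [->//|nz] := eqVneq z x.+2; apply: IHx; lia.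
elim: x => [|x IH] //=.
case fx: (f x); first by split => // z; lia.
move: IH; case: (seek_left f x) => [y|] /= IH.
  have [yx fy H] := IH; split => //; first lia.
  move=> z Hz; have [->|nz] := eqVneq z x; first by rewrite fx.
  apply: H; lia.
move=> z Hz; have [->|nz] := eqVneq z x; first by rewrite fx.
apply: IH; lia.
Qed.

Lemma landing_spec_uniq K t f x b1 b2 :
  landing_spec K t f x b1 -> landing_spec K t f x b2 -> b1 = b2.
Proof.
case: t b1 b2 => [] [y|] [y'|] //=.
- move=> [xy yK fy H] [xy' yK' fy' H']; congr Some.
  have [lt|lt|//] := ltngtP y y'.
    by move: (H' y.+1 ltac:(lia)); rewrite (negPf fy).
  by move: (H y'.+1 ltac:(lia)); rewrite (negPf fy').
- by move=> [xy yK fy H] H'; move: (H' y.+1 ltac:(lia)); rewrite (negPf fy).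
- by move=> H' [xy yK fy H]; move: (H' y'.+1 ltac:(lia)); rewrite (negPf fy).
- move=> [xy fy H] [xy' fy' H']; congr Some.
  have [lt|lt|//] := ltngtP y y'.
    by move: (H y' ltac:(lia)); rewrite fy'.
  by move: (H' y ltac:(lia)); rewrite fy.
- by move=> [xy fy H] H'; move: (H' y ltac:(lia)); rewrite fy.
- by move=> H' [xy fy H]; move: (H' y' ltac:(lia)); rewrite fy.
Qed.

Lemma landingE K t f x b : landing_spec K t f x b -> landing K t f x = b.
Proof. by apply: landing_spec_uniq; apply: landingP. Qed.

Lemma landing_neq K t f x y : landing K t f x = Some y -> y != x.
Proof. by have := landingP K t f x; case: t => /= /[swap] -> []; lia. Qed.

Lemma can_landing K t f x : can (hop x f) (landing K t f x).
Proof.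
have := landingP K t f x; case: (landing _ _ _ _) => [y|] //; case: t => /=.
  case=> xy yK fy H; rewrite (@hop_out x f y.+1); [|lia|lia].
  rewrite fy andbT; have [->|n] := eqVneq y x.+1; first exact: hop_hi.
  rewrite hop_out; [apply: H; lia|lia|lia].
case=> yx fy H; rewrite hop_out ?fy /=; [|lia|lia].
have [->|n] := eqVneq y.+1 x; first by rewrite hop_lo.
rewrite hop_out; [apply: H; lia|lia|lia].
Qed.

(** The local rule of growth diagrams. Two removals from the same shape commute
    when they take different boxes; when they take the same box, a bump takes
    place and both continue with its landing place. *)
Definition local_rule (K : nat) (t : bool) (f : config) (h u : step) : step * step :=
  match h, u with
  | Some x, Some y => if x == y then (landing K t f x, landing K t f x) else (h, u)
  | _, _ => (h, u)
  end.

Lemma ruleP K t f h u h' u' : can f h -> can f u -> local_rule K t f h u = (h', u') ->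
  [/\ can (act h f) u', can (act u f) h' & act u' (act h f) = act h' (act u f)].
Proof.
case: h u => [x|] [y|] //=; last 3 first.
- by move=> cx _ [<- <-].
- by move=> _ cy [<- <-].
- by move=> _ _ [<- <-].
move=> cx cy; case: eqP => [<-|/eqP nxy] [<- <-].
  by split=> //; apply: can_landing.
have /andP[n1 n2] := can_neq cx cy.
split; rewrite ?can_hop //; first by rewrite eq_sym.
exact: hopC.
Qed.

(** The local rule of jeu de taquin: two successive removals can be exchanged
    unless their boxes are neighbours, which can be removed in one order only. *)
Definition sw (a b : step) : step * step :=
  match a, b with
  | Some x, Some y => if (x.+1 == y) || (y.+1 == x) then (a, b) else (b, a)
  | _, _ => (b, a)
  end.

Lemma swK a b : sw (sw a b).1 (sw a b).2 = (a, b).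
Proof.
case: a b => [x|] [y|] //=; case E: (_ || _) => /=; rewrite ?E //.
by rewrite orbC E.
Qed.

Lemma swP f a b a' b' : can f a -> can (act a f) b -> sw a b = (a', b') ->
  [/\ can f a', can (act a' f) b' & act b' (act a' f) = act b (act a f)].
Proof.
case: a b => [x|] [y|]; [| by move=> /= c1 c2 [<- <-]..].
move=> cx cy; rewrite /sw; case: ifP => E [<- <-] //.
move/negbT/norP: E => [n1 n2].
have nxy : x != y by apply/eqP => e; move: cy; rewrite -e /= hop_lo.
rewrite /act can_hop // in cy; have nyx : y != x by rewrite eq_sym.
by rewrite /act can_hop // hopC.
Qed.
Arguments local_rule : simpl never.
Arguments sw : simpl never.

(** * The cube of local rules *)

(** The frame on the right, which keeps the search for a landing place finite. *)
Definition solid (K : nat) (f : config) : Prop := forall z, K <= z -> f z.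

Lemma solid_can K f x : solid K f -> can f (Some x) -> x.+1 < K.
Proof. by move=> sf /andP[_]; case: (leqP K x.+1) => // /sf ->. Qed.

Lemma solid_act K f h : solid K f -> can f h -> solid K (act h f).
Proof.
case: h => [x|] // sf cx z Kz; have := solid_can sf cx => xK.
rewrite /act hop_out ?sf //; lia.
Qed.

(** The search stops at the first corner of its direction, hence notices the
    removal of another corner only when it would have stopped there. *)
Lemma landing_hop_far K t f a b : solid K f -> can f (Some a) -> can f (Some b) -> a != b ->
  landing K t f a != Some b -> landing K t (hop b f) a = landing K t f a.
Proof.
move=> sf ca cb nab nb; have bK := solid_can sf cb; have /andP[n1 n2] := can_neq ca cb.
move: ca cb => /andP[fa fa1] /andP[fb fb1]; apply: landingE.
have := landingP K t f a; case: t (landing K t f a) nb => [] [y|] /=.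
- move=> nb [ay yK fy H].
  have Hb : b < a \/ y < b.
    case: (ltnP b a) => [|ba]; [by left | right].
    have {}nb : y != b by apply: contraNneq nb => ->.
    case: (ltnP y b) => // by'; move: (H b.+1 ltac:(lia)); by rewrite (negPf fb1).
  have yb : y.+1 != b by apply/eqP => e; rewrite e fb in fy.
  split=> //; first by rewrite hop_out //; lia.
  move=> z Hz; rewrite hop_out ?H //; lia.
- move=> _ H z Hz; rewrite hopE; case: eqP => [e|_].
    by move: (H b.+1 ltac:(lia)); rewrite (negPf fb1).
  by case: eqP => // _; apply: H.
- move=> nb [ya fy H].
  have {}nb : y != b by apply: contraNneq nb => ->.
  have Hb : a < b \/ b < y.
    case: (ltnP a b) => [|ba]; [by left | right].
    case: (ltnP b y) => // by'; move: (H b ltac:(lia)); by rewrite fb.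
  have nyb : y != b.+1 by apply/eqP => e; rewrite e (negPf fb1) in fy.
  split=> //; first by rewrite hop_out.
  move=> z Hz; rewrite hop_out ?H //; lia.
- move=> _ H z Hz; case: (ltnP b a) => ba; first by move: (H b ba); rewrite fb.
  rewrite hop_out ?H //; lia.
Qed.

(** The content next to [b], on the side from which a bump in direction [t]
    arrives. *)
Definition beyond (t : bool) (b : nat) : nat := if t then b.-1 else b.+1.

(** The decisive case of the cube: when the bump from [a] would land on [b], but
    [b] is removed as well, the bumps from [a] and, in the opposite direction,
    from [b] both end at the box that appears between them. *)
Lemma landing_meet K t f a b : solid K f -> can f (Some a) -> can f (Some b) ->
  landing K t f a = Some b ->
  landing K t (hop b f) a = Some (beyond t b) /\
  landing K (~~ t) (hop a f) b = Some (beyond t b).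
Proof.
move=> sf ca cb e; have nab := landing_neq e; have aK := solid_can sf ca.
have /andP[n1 n2] := can_neq ca cb.
have := landingP K t f a; rewrite e; move: ca cb => /andP[fa fa1] /andP[fb fb1].
case: t e => e /= [ab].
  move=> bK _ H; split; apply: landingE => /=.
    split; [lia | lia | |].
      by rewrite prednK ?hop_lo //; lia.
    move=> z Hz; rewrite hop_out ?H //; lia.
  split; first lia.
    have [e1|n] := eqVneq b.-1 a.+1; first by rewrite e1 hop_hi.
    rewrite hop_out ?H //; lia.
  by move=> z; lia.
move=> _ H; split; apply: landingE => /=.
  split; [lia | exact: hop_hi | ].
  move=> z Hz; rewrite hop_out ?H //; lia.
split; [lia | lia | | by move=> z; lia].
  have [->|n] := eqVneq b.+2 a; first by rewrite hop_lo.
  rewrite hop_out ?H //; lia.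
Qed.

Definition toward (t : bool) (a b : nat) : bool := if t then b == a.+1 else a == b.+1.

Lemma towardP t a b : (a.+1 == b) || (b.+1 == a) -> toward t a b || toward (~~ t) a b.
Proof. by case: t => /=; lia. Qed.

(** A box that can be removed only after [a], and is its neighbour in direction
    [t], is where the bump from [a] lands. *)
Lemma landing_adj K t f a b : solid K f -> can f (Some a) -> can (hop a f) (Some b) ->
  toward t a b -> landing K t f a = Some b.
Proof.
move=> sf ca; have aK := solid_can sf ca.
have sf' : solid K (hop a f) by apply: (solid_act (h := Some a)).
move=> cb; have bK := solid_can sf' cb; move: cb ca.
move=> /andP[fb fb1] /andP[fa fa1]; case: t => /= /eqP e; apply: landingE.
  subst b; split=> //; last by move=> z; lia.
  by move: fb1; rewrite hop_out //; lia.
subst a; split=> //; last by move=> z; lia.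
by move: fb; rewrite hop_out //; lia.
Qed.

(** In the other direction it makes no difference whether the search starts at
    [a] or at a neighbour that was uncovered by the removal of [a]. *)
Lemma landing_past K t f a b : solid K f -> can f (Some a) -> toward t a b ->
  landing K (~~ t) (hop a f) b = landing K (~~ t) f a.
Proof.
move=> sf ca; have aK := solid_can sf ca.
case: t => /= /eqP e; apply: landingE; have := landingP K _ f a.
  subst b => /(_ false); case: (landing K false f a) => [y|] /=.
    move=> [ya fy H]; split; [lia | by rewrite hop_out //; lia | ].
    move=> z Hz; have [->|n] := eqVneq z a; first by rewrite hop_lo.
    rewrite hop_out ?H //; lia.
  move=> H z Hz; have [->|n] := eqVneq z a; first by rewrite hop_lo.
  rewrite hop_out ?H //; lia.
subst a => /(_ true); case: (landing K true f b.+1) => [y|] /=.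
  move=> [ya yK fy H]; split=> //; [lia | by rewrite hop_out //; lia | ].
  move=> z Hz; have [->|n] := eqVneq z b.+2; first by rewrite hop_hi.
  rewrite hop_out ?H //; lia.
move=> H z Hz; have [->|n] := eqVneq z b.+2; first by rewrite hop_hi.
rewrite hop_out ?H //; lia.
Qed.

Lemma landing_side K t f a y : landing K t f a = Some y -> if t then a < y else y < a.
Proof. by have := landingP K t f a => /[swap] ->; case: t => -[]. Qed.

Lemma sw_far a b : a.+1 != b -> b.+1 != a -> sw (Some a) (Some b) = (Some b, Some a).
Proof. by move=> /negPf ab /negPf ba; rewrite /sw ab ba. Qed.

Lemma sw_near a b : (a.+1 == b) || (b.+1 == a) -> sw (Some a) (Some b) = (Some a, Some b).
Proof. by rewrite /sw => ->. Qed.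

Lemma swN b : (sw None b = (b, None)) * (sw b None = (None, b)).
Proof. by case: b. Qed.

Definition pass2 K f u t1 h1 t2 h2 : step * step * step :=
  let: (h1', u1) := local_rule K t1 f h1 u in
  let: (h2', u2) := local_rule K t2 (act h1 f) h2 u1 in
  ((h1', h2'), u2).

Lemma rule_Nh K t f u : local_rule K t f None u = (None, u). Proof. by []. Qed.
Lemma rule_Nu K t f h : local_rule K t f h None = (h, None). Proof. by case: h. Qed.
Lemma rule_eq K t f x : local_rule K t f (Some x) (Some x) = (landing K t f x, landing K t f x).
Proof. by rewrite /local_rule eqxx. Qed.
Lemma rule_neq K t f x y : x != y -> local_rule K t f (Some x) (Some y) = (Some x, Some y).
Proof. by rewrite /local_rule => /negPf ->. Qed.

(** The cube when [h1] and [h2] remove independent corners and [u] meets the first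
    of them: either its bump avoids the other corner, or [landing_meet] applies. *)
Lemma cube_far K t f a b (h1 h2 v : step) : solid K f ->
  can f (Some a) -> can f (Some b) -> a != b ->
  pass2 K f (Some a) t (Some a) (~~ t) (Some b) = ((h1, h2), v) ->
  pass2 K f (Some a) (~~ t) (Some b) t (Some a) = (sw h1 h2, v).
Proof.
move=> sf ca cb nab; rewrite /pass2 rule_eq (@rule_neq _ _ _ b a) 1?eq_sym //=.
rewrite [local_rule K t (hop b f) _ _]rule_eq.
have [e|ne] := eqVneq (landing K t f a) (Some b).
  have [-> e2] := landing_meet sf ca cb e.
  rewrite e rule_eq e2 => -[<- <- <-]; rewrite sw_near //.
  have := landing_neq e2; rewrite /beyond; case: t {e e2} => /=; lia.
rewrite landing_hop_far //.
have n2 := can_neq ca cb.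
have {}cb : can (hop a f) (Some b).
  by case/andP: n2 => n3 n4; rewrite can_hop.
have := can_landing K t f a.
case E: (landing K t f a) ne => [y|] ne cy' /=; last by move=> [<- <- <-].
have nby : b != y by apply: contraNneq ne => ->.
rewrite rule_neq // => -[<- <- <-].
have /andP[n3 n4] := can_neq cb cy'.
by rewrite sw_far.
Qed.

(** The cube when [h2] removes a neighbour of the box of [h1]: the bump in
    direction of this neighbour lands on it, and there the opposite bump starts,
    which by [landing_past] could have started from [h1] at once. *)
Lemma cube_adj K t f a b (h1 h2 v : step) : solid K f ->
  can f (Some a) -> can (hop a f) (Some b) -> toward t a b ->
  pass2 K f (Some a) t (Some a) (~~ t) (Some b) = ((h1, h2), v) ->
  pass2 K f (Some a) (~~ t) (Some a) t (Some b) = (sw h1 h2, v).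
Proof.
move=> sf ca cb tab; rewrite /pass2 !rule_eq (landing_adj sf ca cb tab) /= rule_eq.
rewrite (landing_past sf ca tab).
case E: (landing K (~~ t) f a) => [y|] /=; last by move=> [<- <- <-].
have side := landing_side E.
have nby : b != y by case: t tab side {E} => /=; lia.
rewrite rule_neq // => -[<- <- <-].
by rewrite sw_far //; case: t tab side {E} => /=; lia.
Qed.

(** Insertion by rows and insertion by columns commute; here this is the
    statement that crossing two steps of different colours is compatible with
    switching them. Only the steps with the same box as [u] are affected, and up
    to exchanging the roles of the two steps, which is allowed because [sw] is an
    involution, these are the two cases above. *)
Lemma cube K t f h1 h2 u h1' h2' v : solid K f ->
  can f h1 -> can (act h1 f) h2 -> can f u ->
  pass2 K f u t h1 (~~ t) h2 = ((h1', h2'), v) ->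
  pass2 K f u (~~ t) (sw h1 h2).1 t (sw h1 h2).2 = (sw h1' h2', v).
Proof.
move=> sf; case: u => [d|]; last first.
  by move=> _ _ _; rewrite /pass2 !rule_Nu => -[<- <- <-]; case: (sw h1 h2).
case: h1 => [a|]; last first.
  move=> _ c2 cd; rewrite /pass2 rule_Nh !swN /=.
  by case: (local_rule _ _ _ _ _) => [x y] [<- <- <-]; rewrite ?rule_Nh swN.
case: h2 => [b|]; last first.
  move=> c1 _ cd; rewrite /pass2 !swN /=.
  case: (local_rule _ _ _ (Some a) _) => [x y]; rewrite ?rule_Nh => -[<- <- <-].
  by rewrite swN.
move=> ca cb cd; have [near|] := boolP ((a.+1 == b) || (b.+1 == a)).
  rewrite sw_near //=; have [e|nad] := eqVneq a d.
    rewrite -e; case/orP: (towardP t near) => tw; first exact: cube_adj.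
    move=> E; case E': (pass2 K f (Some a) (~~ t) (Some a) t (Some b)) => [[g1 g2] w].
    have := cube_adj (h1 := g1) (h2 := g2) (v := w) sf ca cb tw.
    rewrite negbK => /(_ E'); rewrite E => -[e1 <-].
    by have := swK g1 g2; case: (sw g1 g2) e1 => x y /= [<- <-] ->.
  have nbd : b != d.
    move: ca cd cb => /andP[fa fa1] /andP[fd fd1] _.
    apply/eqP => e; move: near; subst d => /orP[] /eqP e.
      by rewrite e fd in fa1.
    by rewrite e fa in fd1.
  rewrite /pass2 rule_neq //= rule_neq // => -[<- <- <-].
  by rewrite rule_neq //= rule_neq // sw_near.
move=> /norP[n1 n2].
have nab : a != b by apply/eqP => e; move: cb; rewrite -e /= hop_lo.
have cb' : can f (Some b) by move: cb; rewrite /act can_hop.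
rewrite sw_far //=.
have [e|nad] := eqVneq a d; first by rewrite -e; apply: cube_far.
have [e|nbd] := eqVneq b d.
  rewrite -e => E.
  case E': (pass2 K f (Some b) (~~ t) (Some b) t (Some a)) => [[g1 g2] w].
  have := cube_far (t := ~~ t) (h1 := g1) (h2 := g2) (v := w) sf cb' ca.
  rewrite eq_sym negbK => /(_ nab E'); rewrite E => -[e1 <-].
  by have := swK g1 g2; case: (sw g1 g2) e1 => x y /= [<- <-] ->.
rewrite /pass2 rule_neq //= rule_neq // => -[<- <- <-].
by rewrite rule_neq //= rule_neq // sw_far.
Qed.

(** * Coloured paths, switching and growth grids *)

Fixpoint valid (f : config) (s : seq step) : bool :=
  if s is h :: s' then can f h && valid (act h f) s' else true.
Fixpoint run (f : config) (s : seq step) : config :=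
  if s is h :: s' then run (act h f) s' else f.

Lemma valid_cat f s1 s2 : valid f (s1 ++ s2) = valid f s1 && valid (run f s1) s2.
Proof. by elim: s1 f => //= h s1 IH f; rewrite IH andbA. Qed.

Lemma run_cat f s1 s2 : run f (s1 ++ s2) = run (run f s1) s2.
Proof. by elim: s1 f => //= h s1 IH f. Qed.

Lemma solid_run K f s : solid K f -> valid f s -> solid K (run f s).
Proof.
elim: s f => //= h s IH f sf /andP[ch vs]; apply: IH => //; exact: solid_act.
Qed.

(** Each step carries a colour: [true] for insertion by rows, [false] for
    insertion by columns. *)
Definition path := seq (bool * step).

Fixpoint pass (K : nat) (f : config) (u : step) (s : path) : path * step :=
  if s is (t, h) :: s' then
    let: (h', u1) := local_rule K t f h u in
    let: (r, v) := pass K (act h f) u1 s' in ((t, h') :: r, v)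
  else ([::], u).

Lemma passP K f u s s' v : valid f (unzip2 s) -> can f u -> pass K f u s = (s', v) ->
  [/\ valid (act u f) (unzip2 s'), can (run f (unzip2 s)) v,
      run (act u f) (unzip2 s') = act v (run f (unzip2 s)) & unzip1 s' = unzip1 s].
Proof.
elim: s f u s' v => [|[t h] s IH] f u s' v /=; first by move=> _ cu [<- <-].
move=> /andP[ch vs] cu; case E: (local_rule K t f h u) => [h' u1].
case E2: (pass K (act h f) u1 s) => [r w] [<- <-].
have [c1 c2 e] := ruleP ch cu E.
have [v1 c3 e3 ut] := IH _ _ _ _ vs c1 E2.
by rewrite /= c2 -e v1 ut.
Qed.

(** The step [h] ends an insertion and disappears. *)
Definition dead (h h' : step) : bool := isSome h && ~~ isSome h'.
Definition dies (t : bool) (s s' : path) : bitseq :=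
  [seq dead p.1.2 p.2.2 | p <- zip s s' & p.1.1 == t].

(** Tableau switching: steps of different colours move past each other, those of
    the same colour keep their order. *)
Inductive conn : path -> path -> Prop :=
| ConnRefl s : conn s s
| ConnTrans s1 s2 s3 : conn s1 s2 -> conn s2 s3 -> conn s1 s3
| ConnCons p s1 s2 : conn s1 s2 -> conn (p :: s1) (p :: s2)
| ConnSwap t a b s :
    conn ((t, a) :: (~~ t, b) :: s) ((~~ t, (sw a b).1) :: (t, (sw a b).2) :: s).

Lemma conn_sym s1 s2 : conn s1 s2 -> conn s2 s1.
Proof.
elim=> [s|{}s1 {}s2 s3 _ IH1 _ IH2|p {}s1 {}s2 _ IH|t a b s].
- exact: ConnRefl.
- exact: ConnTrans IH2 IH1.
- exact: ConnCons.
by have := ConnSwap (~~ t) (sw a b).1 (sw a b).2 s; rewrite swK negbK.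
Qed.

Lemma conn_cat s1 s2 r1 r2 : conn s1 s2 -> conn r1 r2 -> conn (s1 ++ r1) (s2 ++ r2).
Proof.
move=> c1 c2; apply: (@ConnTrans _ (s1 ++ r2)).
  by elim: s1 {c1} => //= p s1; apply: ConnCons.
elim: c1 => [s|{}s1 {}s2 s3 _ IH1 _ IH2|p {}s1 {}s2 _ IH|t a b s] /=.
- exact: ConnRefl.
- exact: ConnTrans IH1 IH2.
- exact: ConnCons.
exact: ConnSwap.
Qed.

Lemma conn_valid s1 s2 f : conn s1 s2 -> valid f (unzip2 s1) ->
  valid f (unzip2 s2) /\ run f (unzip2 s2) = run f (unzip2 s1).
Proof.
move=> c; elim: c f => {s1 s2}
  [s|s1 s2 s3 _ IH1 _ IH2|p s1 s2 _ IH|t a b s] f //=.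
- by move=> /IH1[/IH2[-> ->]].
- by move=> /andP[-> /IH].
move=> /and3P[ca cb vs].
case E: (sw a b) => [a' b']; have [ca' cb' e] := swP ca cb E.
by rewrite /= ca' cb' e.
Qed.

Lemma isSome_sw a b : isSome (sw a b).1 = isSome b /\ isSome (sw a b).2 = isSome a.
Proof. by rewrite /sw; case: a b => [x|] [y|] //=; case: ifP. Qed.

(** The cube, applied at one place of a path. A switch moves a step without
    changing whether it is [None], so that the deaths in each colour stay the
    same. *)
Lemma pass_conn K s1 s2 f u s1' v : solid K f -> conn s1 s2 ->
  valid f (unzip2 s1) -> can f u -> pass K f u s1 = (s1', v) ->
  exists s2', [/\ pass K f u s2 = (s2', v), conn s1' s2'
                & forall t, dies t s1 s1' = dies t s2 s2'].
Proof.
move=> + c; elim: c f u s1' v => {s1 s2}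
  [s|s1 s2 s3 c12 IH1 _ IH2|[t h] s1 s2 _ IH|t a b s] f u s1' v sf /=.
- by move=> _ _ ->; exists s1'; split=> //; apply: ConnRefl.
- move=> v1 cu /(IH1 _ _ _ _ sf v1 cu)[s2' [E2 c2 d2]].
  have [v2 _] := conn_valid c12 v1.
  have [s3' [E3 c3 d3]] := IH2 _ _ _ _ sf v2 cu E2.
  by exists s3'; split=> //; [exact: ConnTrans c2 c3 | move=> t; rewrite d2].
- move=> /andP[ch vs] cu; case E: (local_rule K t f h u) => [h' u1].
  case E1: (pass K (act h f) u1 s1) => [r w] [<- <-].
  have [c1 _ _] := ruleP ch cu E.
  have [r' [E2 c2 d2]] := IH _ _ _ _ (solid_act sf ch) vs c1 E1.
  exists ((t, h') :: r'); rewrite E2; split=> //; first exact: ConnCons.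
  by move=> t'; move: (d2 t'); rewrite /dies /=; case: (t == t') => //= ->.
move=> /and3P[ca cb vs] cu.
case E1: (local_rule K t f a u) => [a' u1].
case E2: (local_rule K (~~ t) (act a f) b u1) => [b' u2].
case E3: (pass K _ u2 s) => [r w] [<- <-].
have := @cube K t f a b u a' b' u2 sf ca cb cu.
rewrite /pass2 E1 E2 => /(_ erefl).
have [_ _ e] := swP ca cb (surjective_pairing _).
case F1: (local_rule K (~~ t) f (sw a b).1 u) => [b1 w1].
case F2: (local_rule K t (act (sw a b).1 f) (sw a b).2 w1) => [a1 w2] [es ew].
rewrite e ew E3; exists ((~~ t, (sw a' b').1) :: (t, (sw a' b').2) :: r).
rewrite -es; split=> //; first by rewrite es; apply: ConnSwap.
have [i1 i2] := isSome_sw a b; have := isSome_sw a' b'; rewrite -es => -[/= i3 i4].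
by case: t {E1 E2 F1 F2} => -[]; rewrite /dies /= /dead ?i1 ?i2 ?i3 ?i4.
Qed.

(** The grid whose columns are the steps of [s] and whose rows are the steps of
    [us], which enter at the beginning of [s]; [outs] leaves at its end. *)
Fixpoint outs (K : nat) (f : config) (us : seq step) (s : path) : seq step :=
  if us is u :: us' then
    (pass K f u s).2 :: outs K (act u f) us' (pass K f u s).1
  else [::].
Fixpoint deaths (K : nat) (t : bool) (f : config) (us : seq step) (s : path)
    : seq bitseq :=
  if us is u :: us' then
    dies t s (pass K f u s).1 :: deaths K t (act u f) us' (pass K f u s).1
  else [::].

Lemma grid_conn K s1 s2 f us : solid K f -> conn s1 s2 ->
  valid f (unzip2 s1) -> valid f us ->
  outs K f us s1 = outs K f us s2 /\
  forall t, deaths K t f us s1 = deaths K t f us s2.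
Proof.
elim: us f s1 s2 => [|u us IH] f s1 s2 sf c v1 //= /andP[cu vus].
case E: (pass K f u s1) => [s1' v].
have [s2' [-> c' d]] := pass_conn sf c v1 cu E.
have [v1' _ _ _] := passP v1 cu E.
have [/= -> ds] := IH _ _ _ (solid_act sf cu) c' v1' vus.
by split=> // t; rewrite d ds.
Qed.

Definition mk (t : bool) (a : seq step) : path := [seq (t, h) | h <- a].

Lemma mk_unzip2 t a : unzip2 (mk t a) = a.
Proof. by rewrite /mk /unzip2 -map_comp map_id. Qed.

(** Passage along a path of a single colour, and below the grids along such
    paths. *)
Fixpoint spass (K : nat) (t : bool) (f : config) (u : step) (a : seq step)
    : seq step * step :=
  if a is h :: a' then
    let: (h', u1) := local_rule K t f h u in
    let: (r, v) := spass K t (act h f) u1 a' in (h' :: r, v)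
  else ([::], u).

Fixpoint souts (K : nat) (t : bool) (f : config) (us : seq step) (a : seq step)
    : seq step :=
  if us is u :: us' then
    (spass K t f u a).2 :: souts K t (act u f) us' (spass K t f u a).1
  else [::].

Definition sdies (a a' : seq step) : bitseq := [seq dead p.1 p.2 | p <- zip a a'].

Fixpoint sdeaths (K : nat) (t : bool) (f : config) (us : seq step) (a : seq step)
    : seq bitseq :=
  if us is u :: us' then
    sdies a (spass K t f u a).1 :: sdeaths K t (act u f) us' (spass K t f u a).1
  else [::].

Lemma spassP K t f u a a' v : valid f a -> can f u -> spass K t f u a = (a', v) ->
  [/\ valid (act u f) a', can (run f a) v,
      run (act u f) a' = act v (run f a) & size a' = size a].
Proof.
elim: a f u a' v => [|h s IH] f u s' v /=; first by move=> _ cu [<- <-].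
move=> /andP[ch vs] cu; case E: (local_rule K t f h u) => [h' u1].
case E2: (spass K t (act h f) u1 s) => [r w] [<- <-].
have [c1 c2 e] := ruleP ch cu E.
have [v1 c3 e3 ut] := IH _ _ _ _ vs c1 E2.
by rewrite /= c2 -e v1 ut.
Qed.

Lemma pass_mk_cat K t f u a s : pass K f u (mk t a ++ s) =
  (mk t (spass K t f u a).1 ++ (pass K (run f a) (spass K t f u a).2 s).1,
   (pass K (run f a) (spass K t f u a).2 s).2).
Proof.
elim: a f u => [|h a IH] f u /=; first by case: (pass _ _ _ _).
case E: (local_rule K t f h u) => [h' u1]; rewrite IH.
by case: (spass K t (act h f) u1 a) => [r w].
Qed.

Lemma size_spass K t f u a : size (spass K t f u a).1 = size a.
Proof.
elim: a f u => //= h a IH f u; case: (local_rule K t f h u) => [h' u1].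
by move: (IH (act h f) u1); case: (spass _ _ _ _ _) => [r w] /= ->.
Qed.

Lemma dies_mk_cat t t' a a' s s' : size a = size a' ->
  dies t (mk t' a ++ s) (mk t' a' ++ s') =
  (if t' == t then sdies a a' else [::]) ++ dies t s s'.
Proof.
elim: a a' => [|h a IH] [|h' a'] //; first by rewrite /=; case: ifP.
move=> [/IH e]; rewrite -[dies _ _ _]/(map _ (if t' == t then _ :: _ else _)).
move: e; rewrite /dies => e.
by case: ifP e => E /= ->.
Qed.

(** What leaves the first part of a path enters the second. *)
Lemma deaths_mk_cat K t t' f us a s : valid f a -> valid f us ->
  deaths K t f us (mk t' a ++ s) =
  [seq (if t' == t then p.1 else [::]) ++ p.2
     | p <- zip (sdeaths K t' f us a) (deaths K t (run f a) (souts K t' f us a) s)].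
Proof.
elim: us f a s => //= u us IH f a s va /andP[cu vus].
rewrite pass_mk_cat /=; have := size_spass K t' f u a.
case E: (spass K t' f u a) => [a' v] /= sa.
have [va' _ e _] := spassP va cu E.
by rewrite IH // e dies_mk_cat.
Qed.

Lemma deaths_nil K t f us : deaths K t f us [::] = nseq (size us) [::].
Proof. by elim: us f => //= u us IH f; rewrite IH. Qed.

Lemma size_souts K t f us a : size (souts K t f us a) = size us.
Proof. by elim: us f a => //= u us IH f a; rewrite IH. Qed.

Lemma size_sdeaths K t f us a : size (sdeaths K t f us a) = size us.
Proof. by elim: us f a => //= u us IH f a; rewrite IH. Qed.

Lemma deaths_mk K t f us a : valid f a -> valid f us ->
  deaths K t f us (mk t a) = sdeaths K t f us a.
Proof.
move=> va vus; rewrite -[mk t a]cats0 deaths_mk_cat // eqxx deaths_nil.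
rewrite size_souts -(size_sdeaths K t f us a).
by elim: (sdeaths _ _ _ _ _) => //= d ds ->; rewrite cats0.
Qed.

Lemma deaths_mk_neq K t f us a : valid f a -> valid f us ->
  deaths K (~~ t) f us (mk t a) = nseq (size us) [::].
Proof.
move=> va vus; rewrite -[mk t a]cats0 deaths_mk_cat // deaths_nil size_souts.
rewrite (_ : (t == ~~ t) = false); last by case: t.
rewrite -(size_sdeaths K t f us a).
by elim: (sdeaths _ _ _ _ _) => //= d ds ->.
Qed.

Lemma deaths_fst K t f us a b : valid f (a ++ b) -> valid f us ->
  valid (run f a) (souts K t f us a) ->
  deaths K t f us (mk t a ++ mk (~~ t) b) = sdeaths K t f us a.
Proof.
rewrite valid_cat => /andP[va vb] vus vo; rewrite deaths_mk_cat // eqxx.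
rewrite -[t in deaths K t]negbK deaths_mk_neq // size_souts.
rewrite -(size_sdeaths K t f us a).
by elim: (sdeaths _ _ _ _ _) => //= d ds ->; rewrite cats0.
Qed.

Lemma deaths_snd K t f us a b : valid f (a ++ b) -> valid f us ->
  valid (run f a) (souts K t f us a) ->
  deaths K (~~ t) f us (mk t a ++ mk (~~ t) b) =
  sdeaths K (~~ t) (run f a) (souts K t f us a) b.
Proof.
rewrite valid_cat => /andP[va vb] vus vo; rewrite deaths_mk_cat //.
rewrite (_ : (t == ~~ t) = false); last by case: t {vo}.
rewrite deaths_mk //.
have := size_sdeaths K t f us a.
rewrite -(size_souts K t f us a) -(size_sdeaths K (~~ t) (run f a) _ b).
elim: (sdeaths K t f us a) (sdeaths K (~~ t) _ _ _) => [|d ds IH] [|e es] //= [] /IH.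
by move=> ->.
Qed.

Fixpoint sends (K : nat) (t : bool) (f : config) (us a : seq step) : seq step :=
  if us is u :: us' then sends K t (act u f) us' (spass K t f u a).1 else a.

Lemma sgridP K t f us a : valid f a -> valid f us ->
  [/\ valid (run f a) (souts K t f us a), valid (run f us) (sends K t f us a)
    & run (run f us) (sends K t f us a) = run (run f a) (souts K t f us a)].
Proof.
elim: us f a => //= u us IH f a va /andP[cu vus].
case E: (spass K t f u a) => [a' v] /=.
have [va' cv e _] := spassP va cu E.
have [v1 v2 e2] := IH _ _ va' vus.
by rewrite cv /= -e.
Qed.

(** A bump can be undone: from the box where it landed and the shape below, search
    back for the corner where it started. *)
Lemma landing_inj K t f1 f2 x1 x2 : solid K f1 -> solid K f2 ->
  can f1 (Some x1) -> can f2 (Some x2) -> hop x1 f1 = hop x2 f2 ->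
  landing K t f1 x1 = landing K t f2 x2 -> x1 = x2.
Proof.
move=> sf1 sf2; wlog lt12 : x1 x2 f1 f2 sf1 sf2 / x1 < x2.
  move=> H c1 c2 e eb; have [lt|lt|//] := ltngtP x1 x2; first exact: (H x1 x2 f1 f2).
  by apply/esym; apply: (H x2 x1 f2 f1).
move=> c1 c2 e eb; exfalso.
have K1 := solid_can sf1 c1; have K2 := solid_can sf2 c2.
have A z : hop x1 f1 z = hop x2 f2 z by rewrite e.
have := landingP K t f2 x2; rewrite -eb; have := landingP K t f1 x1.
case: t eb (landing K t f1 x1) => eb [y|] /=.
- move=> [xy _ _ H1] [xy' _ _ _]; move: (A x2); rewrite hop_lo.
  have [->|n] := eqVneq x2 x1.+1; first by rewrite hop_hi.
  by rewrite hop_out ?H1 //; lia.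
- move=> H1 _; move: (A x2); rewrite hop_lo.
  have [->|n] := eqVneq x2 x1.+1; first by rewrite hop_hi.
  by rewrite hop_out ?H1 //; lia.
- move=> [xy _ _] [xy' _ H2]; move: (A x1.+1); rewrite hop_hi.
  have [->|n] := eqVneq x2 x1.+1; first by rewrite hop_lo.
  by rewrite hop_out; [rewrite (negPf (H2 _ _)) //; lia | lia | lia].
- move=> _ H2; move: (A x1.+1); rewrite hop_hi.
  have [->|n] := eqVneq x2 x1.+1; first by rewrite hop_lo.
  by rewrite hop_out; [rewrite (negPf (H2 _ _)) //; lia | lia | lia].
Qed.

(** The one thing that a local rule forgets is whether a missing step was missing
    before, and this is what [dead] records. *)
Lemma rule_inj K t f1 f2 h1 h2 u1 u2 h' u' : solid K f1 -> solid K f2 ->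
  can f1 h1 -> can f1 u1 -> can f2 h2 -> can f2 u2 ->
  local_rule K t f1 h1 u1 = (h', u') -> local_rule K t f2 h2 u2 = (h', u') ->
  dead h1 h' = dead h2 h' -> act h1 f1 = act h2 f2 ->
  [/\ h1 = h2, u1 = u2 & f1 = f2].
Proof.
move=> sf1 sf2 c1 d1 c2 d2 E1 E2 dd e.
suff [eh eu] : h1 = h2 /\ u1 = u2.
  by split=> //; apply: (act_inj c1); rewrite ?e eh.
have C h u f : (exists x, [/\ h = Some x, u = Some x &
     local_rule K t f h u = (landing K t f x, landing K t f x)]) \/
   (local_rule K t f h u = (h, u) /\ (h = u -> h = None)).
  case: h u => [x|] [y|]; try by right.
  have [->|n] := eqVneq x y; first by left; exists y; rewrite rule_eq.
  by right; rewrite rule_neq //; split=> // -[] e'; rewrite e' eqxx in n.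
case: (C h1 u1 f1) (C h2 u2 f2) => [[x1 [eh1 eu1 E1']]|[E1' N1]]
  [[x2 [eh2 eu2 E2']]|[E2' N2]]; move: E1 E2; rewrite E1' E2'.
- move=> [b1 b1'] [b2 _]; suff e12 : x1 = x2 by rewrite eh1 eu1 eh2 eu2 e12.
  move: c1 c2 e; rewrite eh1 eh2 => c1 c2 e.
  by apply: (landing_inj (t := t) sf1 sf2 c1 c2 e); rewrite b1 b2.
- move=> [b1 b1'] [e1 e2]; have h2N : h2 = None by apply: N2; rewrite e1 e2 -b1.
  by move: dd; rewrite -e1 h2N eh1.
- move=> [e1 e2] [b1 b1']; have h1N : h1 = None by apply: N1; rewrite e1 e2 -b1.
  by move: dd; rewrite -e1 h1N eh2.
by move=> [<- <-] [-> ->].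
Qed.

Lemma spass_inj K t f1 f2 u1 u2 a1 a2 a' v : solid K f1 -> solid K f2 ->
  valid f1 a1 -> valid f2 a2 -> can f1 u1 -> can f2 u2 -> size a1 = size a2 ->
  spass K t f1 u1 a1 = (a', v) -> spass K t f2 u2 a2 = (a', v) ->
  sdies a1 a' = sdies a2 a' -> run f1 a1 = run f2 a2 ->
  [/\ f1 = f2, u1 = u2 & a1 = a2].
Proof.
elim: a1 a2 a' v f1 f2 u1 u2 => [|h1 a1 IH] [|h2 a2] //= a' v f1 f2 u1 u2 sf1 sf2.
  by move=> _ _ _ _ _ [<- <-] [<-].
move=> /andP[ch1 va1] /andP[ch2 va2] cu1 cu2 [sz].
case E1: (local_rule K t f1 h1 u1) => [h1' w1]; case F1: (spass _ _ _ w1 a1) => [r1 v1] [<- <-].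
case E2: (local_rule K t f2 h2 u2) => [h2' w2]; case F2: (spass _ _ _ w2 a2) => [r2 v2].
move=> [eh er ev]; subst h2' r2 v2 => -[dd ds] er.
have [cw1 _ _] := ruleP ch1 cu1 E1; have [cw2 _ _] := ruleP ch2 cu2 E2.
have [e1 e2 e3] := IH _ _ _ _ _ _ _ (solid_act sf1 ch1) (solid_act sf2 ch2)
  va1 va2 cw1 cw2 sz F1 F2 ds er.
subst w2 a2; have [-> -> ->] := rule_inj sf1 sf2 ch1 cu1 ch2 cu2 E1 E2 dd e1.
by split.
Qed.

Definition stuck (f : config) : Prop := forall x, ~~ can f (Some x).

Lemma stuck_can f h : stuck f -> can f h -> h = None.
Proof. by case: h => // x /(_ x)/negPf ->. Qed.

Lemma stuck_valid F a : stuck F -> valid F a -> a = nseq (size a) None.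
Proof.
by move=> sF; elim: a => //= h a IHa /andP[/(stuck_can sF) -> /= va]; rewrite -IHa.
Qed.

Lemma run_souts K t f F us a : stuck F -> valid f a -> valid f us -> run f us = F ->
  run (run f a) (souts K t f us a) = F.
Proof.
move=> sF va vus rus; have [_ vn <-] := sgridP K t va vus.
by move: vn; rewrite rus => /(stuck_valid sF) ->; elim: (size _).
Qed.

(** The Robinson-Schensted correspondence is injective: starting from the last row
    of the grid, where every step has become [None], its rows can be recovered
    one by one from the deaths. *)
Lemma deaths_inj K t F f1 f2 us1 us2 a1 a2 : stuck F ->
  solid K f1 -> solid K f2 ->
  valid f1 a1 -> valid f2 a2 -> run f1 a1 = F -> run f2 a2 = F ->
  valid f1 us1 -> valid f2 us2 -> run f1 us1 = F -> run f2 us2 = F ->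
  size a1 = size a2 -> size us1 = size us2 ->
  sdeaths K t f1 us1 a1 = sdeaths K t f2 us2 a2 ->
  [/\ f1 = f2, us1 = us2 & a1 = a2].
Proof.
move=> sF; elim: us1 us2 f1 f2 a1 a2 => [|u1 us1 IH] [|u2 us2] //= f1 f2 a1 a2 sf1 sf2.
  move=> va1 va2 _ _ _ _ e1 e2 sz _ _; subst f1 f2; split=> //.
  by rewrite (stuck_valid sF va1) (stuck_valid sF va2) sz.
move=> va1 va2 r1 r2 /andP[cu1 vu1] /andP[cu2 vu2] e1 e2 sa [su].
case E1: (spass K t f1 u1 a1) => [a1' v1]; case E2: (spass K t f2 u2 a2) => [a2' v2] /= [dd ds].
have [va1' cv1 g1 sz1] := spassP va1 cu1 E1; have [va2' cv2 g2 sz2] := spassP va2 cu2 E2.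
move: cv1 cv2; rewrite r1 r2 => /(stuck_can sF) ev1 /(stuck_can sF) ev2; subst v1 v2.
rewrite r1 in g1; rewrite r2 in g2.
have [e3 e4 e5] := IH us2 _ _ a1' a2' (solid_act sf1 cu1) (solid_act sf2 cu2)
  va1' va2' g1 g2 vu1 vu2 e1 e2 (etrans sz1 (etrans sa (esym sz2))) su ds.
subst a2' us2.
have [-> -> ->] := spass_inj sf1 sf2 va1 va2 cu1 cu2 sa E1 E2 dd (etrans r1 (esym r2)).
by [].
Qed.

(** * Rotation and switching squares *)

(** Position 0 bounds the shape on the left as [solid] does on the right. All
    contents of a framed shape lie strictly between 0 and [c.-1]. *)
Definition framed (c : nat) (f : config) : Prop := ~~ f 0 /\ solid c f.

Lemma framed_can c f x : framed c f -> can f (Some x) -> (0 < x) && (x.+1 < c).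
Proof.
move=> [f0 sf] cx; rewrite (solid_can sf cx) andbT; case: x cx => // /andP[].
by rewrite (negPf f0).
Qed.

Lemma framed_act c f h : framed c f -> can f h -> framed c (act h f).
Proof.
move=> fr ch; split; last by apply: solid_act => //; case: fr.
case: h ch => [x|] /= ch; last by case: fr.
have /andP[x0 _] := framed_can fr ch.
rewrite hop_out; [by case: fr | lia | lia].
Qed.

Lemma framed_run c f a : framed c f -> valid f a -> framed c (run f a).
Proof.
by elim: a f => //= h a IH f fr /andP[ch va]; apply: IH => //; apply: framed_act.
Qed.

Lemma run_inj f1 f2 a : valid f1 a -> valid f2 a -> run f1 a = run f2 a -> f1 = f2.
Proof.
elim: a f1 f2 => //= h a IH f1 f2 /andP[c1 v1] /andP[c2 v2] /(IH _ _ v1 v2).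
exact: act_inj.
Qed.

(** Rotation of the complementary shape by 180 degrees, within the frame. *)
Definition rotc (c : nat) (f : config) : config :=
  fun p => if 0 < p < c then f (c - p) else f p.
Definition rot_step (c : nat) (h : step) : step := omap (fun x => c.-1 - x) h.
(** The rotated boxes have to be removed in the opposite order. *)
Definition rots (c : nat) (a : seq step) : seq step := rev (map (rot_step c) a).

Lemma rotcK c f : rotc c (rotc c f) = f.
Proof.
apply: functional_extensionality => p; rewrite /rotc.
case: (boolP (0 < p < c)) => H //.
by rewrite ifT; [congr f; lia | lia].
Qed.

Lemma framed_rotc c f : framed c f -> framed c (rotc c f).
Proof.
move=> [f0 sf]; split; first by rewrite /rotc.
by move=> z cz; rewrite /rotc ifF; [apply: sf | lia].
Qed.

Lemma rot_can c f h : framed c f -> can f h ->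
  can (rotc c (act h f)) (rot_step c h) /\ act (rot_step c h) (rotc c (act h f)) = rotc c f.
Proof.
case: h => [x|] //= fr cx; have /andP[x0 xc] := framed_can fr cx.
move: cx => /andP[fx fx1]; split.
  rewrite /rotc !ifT; [|lia|lia].
  rewrite (_ : c - (c.-1 - x) = x.+1); last lia.
  rewrite (_ : c - (c.-1 - x).+1 = x); last lia.
  by rewrite hop_hi hop_lo.
apply: functional_extensionality => p; rewrite hopE /rotc.
case: eqP => [->|n1].
  by rewrite ifT; [rewrite (_ : c - _ = x.+1) ?(negPf fx1) //; lia | lia].
case: eqP => [->|n2].
  by rewrite ifT; [rewrite (_ : c - _ = x) ?fx //; lia | lia].
by case: ifP => H; rewrite hop_out //; lia.
Qed.

Lemma rots_valid c f a : framed c f -> valid f a ->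
  valid (rotc c (run f a)) (rots c a) /\ run (rotc c (run f a)) (rots c a) = rotc c f.
Proof.
elim: a f => //= h a IH f fr /andP[ch va].
have [v e] := IH _ (framed_act fr ch) va; have [c1 e1] := rot_can fr ch.
rewrite /rots /= rev_cons -cats1 valid_cat run_cat -/(rots c a) v e /= e1.
by rewrite c1.
Qed.

Lemma rots_cat c a b : rots c (a ++ b) = rots c b ++ rots c a.
Proof. by rewrite /rots map_cat rev_cat. Qed.

Lemma size_rots c a : size (rots c a) = size a.
Proof. by rewrite /rots size_rev size_map. Qed.

Definition rot_path (c : nat) (s : path) : path :=
  rev (map (fun p => (p.1, rot_step c p.2)) s).

Lemma rot_path_mk c t a : rot_path c (mk t a) = mk t (rots c a).
Proof. by rewrite /rot_path /mk /rots map_rev -!map_comp. Qed.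

Lemma rot_path_cat c r s : rot_path c (r ++ s) = rot_path c s ++ rot_path c r.
Proof. by rewrite /rot_path map_cat rev_cat. Qed.

Lemma sw_rot c a b : (if a is Some x then x < c else true) ->
  (if b is Some y then y < c else true) ->
  sw (rot_step c b) (rot_step c a) = (rot_step c (sw a b).2, rot_step c (sw a b).1).
Proof.
case: a b => [x|] [y|] //= xc yc; rewrite /sw.
rewrite (_ : (_ || _) = ((x.+1 == y) || (y.+1 == x))); last lia.
by case: ifP.
Qed.

Lemma conn_rot c f s1 s2 : framed c f -> valid f (unzip2 s1) -> conn s1 s2 ->
  conn (rot_path c s1) (rot_path c s2).
Proof.
move=> + + cn; elim: cn f => {s1 s2}
  [s|s1 s2 s3 c12 IH1 _ IH2|p s1 s2 _ IH|t a b s] f fr /=.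
- by move=> _; apply: ConnRefl.
- move=> v1; have [v2 _] := conn_valid c12 v1.
  exact: ConnTrans (IH1 _ fr v1) (IH2 _ fr v2).
- move=> /andP[cp v1]; rewrite /rot_path /= !rev_cons -!cats1.
  by apply: conn_cat (ConnRefl _); apply: (IH _ (framed_act fr cp)).
move=> /and3P[ca cb _]; rewrite /rot_path /= !rev_cons -!cats1 -!catA.
apply: conn_cat (ConnRefl _) _.
have := ConnSwap (~~ t) (rot_step c b) (rot_step c a) [::].
rewrite negbK sw_rot //.
  by case: a ca {cb} => // x /(framed_can fr)/andP[_ /ltnW].
by case: b cb => // y /(framed_can (framed_act fr ca))/andP[_ /ltnW].
Qed.

Lemma conn_count s1 s2 t : conn s1 s2 ->
  count (fun p => p.1 == t) s1 = count (fun p => p.1 == t) s2.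
Proof.
by elim=> {s1 s2} //= [s1 s2 s3 _ -> _ ->|p s1 s2 _ ->|t' a b s] //; rewrite addnCA.
Qed.

Lemma count_mk t t' a : count (fun p => p.1 == t) (mk t' a) = (t' == t) * size a.
Proof.
by elim: a => //= [|h a ->]; rewrite ?muln0 //; case: (t' == t).
Qed.

Lemma conn_mk_size t a b b' a' :
  conn (mk t a ++ mk (~~ t) b) (mk (~~ t) b' ++ mk t a') ->
  size a' = size a /\ size b' = size b.
Proof.
move=> cn; have := conn_count t cn; have := conn_count (~~ t) cn.
rewrite !count_cat !count_mk !eqxx; case: t {cn} => /=; lia.
Qed.

(** Switching a tableau [a] of shape [g] minus an inner shape past the tableau
    [b] that follows it, down to the shape [F]. *)
Definition Square (t : bool) (g F : config) (a b b' a' : seq step) : Prop :=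
  [/\ valid g (a ++ b), run g (a ++ b) = F &
      conn (mk t a ++ mk (~~ t) b) (mk (~~ t) b' ++ mk t a')].

Lemma unzip2_mk2 t t' a b : unzip2 (mk t a ++ mk t' b) = a ++ b.
Proof. by rewrite /unzip2 map_cat -!/(unzip2 _) !mk_unzip2. Qed.

Lemma square_valid t g F a b b' a' : Square t g F a b b' a' ->
  [/\ valid g a, valid (run g a) b, valid g b' & valid (run g b') a'] /\
  (run (run g a) b = F /\ run (run g b') a' = F).
Proof.
move=> [v r cn]; have := @conn_valid _ _ g cn; rewrite !unzip2_mk2 => /(_ v)[v' r'].
move: v v' r r'; rewrite !valid_cat !run_cat => /andP[-> ->] /andP[-> ->] <- ->.
by split.
Qed.

Lemma square_sym t g F a b b' a' : Square t g F a b b' a' -> Square (~~ t) g F b' a' a b.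
Proof.
move=> [v r cn]; have := @conn_valid _ _ g cn; rewrite !unzip2_mk2 => /(_ v)[v' r'].
by split; rewrite ?r' ?negbK //; apply: conn_sym.
Qed.

Lemma square_rot c t g F a b b' a' : framed c g -> Square t g F a b b' a' ->
  Square (~~ t) (rotc c F) (rotc c g) (rots c b) (rots c a) (rots c a') (rots c b').
Proof.
move=> fr [v r cn]; have [v' r'] := rots_valid fr v; rewrite r rots_cat in v' r'.
split=> //; have vs : valid g (unzip2 (mk t a ++ mk (~~ t) b)) by rewrite unzip2_mk2.
by have := conn_rot fr vs cn; rewrite !rot_path_cat !rot_path_mk negbK.
Qed.

(** The deaths of colour [t] can be read on either side of the square. *)
Lemma square_deaths_fst K t g F us a b b' a' : solid K g -> Square t g F a b b' a' ->
  valid g us ->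
  sdeaths K t (run g b') (souts K (~~ t) g us b') a' = sdeaths K t g us a.
Proof.
move=> sg sq vus; have [[va vb vb' va'] _] := square_valid sq; case: sq => [v r cn].
have [vo _ _] := sgridP K t va vus; have [vo' _ _] := sgridP K (~~ t) vb' vus.
have vs : valid g (unzip2 (mk t a ++ mk (~~ t) b)) by rewrite unzip2_mk2.
have [_ /(_ t)] := grid_conn sg cn vs vus.
rewrite deaths_fst //; have := @deaths_snd K (~~ t) g us b' a'.
by rewrite negbK valid_cat vb' va' => -> // <-.
Qed.

(** The result [a'] of switching [a] past [b] is independent of [b]: its deaths are
    those of [a], and deaths determine a word. This is the theorem that
    rectification is well defined; the word [us] is only a probe. *)
Lemma square_fst_out K t g F us a b1 b1' a1' b2 b2' a2' : stuck F -> solid K g ->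
  valid g us -> run g us = F ->
  Square t g F a b1 b1' a1' -> Square t g F a b2 b2' a2' ->
  [/\ run g b1' = run g b2', souts K (~~ t) g us b1' = souts K (~~ t) g us b2'
    & a1' = a2'].
Proof.
move=> sF sg vus rus sq1 sq2.
have [[va vb1 vb1' va1'] [r1 r1']] := square_valid sq1.
have [[_ vb2 vb2' va2'] [r2 r2']] := square_valid sq2.
have d1 := square_deaths_fst sg sq1 vus; have d2 := square_deaths_fst sg sq2 vus.
have [vo1 _ _] := sgridP K (~~ t) vb1' vus; have [vo2 _ _] := sgridP K (~~ t) vb2' vus.
have rr1 := run_souts K (~~ t) sF vb1' vus rus; have rr2 := run_souts K (~~ t) sF vb2' vus rus.
have [s1 _] : size a1' = size a /\ size b1' = size b1 by apply: (conn_mk_size (t := t)); case: sq1.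
have [s2 _] : size a2' = size a /\ size b2' = size b2 by apply: (conn_mk_size (t := t)); case: sq2.
exact: (deaths_inj sF (solid_run sg vb1') (solid_run sg vb2') va1' va2'
  r1' r2' vo1 vo2 rr1 rr2 (etrans s1 (esym s2))
  (etrans (size_souts _ _ _ _ _) (esym (size_souts _ _ _ _ _))) (etrans d1 (esym d2))).
Qed.

Lemma square_fst K t g F a b1 b1' a1' b2 b2' a2' : stuck F -> solid K g ->
  Square t g F a b1 b1' a1' -> Square t g F a b2 b2' a2' ->
  run g b1' = run g b2' /\ a1' = a2'.
Proof.
move=> sF sg sq1 sq2; have [v r _] := sq1.
by have [-> _ ->] := square_fst_out sF sg v r sq1 sq2.
Qed.

Lemma rotsK c f a : framed c f -> valid f a -> rots c (rots c a) = a.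
Proof.
move=> fr va; rewrite /rots map_rev revK; elim: a f fr va => //= h a IH f fr /andP[ch va].
rewrite (IH _ (framed_act fr ch) va); congr cons.
by case: h ch {va} => //= x /(framed_can fr); clear; move=> H; congr Some; lia.
Qed.

(** The dual statement, obtained by rotating the square. *)
Lemma square_snd c t g F a1 a2 b b1' a1' b2' a2' : stuck (rotc c g) -> framed c g ->
  Square t g F a1 b b1' a1' -> Square t g F a2 b b2' a2' -> b1' = b2'.
Proof.
move=> sg fr sq1 sq2.
have [[va1 vb1 vb1' va1'] [r1 r1']] := square_valid sq1.
have [[va2 vb2 vb2' va2'] [r2 r2']] := square_valid sq2.
have frF : framed c F by rewrite -r1; do 2 apply: framed_run => //.
have sF : solid c (rotc c F) by case: (framed_rotc frF).
have [_ e] := square_fst sg sF (square_rot fr sq1) (square_rot fr sq2).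
by rewrite -(rotsK fr vb1') e (rotsK fr vb2').
Qed.

(** * Pushing, evacuation and emptying a shape *)

(** The step [y] is pushed through [zs] by successive switches: a jeu de taquin
    slide. *)
Fixpoint push (y : step) (zs : seq step) : seq step * step :=
  if zs is z :: zs' then
    let: (z1, y1) := sw y z in let: (r, y2) := push y1 zs' in (z1 :: r, y2)
  else ([::], y).

Lemma push_conn t y zs :
  conn ((t, y) :: mk (~~ t) zs) (mk (~~ t) (push y zs).1 ++ [:: (t, (push y zs).2)]).
Proof.
elim: zs y => /= [|z zs IH] y; first exact: ConnRefl.
have := ConnSwap t y z (mk (~~ t) zs); case: (sw y z) => z1 y1 /= c1.
apply: (ConnTrans c1); move: (IH y1); case: (push y1 zs) => r y2 /= c2.
exact: ConnCons.
Qed.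

Lemma size_push y zs : size (push y zs).1 = size zs.
Proof.
elim: zs y => //= z zs IH y; case: (sw y z) => z1 y1.
by move: (IH y1); case: (push y1 zs) => r y2 /= ->.
Qed.

Lemma push_valid f y zs : valid f (y :: zs) ->
  valid f ((push y zs).1 ++ [:: (push y zs).2]) /\
  run f ((push y zs).1 ++ [:: (push y zs).2]) = run f (y :: zs).
Proof.
have := @conn_valid _ _ f (push_conn true y zs).
by rewrite /= mk_unzip2 /unzip2 map_cat -!/(unzip2 _) mk_unzip2.
Qed.

Lemma push_cat y zs ws : push y (zs ++ ws) =
  ((push y zs).1 ++ (push (push y zs).2 ws).1, (push (push y zs).2 ws).2).
Proof.
elim: zs y => /= [|z zs IH] y; first by case: (push y ws).
case: (sw y z) => z1 y1; rewrite IH.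
by case: (push y1 zs) => r y2.
Qed.

Fixpoint evac_rec (m : nat) (zs : seq step) : seq step :=
  if m is m'.+1 then
    if zs is y :: zs1 then
      rcons (evac_rec m' (push y zs1).1) (push y zs1).2
    else [::]
  else [::].
(** Schutzenberger's evacuation: each first step in turn is pushed to the end and
    put aside. *)
Definition evac (zs : seq step) : seq step := evac_rec (size zs) zs.

Lemma evac_cons y zs : evac (y :: zs) = rcons (evac (push y zs).1) (push y zs).2.
Proof. by rewrite /evac /= size_push. Qed.

(** The recursion scheme of [evac], which is not structural. *)
Lemma evac_ind (P : seq step -> Prop) : P [::] ->
  (forall y zs, P (push y zs).1 -> P (y :: zs)) -> forall zs, P zs.
Proof.
move=> P0 PS zs; have [m] := ubnP (size zs); elim: m zs => // m IH [//|y zs] /= le.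
by apply: PS; apply: IH; rewrite size_push.
Qed.

Lemma size_evac zs : size (evac zs) = size zs.
Proof.
elim/evac_ind: zs => // y zs IH.
by rewrite evac_cons size_rcons IH size_push.
Qed.

Lemma evac_valid f zs : valid f zs -> valid f (evac zs) /\ run f (evac zs) = run f zs.
Proof.
elim/evac_ind: zs => // y zs IH /push_valid.
rewrite evac_cons -cats1 !valid_cat !run_cat /= => -[/andP[/IH[v e] cy] <-].
by rewrite v e.
Qed.

(** Evacuating [zs ++ ws] first pushes the steps of [zs] through [zs], which
    evacuates [zs], and then through [ws]; the second part is a switching of
    evac [zs] past [ws]. *)
Lemma evac_cat t zs ws : exists b' a',
  [/\ evac (zs ++ ws) = evac b' ++ a', size a' = size zs, size b' = size ws &
      conn (mk t (evac zs) ++ mk (~~ t) ws) (mk (~~ t) b' ++ mk t a')].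
Proof.
elim/evac_ind: zs ws => [|y zs IH] ws.
  by exists ws, [::]; rewrite cats0; split=> //; rewrite cats0; apply: ConnRefl.
rewrite cat_cons !evac_cons push_cat.
have [b' [a' [e sa sb cn]]] := IH (push (push y zs).2 ws).1.
exists b', (rcons a' (push (push y zs).2 ws).2); split.
- by rewrite e rcons_cat.
- by rewrite size_rcons sa size_push.
- by rewrite sb size_push.
have e1 h l r : mk t (rcons l h) ++ r = mk t l ++ (t, h) :: r.
  by rewrite /mk map_rcons cat_rcons.
have e2 h l : mk t (rcons l h) = mk t l ++ [:: (t, h)].
  by rewrite /mk map_rcons cats1.
rewrite e1 e2 catA; apply: ConnTrans (conn_cat cn (ConnRefl _)).
rewrite -catA; apply: conn_cat (ConnRefl _) _; exact: push_conn.
Qed.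

Definition proper (a : seq step) : bool := all isSome a.

Lemma proper_cat a b : proper (a ++ b) = proper a && proper b.
Proof. exact: all_cat. Qed.

Lemma push_proper y zs : isSome y -> proper zs ->
  proper (push y zs).1 /\ isSome (push y zs).2.
Proof.
elim: zs y => //= z zs IH y sy /andP[sz pz].
have [] := isSome_sw y z; case: (sw y z) => z1 y1 /=; rewrite sy sz => s1 s2.
by have := IH y1 s2 pz; case: (push y1 zs) => r y2 /= [-> ->]; rewrite s1.
Qed.

Lemma evac_proper zs : proper zs -> proper (evac zs).
Proof.
elim/evac_ind: zs => // y zs IH /= /andP[sy pz].
have [p1 p2] := push_proper sy pz.
by rewrite evac_cons -cats1 proper_cat IH //= p2.
Qed.

Lemma proper_rots c a : proper (rots c a) = proper a.
Proof.
rewrite /proper /rots all_rev all_map; apply: eq_all => h /=.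
by case: h.
Qed.

(** The number of horizontal edges in the frame, an invariant of removals. *)
Definition mass (c : nat) (f : config) : nat := \sum_(z < c) f z.
(** The number of boxes up to a constant, which decreases with each removal. *)
Definition energy (c : nat) (f : config) : nat := \sum_(z < c) f z * (c - z).

(** Both measures are weighted sums over the edges, of which a removal affects
    two. *)
Lemma sum_hop c f x (w : nat -> nat) : framed c f -> can f (Some x) ->
  \sum_(z < c) f z * w z + w x.+1 = \sum_(z < c) hop x f z * w z + w x.
Proof.
move=> fr cx; have /andP[x0 xc] := framed_can fr cx; move: cx => /andP[fx fx1].
have xc' : x < c by lia.
rewrite (bigD1 (Ordinal xc')) // [in RHS](bigD1 (Ordinal xc')) //=.
have nn : Ordinal xc != Ordinal xc' by rewrite -val_eqE /=; lia.
rewrite (bigD1 (Ordinal xc)) // [in RHS](bigD1 (Ordinal xc)) //=.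
rewrite fx (negPf fx1) hop_lo hop_hi.
rewrite (eq_bigr (fun i : 'I_c => hop x f i * w i)); first lia.
move=> i /andP[]; rewrite -!val_eqE /= => n1 n2.
by rewrite hop_out.
Qed.

Lemma mass_act c f h : framed c f -> can f h -> mass c (act h f) = mass c f.
Proof.
case: h => [x|] //= fr cx; have := sum_hop (fun _ => 1) fr cx.
rewrite (eq_bigr (fun i : 'I_c => nat_of_bool (f i))); last by move=> *; rewrite muln1.
rewrite [in RHS](eq_bigr (fun i : 'I_c => nat_of_bool (hop x f i))); last first.
  by move=> *; rewrite muln1.
by rewrite -!/(mass _ _); lia.
Qed.

Lemma energy_hop c f x : framed c f -> can f (Some x) ->
  energy c f = (energy c (hop x f)).+1.
Proof.
move=> fr cx; have := sum_hop (fun z => c - z) fr cx; rewrite -!/(energy _ _).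
by have := framed_can fr cx; lia.
Qed.

Lemma mass_run c f a : framed c f -> valid f a -> mass c (run f a) = mass c f.
Proof.
elim: a f => //= h a IH f fr /andP[ch va].
by rewrite IH ?mass_act //; apply: framed_act.
Qed.

Lemma energy_run c f a : framed c f -> valid f a -> proper a ->
  energy c f = energy c (run f a) + size a.
Proof.
elim: a f => [|[x|] a IH] f fr //=; first by rewrite addn0.
rewrite -/(can f (Some x)) => /andP[ch va] pa.
by rewrite (energy_hop fr ch) (IH _ (framed_act fr ch) va pa) addnS.
Qed.

(** The boundary of a shape without corners first goes up and then right, so that
    the number of its horizontal edges says where it turns. *)
Lemma stuck_eq c f g : framed c f -> framed c g -> stuck f -> stuck g ->
  mass c f = mass c g -> f = g.
Proof.
have mono h : stuck h -> forall z d, h z -> h (z + d).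
  move=> sh z d hz; elim: d => [|d IH]; first by rewrite addn0.
  by have := sh (z + d); rewrite /= IH /= negbK addnS.
have le f1 f2 z : framed c f1 -> framed c f2 -> stuck f1 -> stuck f2 ->
    f1 z -> ~~ f2 z -> mass c f2 < mass c f1.
  move=> fr1 fr2 s1 s2 h1 h2.
  have zc : z < c by rewrite ltnNge; apply: contra h2 => /(proj2 fr2).
  rewrite /mass (bigD1 (Ordinal zc)) // [X in _ < X](bigD1 (Ordinal zc)) //=.
  rewrite h1 (negPf h2) add0n add1n ltnS; apply: leq_sum => i _.
  case f2i : (f2 i) => //.
  have zi : z < i.
    rewrite ltnNge; apply: contra h2 => iz.
    by have := mono _ s2 i (z - i) f2i; rewrite subnKC.
  by have := mono _ s1 z (i - z) h1; rewrite subnKC ?(ltnW zi) // => ->.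
move=> frf frg sf sg e; apply: functional_extensionality => z.
case fz: (f z); case gz: (g z) => //.
  by have := le _ _ z frf frg sf sg fz (negbT gz); rewrite e ltnn.
by have := le _ _ z frg frf sg sf gz (negbT fz); rewrite e ltnn.
Qed.

Lemma exhaust c f : framed c f ->
  exists a, [/\ valid f a, proper a & stuck (run f a)].
Proof.
have [m] := ubnP (energy c f); elim: m f => // m IH f le fr.
have [[x xc]|no] : (exists x, x < c /\ can f (Some x)) \/ stuck f.
- case: (boolP [exists x : 'I_c, can f (Some (val x))]) => [/existsP[x cx]|/existsPn no].
    by left; exists x.
  right=> x; apply/negP => cx; have /andP[_ xc] := framed_can fr cx.
  by move/negP: (no (Ordinal (ltnW xc))); apply.
- case: xc => xc cx; have [|a [va pa sa]] := IH (hop x f) _ (framed_act fr cx).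
    by rewrite (energy_hop fr cx) in le.
  by exists (Some x :: a); split=> //; apply/andP.
by exists [::].
Qed.

Lemma exhaust_to c f F : framed c f -> framed c F -> stuck F -> mass c f = mass c F ->
  exists a, [/\ valid f a, proper a & run f a = F].
Proof.
move=> fr frF sF e; have [a [va pa sa]] := exhaust fr; exists a; split=> //.
apply: (stuck_eq (framed_run fr va) frF sa sF).
by rewrite mass_run.
Qed.

(** * Shapes met by an evacuated word of a rectangle *)

Lemma cross_exists t a b : exists b' a',
  conn (mk t a ++ mk (~~ t) b) (mk (~~ t) b' ++ mk t a').
Proof.
elim/last_ind: a b => [|a h IH] b.
  by exists b, [::]; rewrite cats0; apply: ConnRefl.
have [b' [a' cn]] := IH (push h b).1.
exists b', (rcons a' (push h b).2).
have e1 l : mk t (rcons a h) ++ l = mk t a ++ (t, h) :: l.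
  by rewrite /mk map_rcons cat_rcons.
have e2 l y : mk t (rcons l y) = mk t l ++ [:: (t, y)].
  by rewrite /mk map_rcons cats1.
rewrite e1 e2 catA; apply: ConnTrans (conn_cat cn (ConnRefl _)).
rewrite -catA; apply: conn_cat (ConnRefl _) _; exact: push_conn.
Qed.

(** Combine the independence of [a'] from [b] and of [b'] from [a] in a third
    square: what remains of the square is governed by the shape between its
    legs. *)
Lemma square_mid c t g F a1 b1 b1' a1' a2 b2 b2' a2' :
  framed c g -> stuck (rotc c g) -> stuck F ->
  Square t g F a1 b1 b1' a1' -> Square t g F a2 b2 b2' a2' ->
  run g a1 = run g a2 -> run g b1' = run g b2'.
Proof.
move=> fr sg sF sq1 sq2 e.
have [b' [a' cn]] := cross_exists t a1 b2.
have [[va1 _ _ _] _] := square_valid sq1; have [[_ vb2 _ _] [r2 _]] := square_valid sq2.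
have sq : Square t g F a1 b2 b' a'.
  by split=> //; rewrite ?valid_cat ?run_cat e ?va1.
have [-> _] := square_fst sF (proj2 fr) sq1 sq.
by rewrite (square_snd sg fr sq sq2).
Qed.

(** The rectangle with n rows and n+1 columns. *)
Definition full (n : nat) : config := fun z => (0 < z <= n.+1) || (n.*2.+2 <= z).
Definition empty (n : nat) : config := fun z => n.+1 <= z.
Notation width n := (n.*2.+2).

Lemma framed_full n : framed (width n) (full n).
Proof. by split=> // z cz; rewrite /full cz orbT. Qed.

Lemma framed_empty n : framed (width n) (empty n).
Proof. by split=> // z cz; rewrite /empty; lia. Qed.

Lemma stuck_empty n : stuck (empty n).
Proof. by move=> x; rewrite /= /empty; lia. Qed.

Lemma rot_empty n : rotc (width n) (empty n) = full n.
Proof.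
by apply: functional_extensionality => z; rewrite /rotc /empty /full; case: ifP; lia.
Qed.

Lemma rot_full n : rotc (width n) (full n) = empty n.
Proof. by rewrite -rot_empty rotcK. Qed.

Lemma mass_rotc c f : mass c (rotc c f) = mass c f.
Proof.
case: c => [|c]; first by rewrite /mass !big_ord0.
rewrite /mass !big_ord_recl /=; congr (_ + _).
rewrite [RHS](reindex_inj rev_ord_inj) /=; apply: eq_bigr => i _.
rewrite /rotc /bump /= ?add1n ifT; last by have := ltn_ord i; lia.
by congr (nat_of_bool (f _)); have := ltn_ord i; lia.
Qed.

Lemma mass_full n : mass (width n) (full n) = mass (width n) (empty n).
Proof. by rewrite -rot_empty mass_rotc. Qed.

(** The standard tableaux on the rectangle, as words of contents. *)
Definition complete (n : nat) (zs : seq step) : Prop :=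
  [/\ valid (full n) zs, proper zs & run (full n) zs = empty n].

Lemma complete_rots n zs : complete n zs -> complete n (rots (width n) zs).
Proof.
move=> [v p r]; have [] := rots_valid (framed_full n) v.
by rewrite r rot_empty rot_full; split; rewrite ?proper_rots.
Qed.

Lemma complete_evac n zs : complete n zs -> complete n (evac zs).
Proof. by move=> [v p r]; have [v' r'] := evac_valid v; split; rewrite ?evac_proper ?r'. Qed.

Lemma complete_size n zs1 zs2 : complete n zs1 -> complete n zs2 -> size zs1 = size zs2.
Proof.
move=> [v1 p1 r1] [v2 p2 r2].
have := energy_run (framed_full n) v1 p1; have := energy_run (framed_full n) v2 p2.
by rewrite r1 r2 => -> /addnI.
Qed.

(** The shape with [k] boxes that the evacuated word passes through. *)
Definition evac_shape (n : nat) (zs : seq step) (k : nat) : config :=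
  run (full n) (take (size zs - k) (evac zs)).

(** By [evac_cat], after switching the first [k] steps past the rest. *)
Lemma evac_shape_square n t zs k : complete n zs -> k <= size zs -> exists b' a',
  Square t (full n) (empty n) (evac (take k zs)) (drop k zs) b' a' /\
  run (full n) (evac (take k zs)) = run (full n) (take k zs) /\
  run (full n) b' = evac_shape n zs k.
Proof.
move=> [v p r] le; have [b' [a' [e sa sb cn]]] := evac_cat t (take k zs) (drop k zs).
rewrite cat_take_drop in e; have := v; have := r.
rewrite -{1 2}(cat_take_drop k zs) run_cat valid_cat => r1 /andP[v1 v2].
have [v1' r1'] := evac_valid v1.
have sq : Square t (full n) (empty n) (evac (take k zs)) (drop k zs) b' a'.
  by split=> //; rewrite ?valid_cat ?run_cat ?v1' r1'.
have [[_ _ vb _] _] := square_valid sq; have [_ rb] := evac_valid vb.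
exists b', a'; split=> //; split=> //.
rewrite /evac_shape e take_size_cat ?rb // size_evac sb size_drop; lia.
Qed.

(** The shape with [k] boxes of the evacuated word depends only on the shape of
    the original word after [k] removals, and conversely; so evacuation permutes
    the shapes, independently of the tableaux that contain them. *)
Lemma evac_shape_fun n zs1 zs2 k1 k2 : complete n zs1 -> complete n zs2 ->
  k1 <= size zs1 -> k2 <= size zs2 ->
  run (full n) (take k1 zs1) = run (full n) (take k2 zs2) -> evac_shape n zs1 k1 = evac_shape n zs2 k2.
Proof.
move=> c1 c2 le1 le2 e.
have [b1 [a1 [sq1 [e1 <-]]]] := evac_shape_square true c1 le1.
have [b2 [a2 [sq2 [e2 <-]]]] := evac_shape_square true c2 le2.
apply: (square_mid (framed_full n) _ (@stuck_empty n) sq1 sq2); last by rewrite e1 e2.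
by rewrite rot_full; apply: stuck_empty.
Qed.

Lemma evac_shape_inj n zs1 zs2 k1 k2 : complete n zs1 -> complete n zs2 ->
  k1 <= size zs1 -> k2 <= size zs2 ->
  evac_shape n zs1 k1 = evac_shape n zs2 k2 -> run (full n) (take k1 zs1) = run (full n) (take k2 zs2).
Proof.
move=> c1 c2 le1 le2.
have [b1 [a1 [sq1 [<- <-]]]] := evac_shape_square true c1 le1.
have [b2 [a2 [sq2 [<- <-]]]] := evac_shape_square true c2 le2.
apply: (square_mid (framed_full n) _ (@stuck_empty n) (square_sym sq1) (square_sym sq2)).
by rewrite rot_full; apply: stuck_empty.
Qed.

Lemma hop_eq_neq f g a x : hop a f = hop x g -> a != x ->
  [/\ f x = false, f x.+1 = true &
      forall z, z != a -> z != a.+1 -> z != x -> z != x.+1 -> f z = g z].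
Proof.
move=> e nax; have A z : hop a f z = hop x g z by rewrite e.
have xa : x != a.+1 by apply/eqP => xa; move: (A x); rewrite hop_lo xa hop_hi.
have ax : a != x.+1 by apply/eqP => ax; move: (A a); rewrite hop_lo ax hop_hi.
split.
- by move: (A x); rewrite hop_lo hop_out // eq_sym.
- by move: (A x.+1); rewrite hop_hi hop_out //; lia.
by move=> z n1 n2 n3 n4; move: (A z); rewrite !hop_out.
Qed.

Lemma cover_uniq f g a b x y : can f (Some a) -> can f (Some b) ->
  can g (Some x) -> can g (Some y) -> x != y ->
  hop a f = hop x g -> hop b f = hop y g -> f = g.
Proof.
move=> ca cb cx cy nxy e1 e2.
have [ax|nax] := eqVneq a x; first by rewrite ax in ca e1; apply: (hop_inj ca cx e1).
have [bY|nby] := eqVneq b y; first by rewrite bY in cb e2; apply: (hop_inj cb cy e2).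
exfalso; have [fx fx1 _] := hop_eq_neq e1 nax; have [_ _ A2] := hop_eq_neq e2 nby.
move: cb cx cy => /andP[fb fb1] /andP[gx gx1] /andP[gy gy1].
have xb : x = b.+1.
  apply/eqP/negPn/negP => xb; have := A2 x; rewrite fx gx; case/(_ _ xb nxy _)/Bool.diff_false_true.
    by apply/eqP => xb'; rewrite -xb' fx in fb.
  by apply/eqP => xy; rewrite xy (negPf gy1) in gx.
have := A2 x.+1; rewrite fx1 (negPf gx1); case/(_ _ _ _ _)/Bool.diff_true_false; try lia.
by apply/eqP => xy; rewrite xy gy in gx1.
Qed.

Lemma valid_take f a k : valid f a -> valid f (take k a).
Proof. by rewrite -{1}(cat_take_drop k a) valid_cat => /andP[]. Qed.

Lemma run_take_next f a k : valid f a -> k < size a ->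
  can (run f (take k a)) (nth None a k) /\
  act (nth None a k) (run f (take k a)) = run f (take k.+1 a).
Proof.
move=> va lt; have := valid_take k.+1 va.
by rewrite (take_nth None lt) -cats1 valid_cat run_cat /= andbT => /andP[].
Qed.

Lemma evac_shape_step n zs k : complete n zs -> k < size zs ->
  exists a, [/\ nth None (evac zs) (size zs - k.+1) = Some a,
                can (evac_shape n zs k.+1) (Some a) & hop a (evac_shape n zs k.+1) = evac_shape n zs k].
Proof.
move=> cz lt; have [ve pe re] := complete_evac cz.
have lt' : size zs - k.+1 < size (evac zs) by rewrite size_evac; lia.
have [c1 e1] := run_take_next ve lt'.
have sE : (size zs - k.+1).+1 = size zs - k by lia.
rewrite sE in e1.
have := all_nthP None pe _ lt'; case E: (nth _ _ _) c1 e1 => [a|] // c1 e1 _.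
by exists a.
Qed.

Lemma evac_shape0 n zs : complete n zs -> evac_shape n zs 0 = empty n.
Proof.
by move=> cz; have [_ _ <-] := complete_evac cz; rewrite /evac_shape subn0 take_oversize // size_evac.
Qed.

(** Suppose that [f] and [g] both cover the shape [h], that [g] has no other
    corner, and that two more boxes can be removed from [h]. New corners of
    [h] are neighbours of [x]. Since [p] and [q] cannot both be neighbours of the
    box [a] as well, one of them is already a corner of [f]. *)
Lemma second_corner f g a x p q : hop a f = hop x g -> a != x ->
  can f (Some a) -> can g (Some x) -> (forall y, can g (Some y) -> y = x) ->
  can (hop a f) (Some p) -> can (hop p (hop a f)) (Some q) ->
  exists2 b, b != a & can f (Some b).
Proof.
set h := hop a f => e nax ca cx uniq cp cq.
have ha : h a = false by rewrite /h hop_lo.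
have ha1 : h a.+1 = true by rewrite /h hop_hi.
have hx : h x = false by rewrite e hop_lo.
have hx1 : h x.+1 = true by rewrite e hop_hi.
have near y : can h (Some y) -> (y.+1 == x) || (x.+1 == y).
  move=> cy; apply/negPn/negP => /norP[n1 n2].
  have nxy : x != y by apply/eqP => xy; move: cy; rewrite -xy /= hx.
  by move: cy; rewrite e can_hop // => /uniq yx; rewrite yx eqxx in nxy.
have done_ y : can h (Some y) -> y.+1 != a -> a.+1 != y -> exists2 b, b != a & can f (Some b).
  move=> cy n1 n2; have nya : y != a by apply/eqP => ya; move: cy; rewrite ya /= ha.
  by exists y => //; move: cy; rewrite can_hop // eq_sym.
have np := near p cp.
have [pa|] := boolP ((p.+1 == a) || (a.+1 == p)); last by move=> /norP[]; apply: done_.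
have [qp|/norP[n1 n2]] := boolP ((q.+1 == p) || (p.+1 == q)).
  exfalso; move: cq => /andP[q0 q1].
  have [e1|e1] : q = p.+1 \/ p = q.+1 by clear -qp; lia.
    have f1 : q.+1 != p by clear -e1; lia.
    have f2 : q.+1 != p.+1 by clear -e1; lia.
    have [e2|e2] : q = a \/ q = x by clear -e1 np pa nax; lia.
      by move: q1; rewrite hop_out // e2 ha1.
    by move: q1; rewrite hop_out // e2 hx1.
  have f1 : q != p by clear -e1; lia.
  have f2 : q != p.+1 by clear -e1; lia.
  have [e2|e2] : q = a \/ q = x by clear -e1 np pa nax; lia.
    by move: q0; rewrite hop_out // e2 ha.
  by move: q0; rewrite hop_out // e2 hx.
have npq : p != q by apply/eqP => pq; move: cq; rewrite -pq /= hop_lo.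
move: cq; rewrite can_hop // => cq; have nq := near q cq.
by apply: (done_ q cq); clear -np nq pa nax n1 n2 npq; lia.
Qed.

Definition lt_step (a b : step) : bool :=
  if a is Some x then if b is Some y then x < y else false else false.

(** Successive boxes never lie on the same diagonal, and a slide past the third
    box moves contents by at most one. *)
Lemma sw2_sign f a b y : valid f [:: Some a; Some b; Some y] ->
  let: (y1, b1) := sw (Some b) (Some y) in
  let: (y2, a1) := sw (Some a) y1 in lt_step a1 b1 = (a < b).
Proof.
move=> /and4P[ca cb cy _]; rewrite /act in cb cy.
have nab : a != b by apply/eqP => ab; move: cb; rewrite -ab /= hop_lo.
have nby : b != y by apply/eqP => bY; move: cy; rewrite -bY /= hop_lo.
have [far|near] := boolP ((b.+1 != y) && (y.+1 != b)).
  have /andP[n1 n2] := far; rewrite sw_far //.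
  have [far'|near'] := boolP ((a.+1 != y) && (y.+1 != a)).
    by have /andP[n3 n4] := far'; rewrite sw_far.
  by rewrite sw_near /=; lia.
rewrite sw_near; last lia.
have [far'|near'] := boolP ((a.+1 != b) && (b.+1 != a)).
  have /andP[n3 n4] := far'; rewrite sw_far //=; lia.
rewrite sw_near /=; last lia.
suff : y != a by lia.
apply/eqP => ya; move: cy => /andP[]; rewrite ya => c1 c2.
have [e|e] : b = a.+1 \/ a = b.+1 by lia.
  by move: c1; rewrite e hop_out ?hop_lo; lia.
by move: c2; rewrite hop_out ?hop_hi; lia.
Qed.

(** Sliding preserves descents: pushed through [zs], the first two steps keep the
    relative order of their contents. *)
Lemma push2_sign f a b zs : valid f [:: Some a, Some b & zs] -> proper zs ->
  let: (r, y) := push (Some b) zs in lt_step (push (Some a) r).2 y = (a < b).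
Proof.
elim: zs f a b => [|[z|] zs IH] f a b // /and4P[ca cb cz vs] /= pz.
have := @sw2_sign f a b z; rewrite /= -/(can _ (Some a)) -/(can _ (Some b)) -/(can _ (Some z)).
rewrite ca cb cz => /(_ isT).
case E1: (sw (Some b) (Some z)) => [z1 b1]; case E2: (sw (Some a) z1) => [z2 a1].
have [cz1 cb1 e1] := swP cb cz E1; have [cz2 ca1 e2] := swP ca cz1 E2.
have := isSome_sw (Some b) (Some z); rewrite E1 => -[] /=.
case: z1 E1 E2 cz1 cb1 e1 cz2 ca1 e2 => // z1; case: b1 => // b1 E1 E2 cz1 cb1 e1 cz2 ca1 e2 _ _.
have := isSome_sw (Some a) (Some z1); rewrite E2 => -[] /=.
case: z2 E2 cz2 ca1 e2 => // z2; case: a1 => // a1 E2 cz2 ca1 e2 _ _ /= <-.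
have := IH (hop z2 f) a1 b1; case: (push (Some b1) zs) => r y IH'.
rewrite /= E2; case: (push (Some a1) r) IH' => r' y' /= -> //.
move: ca1 e2 cb1 e1 vs; rewrite /act => ca1 e2 cb1 e1 vs.
by apply/and3P; split=> //; rewrite /act e2 ?e1.
Qed.

(** * Evacuation of a rectangle is its rotation *)

Lemma complete_cat n a b f : valid (full n) a -> proper a -> run (full n) a = f ->
  valid f b -> proper b -> run f b = empty n -> complete n (a ++ b).
Proof.
by move=> va pa <- vb pb rb; split; rewrite ?valid_cat ?proper_cat ?run_cat ?va ?pa ?vb ?pb.
Qed.

Lemma complete_split n zs k : complete n zs ->
  [/\ valid (full n) (take k zs), proper (take k zs) &
      [/\ valid (run (full n) (take k zs)) (drop k zs), proper (drop k zs)
        & run (run (full n) (take k zs)) (drop k zs) = empty n]].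
Proof.
move=> [+ + +]; rewrite -{1 2 3}(cat_take_drop k zs) valid_cat proper_cat run_cat.
by move=> /andP[? ?] /andP[? ?] ?.
Qed.

(** Any removal [w] from the rotated shape extends to a tableau with the same
    shape after [k.+1] removals, to which the induction hypothesis applies. *)
Lemma evac_shape_pre n k zs w :
  (forall zs', complete n zs' -> k <= size zs' ->
     evac_shape n zs' k = rotc (width n) (run (full n) (take k zs'))) ->
  complete n zs -> k < size zs ->
  let g := rotc (width n) (run (full n) (take k.+1 zs)) in
  can g (Some w) -> exists b, can (evac_shape n zs k.+1) (Some b) /\
                              hop b (evac_shape n zs k.+1) = hop w g.
Proof.
move=> IH cz lt g cw.
have [vt pt [vd pd rd]] := complete_split k.+1 cz.
have frt := framed_run (framed_full n) vt; have frg : framed (width n) g by apply: framed_rotc.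
have frw := framed_act frg cw.
have [d [vD pD rD]] : exists d, [/\ valid (hop w g) d, proper d & run (hop w g) d = empty n].
  apply: exhaust_to frw (framed_empty n) (@stuck_empty n) _.
  by rewrite (mass_act frg cw) mass_rotc (mass_run (framed_full n) vt) mass_full.
have [vr rr] := rots_valid frw vD; rewrite rD rot_empty in vr rr.
have [cr er] := rot_can frg cw; rewrite [rotc _ g]rotcK in er.
set zs2 := (rots (width n) d ++ [:: rot_step (width n) (Some w)]) ++ drop k.+1 zs.
have v1 : valid (full n) (rots (width n) d ++ [:: rot_step (width n) (Some w)]).
  by rewrite valid_cat vr rr /= andbT.
have r1 : run (full n) (rots (width n) d ++ [:: rot_step (width n) (Some w)]) =
    run (full n) (take k.+1 zs) by rewrite run_cat rr.
have p1 : proper (rots (width n) d ++ [:: rot_step (width n) (Some w)]).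
  by rewrite proper_cat proper_rots pD.
have cz2 : complete n zs2 by apply: complete_cat v1 p1 r1 vd pd rd.
have sz := complete_size cz2 cz.
have sd : size d = k.
  by move: sz; rewrite /zs2 !size_cat size_rots /= size_drop; clear -lt; lia.
have t1 : take k.+1 zs2 = rots (width n) d ++ [:: rot_step (width n) (Some w)].
  by rewrite /zs2 take_size_cat // size_cat size_rots sd addn1.
have t0 : take k zs2 = rots (width n) d.
  by rewrite /zs2 -catA take_size_cat // size_rots sd.
have lt2 : k < size zs2 by rewrite sz.
rewrite -(@evac_shape_fun n zs2 zs k.+1 k.+1) ?t1 //.
have [a [_ ca ea]] := evac_shape_step cz2 lt2.
by exists a; rewrite ea IH ?t0 ?rr ?rotcK //; apply: ltnW.
Qed.

(** If the rotated shape has two corners, then [evac_shape_pre] gives two shapes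
    covered by both shapes. *)
Lemma evac_shape_two n k zs x y :
  (forall zs', complete n zs' -> k <= size zs' ->
     evac_shape n zs' k = rotc (width n) (run (full n) (take k zs'))) ->
  complete n zs -> k < size zs ->
  let g := rotc (width n) (run (full n) (take k.+1 zs)) in
  can g (Some x) -> can g (Some y) -> x != y -> evac_shape n zs k.+1 = g.
Proof.
move=> IH cz lt g cx cy nxy.
have [a [ca ea]] := evac_shape_pre IH cz lt cx; have [b [cb eb]] := evac_shape_pre IH cz lt cy.
exact: cover_uniq ca cb cx cy nxy ea eb.
Qed.

Lemma hop_empty n f x : can f (Some x) -> hop x f = empty n -> x = n.
Proof.
move=> cx e; have := congr1 (fun h => h x) e; have := congr1 (fun h => h x.+1) e.
by rewrite /= hop_lo hop_hi /empty; lia.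
Qed.

Lemma hop_one n f h x : hop n h = empty n -> can h (Some n) -> hop x f = h ->
  x.+1 = n \/ x = n.+1.
Proof.
move=> e /andP[h0 h1] eh.
have hx : h x = false by rewrite -eh hop_lo.
have hx1 : h x.+1 = true by rewrite -eh hop_hi.
have out z : z != n -> z != n.+1 -> h z = (n < z).
  by move=> n1 n2; have := congr1 (fun f => f z) e; rewrite /= hop_out.
have nx : x != n by apply/eqP => xn; rewrite xn h0 in hx.
have [->|nx1] := eqVneq x n.+1; first by right.
have [->|nx2] := eqVneq x.+1 n; first by left.
move: hx hx1; rewrite !out //; lia.
Qed.

(** Of two boxes, the second one is to the right of or below the first, and
    which of the two is decided by the relative order of the last two contents of
    the evacuated word. By [push2_sign] it is that of the first two contents of
    the word itself. *)
Lemma evac_shape_base n zs a x0 : complete n zs -> 1 < size zs ->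
  nth None (evac zs) (size zs - 2) = Some a ->
  rot_step (width n) (nth None zs 1) = Some x0 ->
  x0.+1 = n \/ x0 = n.+1 -> a.+1 = n \/ a = n.+1 -> 0 < n -> a = x0.
Proof.
move=> cz lt ea ex hx ha n0; case: (cz) => v p r.
case: zs cz lt ea ex v p r => [|[z0|] [|[z1|] zs]] // cz _ ea [ex] v p r.
have [_ cz0 [_ _ _]] := complete_split 1 cz.
have /andP[c0 v1] := v.
have [cr er] := rot_can (framed_full n) c0; rewrite rot_full in er.
have z0E : z0 = n.+1.
  have := hop_empty cr er; have /andP[] := framed_can (framed_full n) c0; lia.
have /andP[c1 v2] := v1.
have /andP[z1a z1b] := framed_can (framed_act (framed_full n) c0) c1.
have near : sw (Some z0) (Some z1) = (Some z0, Some z1) by apply: sw_near; lia.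
have pz : proper zs by move: p.
have := push2_sign v pz.
move: ea; rewrite evac_cons /= near; case E1: (push (Some z1) zs) => [r1 y1] /=.
rewrite evac_cons; set E0 := evac _; set y0 := (push _ _).2.
have sE : size E0 = size zs.
  by rewrite /E0 size_evac size_push; have := size_push (Some z1) zs; rewrite E1.
rewrite !nth_rcons size_rcons sE (_ : _ - 2 = size zs) ?ltnSn ?ltnn ?eqxx; last by rewrite /=; lia.
move=> ->.
have y1E : y1 = Some n.
  have [ve pe re] := complete_evac cz.
  move: ve pe re; rewrite evac_cons /= near E1 /= -cats1 valid_cat proper_cat run_cat /=.
  move=> /and3P[_ cy _] /and3P[_ sy _]; case: y1 E1 cy sy => // y1 _ cy _ ey.
  by rewrite (hop_empty cy ey).
rewrite y1E /= z0E; clear -hx ha n0 ex z1a z1b; lia.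
Qed.

(** Evacuation rotates every shape of a rectangular tableau. By induction on [k],
    the shape with k+1 boxes and its candidate [g] cover the same shape. If [g]
    has two corners this suffices by [evac_shape_two]. Otherwise, were the two
    shapes different, the first would have two corners by [second_corner]; then
    the claim holds for the rotated evacuated word, and [evac_shape_inj] carries
    it back. Shapes with at most two boxes are treated directly. *)
Lemma evac_shape_rot n k zs : complete n zs -> k <= size zs ->
  evac_shape n zs k = rotc (width n) (run (full n) (take k zs)).
Proof.
elim: k zs => [|k IH] zs cz lt; first by rewrite evac_shape0 // take0 rot_full.
move gE: (rotc _ _) => g.
have [vz pz rz] := cz; have [cz1 ez1] := run_take_next vz lt.
have [vt pt [vd pd rd]] := complete_split k cz.
have frt := framed_run (framed_full n) vt.
have [cr er] := rot_can frt cz1; rewrite ez1 gE in cr er.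
have := all_nthP None pz _ lt; case E: (nth None zs k) cz1 ez1 cr er => [z|] // cz1 ez1 cr er _.
rewrite /rot_step /= -/(rot_step _ _) in cr er.
set x0 := _ - z in cr er.
have [a [Ea ca ea]] := evac_shape_step cz lt.
rewrite -IH // in er; last exact: ltnW.
have e : hop a (evac_shape n zs k.+1) = hop x0 g by rewrite ea.
have [ax|nax] := eqVneq a x0; first by rewrite ax in ca e; apply: hop_inj ca cr e.
have frg : framed (width n) g.
  by rewrite -gE; apply: framed_rotc; apply: framed_run (valid_take _ vz); apply: framed_full.
case: (boolP [exists y : 'I_(width n), can g (Some (val y)) && (x0 != y)]) =>
    [/existsP[y /andP[cy nxy]]|/existsPn uniq].
  by rewrite -gE in cr cy *; apply: (evac_shape_two IH cz lt cr cy nxy).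
have {}uniq y : can g (Some y) -> y = x0.
  move=> cy; have /andP[_ yc] := framed_can frg cy; apply/eqP.
  by have := uniq (Ordinal (ltnW yc)); rewrite cy negbK eq_sym.
destruct k as [|k].
  case/eqP: nax; rewrite evac_shape0 // in e ea er.
  by rewrite (hop_empty ca ea) (hop_empty cr er).
have [p [_ cp ep]] := evac_shape_step cz (ltnW lt).
rewrite -ea in cp.
destruct k as [|k].
  rewrite ea in cp; rewrite evac_shape0 // in ep.
  have pn := hop_empty cp ep; rewrite pn in cp ep.
  have ha := hop_one ep cp ea; have hx := hop_one ep cp er.
  case/eqP: nax; apply: (evac_shape_base cz lt Ea) => //.
    by rewrite E.
  have /andP[] := framed_can frg cr; have /andP[] := framed_can (framed_run (framed_full n) vt) cz1.
  by clear -hx; lia.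
have [q [_ cq eq_]] := evac_shape_step cz (ltnW (ltnW lt)).
rewrite -ep -ea in cq.
have [b nba cb] := second_corner e nax ca cr uniq cp cq.
have cE := complete_evac cz; have [vE pE rE] := cE.
have cz3 := complete_rots cE; set m := size zs - k.+3 in ca cb.
have [vt3 pt3 [vd3 pd3 rd3]] := complete_split (size zs - k.+3) cE.
have t3 : take k.+3 (rots (width n) (evac zs)) = rots (width n) (drop (size zs - k.+3) (evac zs)).
  rewrite -{1}(cat_take_drop (size zs - k.+3) (evac zs)) rots_cat take_size_cat //.
  by rewrite size_rots size_drop size_evac; clear -lt; lia.
have r3 : run (full n) (take k.+3 (rots (width n) (evac zs))) = rotc (width n) (evac_shape n zs k.+3).
  rewrite t3; have [_ <-] := rots_valid (framed_run (framed_full n) vt3) vd3.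
  by rewrite rd3 rot_empty.
have sz3 : size (rots (width n) (evac zs)) = size zs by rewrite size_rots size_evac.
have lt3 : k.+2 < size (rots (width n) (evac zs)) by rewrite sz3.
have p3 : evac_shape n (rots (width n) (evac zs)) k.+3 = evac_shape n zs k.+3.
  have := @evac_shape_two n k.+2 _ a b IH cz3 lt3; rewrite r3 rotcK => -> //.
  by rewrite eq_sym.
have := evac_shape_inj cz3 cz lt3 lt p3; rewrite r3 => e3.
by rewrite -gE -e3 rotcK.
Qed.

Lemma can_act_inj f g h1 h2 : isSome h1 -> isSome h2 -> can f h1 -> can f h2 ->
  f = g -> act h1 f = act h2 g -> h1 = h2.
Proof.
case: h1 h2 => [x|] [y|] // _ _ cx cy <- /= e; congr Some.
have [//|n] := eqVneq x y.
have [fx _ _] := hop_eq_neq e n; by move: cy => /= /andP[]; rewrite fx.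
Qed.

Lemma path_eq f a b : valid f a -> valid f b -> proper a -> proper b -> size a = size b ->
  (forall k, k <= size a -> run f (take k a) = run f (take k b)) -> a = b.
Proof.
elim: a f b => [|h a IH] f [|h' b] //= /andP[ch va] /andP[ch' vb] /andP[sh pa] /andP[sh' pb].
move=> [sz] H; have := H 1 isT; rewrite /= !take0 /= => e1.
have eh := can_act_inj sh sh' ch ch' erefl e1; subst h'; congr cons.
apply: (IH (act h f)) => // k lt; exact: (H k.+1).
Qed.

(** Schutzenberger's theorem: by [evac_shape_rot] both words pass through the same
    shapes. *)
Lemma evac_rots n zs : complete n zs -> evac zs = rots (width n) zs.
Proof.
move=> cz; have [ve pe re] := complete_evac cz; have [vr pr rr] := complete_rots cz.
apply: (path_eq ve vr pe pr); rewrite ?size_rots ?size_evac // => k le.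
have [v p r] := cz; have := @evac_shape_rot n (size zs - k) zs cz (leq_subr _ _).
rewrite /evac_shape subKn // => ->.
have [vt pt [vd pd rd]] := complete_split (size zs - k) cz.
have [_ <-] := rots_valid (framed_run (framed_full n) vt) vd.
have -> : rots (width n) zs = rots (width n) (drop (size zs - k) zs) ++
    rots (width n) (take (size zs - k) zs) by rewrite -rots_cat cat_take_drop.
rewrite rd rot_empty take_size_cat //.
by rewrite size_rots size_drop subKn.
Qed.

Lemma square_rotc n t a b b' a' : proper (a ++ b) ->
  Square t (full n) (empty n) a b b' a' -> run (full n) b' = rotc (width n) (run (full n) a).
Proof.
move=> p sq; have [v r _] := sq; have cz : complete n (a ++ b) by [].
have le : size a <= size (a ++ b) by rewrite size_cat leq_addr.
have [b1 [a1 [sq1 [e1 e2]]]] := evac_shape_square t cz le.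
have := evac_shape_rot cz le; rewrite -e2 take_size_cat // => <-.
apply: (square_mid (framed_full n) _ (@stuck_empty n) sq sq1).
  by rewrite rot_full; apply: stuck_empty.
by rewrite e1 take_size_cat.
Qed.

(** * Self-mirrored shapes and twin removals *)

Lemma rule_cases K t f h u h' u' : local_rule K t f h u = (h', u') ->
  (exists x, [/\ h = Some x, u = Some x, h' = landing K t f x & u' = landing K t f x]) \/
  [/\ h' = h, u' = u & h = u -> h = None].
Proof.
case: h u => [x|] [y|]; [| by move=> [<- <-]; right..].
have [->|n] := eqVneq x y; first by rewrite rule_eq => -[<- <-]; left; exists y.
by rewrite rule_neq // => -[<- <-]; right; split=> // -[] e; rewrite e eqxx in n.
Qed.

(** Shapes invariant under the reflection that exchanges row i, column j with row
    j, column i+1 for j <= i; these are the doubles of shifted shapes. The edge at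
    n+1 lies on the axis and is always horizontal. *)
Definition double (n : nat) (g : config) : Prop :=
  [/\ framed (width n) g, g n.+1 &
      forall p q, p + q = width n -> p <> n.+1 -> g q = ~~ g p].

(** Two boxes exchanged by the reflection, or none. *)
Definition twin (n : nat) (h : step * step) : bool :=
  match h with
  | (Some a, Some b) => a + b == n.*2.+1
  | (None, None) => true
  | _ => false
  end.

(** Twins of which the one above the axis is removed first. *)
Definition down_twin (n : nat) (h : step * step) : bool :=
  twin n h && (if h is (Some a, Some b) then b < a else true).

(** The four edges that change form two mirror pairs, which can overlap only in the
    central edge. *)
Lemma double_push n g a b : double n g -> twin n (a, b) -> can g a -> can (act a g) b ->
  double n (act b (act a g)).
Proof.
case: a b => [a|] [b|] // [fr gc dg] /= /eqP ab ca cb; split.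
- exact: (@framed_act _ _ (Some b) (@framed_act _ _ (Some a) fr ca) cb).
- case/andP: ca => ga ga1; case/andP: cb => gb gb1; rewrite hopE; case: eqP => [nb|nb].
    have an : a = n by clear -nb ab; lia.
    by rewrite an gc in ga1.
  case: eqP => // nb1; rewrite hopE; case: eqP => [na|_]; last by case: eqP.
  by case: nb1; clear -na ab; lia.
move=> p q pq np; have dpq := dg p q pq np.
clear -dpq pq np ab; rewrite !hopE dpq.
have -> : (q == a) = (p == b.+1) by clear -pq ab; lia.
have -> : (q == a.+1) = (p == b) by clear -pq ab; lia.
have -> : (q == b) = (p == a.+1) by clear -pq ab; lia.
have -> : (q == b.+1) = (p == a) by clear -pq ab; lia.
clear dpq; have [p1|_] := eqVneq p a.+1; have [p2|_] := eqVneq p b;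
  have [p3|_] := eqVneq p a; have [p4|_] := eqVneq p b.+1 => //=; exfalso; lia.
Qed.

Lemma double_framed n g : double n g -> framed (width n) g. Proof. by case. Qed.

Lemma double_rotc n g : double n g -> double n (rotc (width n) g).
Proof.
move=> [fr gc dg]; split; first exact: framed_rotc.
  by rewrite /rotc ifT; [rewrite (_ : _ - _ = n.+1) //; clear; lia | clear; lia].
move=> p q pq np; have [p0|p0] := eqVneq p 0.
  have -> : q = width n by move: pq; rewrite p0.
  by rewrite p0 /rotc /= ltnn (proj2 fr) // (negPf (proj1 fr)).
have [q0|q0] := eqVneq q 0.
  have -> : p = width n by move: pq; rewrite q0 addn0.
  by rewrite q0 /rotc /= ltnn (negPf (proj1 fr)) (proj2 fr).
rewrite /rotc !ifT; [|clear -pq p0 q0; lia..].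
rewrite (_ : _ - q = p); last by clear -pq; lia.
rewrite (_ : _ - p = q); last by clear -pq; lia.
by rewrite (dg p q pq np) negbK.
Qed.

(** [double_push] run backwards, by rotating everything. *)
Lemma double_pull n g a b : framed (width n) g -> twin n (a, b) ->
  can g a -> can (act a g) b -> double n (act b (act a g)) -> double n g.
Proof.
move=> fr ab ca cb dg; have fra := framed_act fr ca.
have [ca' ea] := rot_can fr ca; have [cb' eb] := rot_can fra cb.
rewrite -eb in ca' ea; rewrite -(rotcK (width n) g) -ea; apply: double_rotc.
apply: double_push (double_rotc dg) _ cb' ca'; move: ab ca cb.
case: (a) (b) => [x|] [y|] // /eqP xy /(framed_can fr) cx _.
by apply/eqP; move: cx; clear -xy; lia.
Qed.

(** * Grid blocks of two twin pairs *)

Definition mirror (n : nat) (h : step) : step := omap (fun x => n.*2.+1 - x) h.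

(** The reflection exchanges bumps away from the axis on its two sides. They depend
    only on the part of the boundary on their side. *)
Lemma landing_mirror n g f f' x X : double n g -> x + X = n.*2.+1 -> x <= n ->
  (forall z, z < x -> f z = g z) -> (forall z, X.+1 < z -> f' z = g z) ->
  landing (width n) false f x = mirror n (landing (width n) true f' X).
Proof.
move=> [fr gc dg] xX xn ef ef'; have := landingP (width n) true f' X.
case: (landing (width n) true f' X) => [y|] /= H; apply: landingE => /=.
  case: H => Xy yK ny Hz; rewrite ef'// in ny; split.
  - clear -Xy xX yK; lia.
  - rewrite ef; last by clear -Xy xX yK; lia.
    by rewrite (dg y.+1) ?ny //; clear -Xy xX yK xn; lia.
  move=> z Hz'; rewrite ef; last by case/andP: Hz'.
  rewrite (dg (width n - z)); [|clear -Hz' xn; lia..].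
  rewrite negbK -ef' ?Hz //; clear -Hz' xn xX yK; lia.
move=> z zx; rewrite ef // (dg (width n - z)); [|clear -zx xn; lia..].
have [->|z0] := eqVneq z 0.
  by rewrite subn0 (proj2 fr).
rewrite negbK -ef' ?H //; clear -z0 zx xn xX; lia.
Qed.

Lemma act_out h f z : (if h is Some y then (z != y) && (z != y.+1) else true) ->
  act h f z = f z.
Proof. by case: h => // y /andP[n1 n2]; apply: hop_out. Qed.

(** The block of the grid where the pair [u] crosses the pair [h], whose first step
    has the colour of rows and whose second step has that of columns: [x] and [y]
    are the states of [h] after the first and second step of [u], and [w] is what
    [u] becomes. *)
Definition block_out (K : nat) (g : config) (h u : step * step) :=
  let: (x1, v1) := local_rule K true g h.1 u.1 in
  let: (x2, w1) := local_rule K false (act h.1 g) h.2 v1 in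
  let: (y1, v2) := local_rule K true (act u.1 g) x1 u.2 in
  let: (y2, w2) := local_rule K false (act x1 (act u.1 g)) x2 v2 in
  ((x1, x2), (y1, y2), (w1, w2)).

(** The trace that the symmetry of a block leaves in its deaths: the two colours die
    together, the second one a row later. *)
Definition balanced (h x y : step * step) : bool :=
  [&& dead h.1 x.1 == dead x.2 y.2, ~~ dead h.2 x.2 & ~~ dead x.1 y.1].

Lemma dead_self h : dead h h = false. Proof. by case: h. Qed.

(** The only interactions are those between a box and itself or its twin. If [h] and
    [u] consist of the same boxes in the same order, the two bumps are mirror
    images. If they come in opposite orders, the bumps go towards the axis; they
    land on twins, unless both reach the axis, where they meet and bounce back
    to the pair of contents n and n+1. *)
Lemma block_fwd n g h u x y w : double n g -> twin n h -> down_twin n u ->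
  can g h.1 -> can (act h.1 g) h.2 -> can g u.1 -> can (act u.1 g) u.2 ->
  block_out (width n) g h u = (x, y, w) ->
  [/\ twin n y, down_twin n w & balanced h x y].
Proof.
move=> dg; case: h u => h1 h2 [u1 u2] /=.
case: h1 h2 => [a|] [b|] //; last first.
  move=> _ pu _ _ _ _; rewrite /block_out /= ?rule_Nh /= ?rule_Nh /= ?rule_Nh /= => -[<- <- <-].
  by rewrite /balanced.
case: u1 u2 => [X|] [z|] //; last first.
  move=> th _ _ _ _ _; rewrite /block_out /= ?rule_Nu /= ?rule_Nu /= ?rule_Nu => -[<- <- <-].
  by rewrite /balanced /= ?dead_self.
move=> th /andP[/eqP tu zX] ca cb cX cz; have fr := double_framed dg.
have sK : solid (width n) g by case: fr.
move: zX tu cz; move: z => z zX tu cz.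
have zn : z <= n by clear -zX tu; lia.
have [aX|naX] := eqVneq a X.
  subst X; have bz : b = z by clear -th tu zX; move/eqP: th; lia.
  subst z; rewrite /block_out /= rule_eq /=.
  have sd := landing_side (K := width n) (t := true) (f := g) (a := a).
  have Ea : local_rule (width n) false (hop a g) (Some b) (landing (width n) true g a) =
            (Some b, landing (width n) true g a).
    case Y: (landing _ _ _ _) => [y'|]; last by rewrite rule_Nu.
    by rewrite rule_neq //; have := sd _ Y; clear -zX; lia.
  have Eb : local_rule (width n) true (hop a g) (landing (width n) true g a) (Some b) =
            (landing (width n) true g a, Some b).
    case Y: (landing _ _ _ _) => [y'|]; last by rewrite rule_Nh.
    by rewrite rule_neq //; have := sd _ Y; clear -zX; lia.
  rewrite Ea Eb rule_eq => -[<- <- <-].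
  have -> : landing (width n) false (act (landing (width n) true g a) (hop a g)) b =
            mirror n (landing (width n) true g a).
    apply: (@landing_mirror n g) => //; first by clear -tu; lia.
    move=> p pb; rewrite act_out; first by rewrite hop_out //; clear -pb zX; lia.
    by case Y: (landing _ _ _ _) => [y'|] //; have := sd _ Y; clear -pb zX; lia.
  rewrite /balanced /= ?dead_self /=.
  case Y: (landing _ _ _ _) => [y'|] //=; have := landingP (width n) true g a.
  rewrite Y /= => -[ay yK _ _].
  by rewrite /down_twin /twin; split=> //; clear -ay yK zX tu; lia.
have [az|naz] := eqVneq a z; last first.
  rewrite /block_out /= (rule_neq _ _ _ naX) /= rule_neq.
    2: by clear -th tu naz; move/eqP: th; lia.
  rewrite (rule_neq _ _ _ naz) /= rule_neq; last by clear -th tu naX; move/eqP: th; lia.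
  move=> [<- <- <-]; rewrite /balanced /= ?dead_self /= /down_twin /twin.
  by split=> //; clear -tu zX; lia.
subst z; have bX : b = X by clear -th tu zX; move/eqP: th; lia.
subst X; clear th; case: (dg) => _ gc dd.
have an : a < n.
  rewrite ltn_neqAle zn andbT; apply/eqP => an; move: ca => /andP[_].
  by rewrite an gc.
move: (ca) (cb) (cX) => /andP[ga ga1] /andP[gb gb1] /andP[gb' gb1'].
rewrite /block_out /= (rule_neq _ _ _ naX) /= !rule_eq.
have hc : hop a g n.+1 = true by rewrite hop_out //; clear -an; lia.
have nb : n.+1 < b by clear -tu an; lia.
have := landingP (width n) false (hop a g) b.
case E1: (landing (width n) false (hop a g) b) => [z|] /=; last first.
  by move=> H; move: (H n.+1 nb); rewrite hc.
move=> [zb gz Hz].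
have zn1 : n < z.
  rewrite ltnNge; apply/negP => zn1.
  have Hc : z < n.+1 < b by rewrite ltnS zn1.
  by move: (Hz _ Hc); rewrite hc.
have gz' : g z by move: gz; rewrite hop_out //; clear -zn1 an; lia.
have [zc|nzc] := eqVneq z n.+1.
  (* Both bumps reach the central edge. *)
  have E2 : landing (width n) true (hop b g) a = Some n.+1.
    apply: landingE => /=; split; try by clear -an; lia.
      have [->|nb2] := eqVneq n.+2 b; first by rewrite hop_lo.
      rewrite hop_out //; last by clear -tu an; lia.
      by move: (Hz n.+2); rewrite hop_out; [apply; clear -zc nb nb2 tu an; lia | clear -an; lia..].
    move=> p Hp; rewrite hop_out; [|clear -Hp tu an; lia..].
    have [->|np] := eqVneq p n.+1; first by [].
    rewrite (dd (width n - p) p); [|clear -Hp; lia|clear -np Hp; lia].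
    move: (Hz (width n - p)); rewrite hop_out; [|clear -Hp an; lia..].
    by apply; clear -Hp np zc tu; lia.
  rewrite E2 zc rule_eq.
  have -> : landing (width n) false (hop a (hop b g)) n.+1 = Some n.
    apply: landingE => /=; split; [by [] | | by clear; move=> p; lia].
    have [->|na] := eqVneq n a.+1; first by rewrite hop_hi.
    rewrite !hop_out; [|clear -tu an na nb; lia..].
    rewrite (dd n.+2 n); [|clear; lia|clear; lia].
    have [e|nb2] := eqVneq n.+2 b; first by exfalso; clear -e tu na an; lia.
    by move: (Hz n.+2); rewrite hop_out; [apply; clear -zc nb nb2 tu an; lia | clear -an; lia..].
  move=> [<- <- <-]; rewrite /balanced /down_twin /twin.
  by split=> //=; clear; lia.
have E2 : landing (width n) true (hop b g) a = Some (n.*2.+1 - z).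
  apply: landingE => /=; split; try by clear -an tu zn1 nzc nb zb; lia.
    rewrite hop_out; [|clear -an tu zn1 nzc nb zb; lia..].
    by rewrite (dd z) ?gz' //; clear -an tu zn1 nzc nb zb; lia.
  move=> p Hp; rewrite hop_out; [|clear -an tu zn1 nzc nb zb Hp; lia..].
  rewrite (dd (width n - p) p); [|clear -an tu zn1 nzc nb zb Hp; lia..].
  move: (Hz (width n - p)); rewrite hop_out; [|clear -an tu zn1 nzc nb zb Hp; lia..].
  by apply; clear -an tu zn1 nzc nb zb Hp; lia.
rewrite E2 rule_neq; last by clear -an tu zn1 nzc nb zb; lia.
move=> [<- <- <-]; rewrite /balanced /down_twin /twin /=.
by split=> //; clear -an tu zn1 nzc nb zb; lia.
Qed.

(** The first of three lemmas with a common idea: the landing places of two bumps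
    say where the symmetric shape [k] has horizontal and where it has vertical edges,
    and this forces the starting points [x] and [X] to be mirror images. Here the
    bumps move away from the axis, to [y] and [Y]; the ends of the frame take the
    place of these when both insertions end. *)
Lemma mirror_outward n k x X y Y : double n k -> y + Y = n.*2.+1 ->
  y < x -> x < X -> X < Y ->
  (forall z, y < z <= x -> ~~ k z) -> k x.+1 ->
  (forall z, X < z <= Y -> k z) -> (X != x.+1 -> ~~ k X) -> x + X = n.*2.+1.
Proof.
move=> [fr kc dk] yY yx xX XY low kx1 high kX.
apply/eqP; rewrite eqn_leq; apply/andP; split; rewrite leqNgt; apply/negP => lt.
  have [e|ne] := eqVneq X x.+1.
    by move: (low n.+1); rewrite kc => /(_ ltac:(clear -e lt yY yx xX XY; lia)).
  have {}kX := kX ne.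
  have [e|nXc] := eqVneq X n.+1; first by rewrite e kc in kX.
  have := dk X (width n - X); rewrite (negPf kX) => /(_ ltac:(clear -yY XY; lia) (elimN eqP nXc)).
  have := low (width n - X) ltac:(clear -lt yY XY xX; lia).
  by move=> /negPf ->.
have [e|ne] := eqVneq x n; first by clear -e lt xX; lia.
have := dk x.+1 (width n - x.+1); rewrite kx1.
move=> /(_ ltac:(clear -lt; lia) ltac:(clear -ne; lia)).
by rewrite high //; clear -lt yY yx; lia.
Qed.

(** The same for bumps that move towards the axis. *)
Lemma mirror_inward n k x X y Y : double n k -> y + Y = n.*2.+1 ->
  x < y -> y <= n -> Y < X -> ~~ k x ->
  (forall z, x < z <= y -> k z) ->
  (forall z, Y < z <= X -> ~~ k z) -> k X.+1 -> x + X = n.*2.+1.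
Proof.
move=> [fr kc dk] yY xy yn YX kx high low kX1.
apply/eqP; rewrite eqn_leq; apply/andP; split; rewrite leqNgt; apply/negP => lt.
  have := dk x (width n - x); rewrite (negPf kx).
  move=> /(_ ltac:(clear -xy yn; lia) ltac:(clear -xy yn; lia)).
  by rewrite (negPf (low _ _)) //; clear -lt xy yY yn; lia.
have := dk X.+1 (width n - X.+1); rewrite kX1.
move=> /(_ ltac:(clear -lt; lia) ltac:(clear -YX yY yn; lia)).
by rewrite high //; clear -lt YX yY; lia.
Qed.

(** The same for bumps that met on the axis. *)
Lemma mirror_centre n k x X : double n k -> x < n -> n.+1 < X -> ~~ k x ->
  (forall z, x < z <= n.+1 -> k z) ->
  (forall z, n.+1 < z <= X -> ~~ k z) -> k X.+1 -> x + X = n.*2.+1.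
Proof.
move=> dk xn nX kx high low kX1; apply: (@mirror_inward n k x X n n.+1) => //.
  by clear; lia.
by move=> z Hz; apply: high; clear -Hz; lia.
Qed.

(** Block by block, symmetry can be recovered from the output. The equality
    [balanced] excludes that only one of the two bumps occurred; for the cases in
    which they did, see the lemmas on mirror images above. *)
Lemma block_inv n g h u x y w : framed (width n) g ->
  can g h.1 -> can (act h.1 g) h.2 -> can g u.1 -> can (act u.1 g) u.2 ->
  block_out (width n) g h u = (x, y, w) ->
  twin n y -> down_twin n w -> balanced h x y ->
  double n (act y.2 (act y.1 (act u.2 (act u.1 g)))) ->
  [/\ twin n h, down_twin n u & double n g].
Proof.
case: h u x y w => h1 h2 [u1 u2] [x1 x2] [y1 y2] [w1 w2] /= fr ch1 ch2 cu1 cu2.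
rewrite /block_out /=.
case E1: (local_rule _ _ g _ _) => [x1' v1]; case E2: (local_rule _ _ (act h1 g) _ _) => [x2' w1'].
case E3: (local_rule _ _ (act u1 g) _ _) => [y1' v2].
case E4: (local_rule _ _ (act x1' _) _ _) => [y2' w2'] [? ? ? ? ? ?].
subst x1' x2' y1' y2' w1' w2' => ty tw /and3P[/eqP /= bal /= b2 /= b3] dF.
have [cv1 cx1 e1] := ruleP ch1 cu1 E1.
have [cw1 cx2 e2] := ruleP ch2 cv1 E2.
have [cv2 cy1 e3] := ruleP cx1 cu2 E3.
rewrite e1 in cx2 e2.
have [cw2 cy2 e4] := ruleP cx2 cv2 E4; rewrite e3 in cy2.
have sg := proj2 fr.
have frk : framed (width n) (act u2 (act u1 g)) by do 2 apply: framed_act => //.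
have dk : double n (act u2 (act u1 g)) by apply: (double_pull frk ty cy1 cy2 dF).
suff [th tu] : twin n (h1, h2) /\ down_twin n (u1, u2).
  by split=> //; apply: (double_pull fr _ cu1 cu2 dk); case/andP: tu.
clear dF e1 e2 e3 e4 frk cv1 cw1 cx1 cv2 cx2 cy1 cy2 cw2.
case: y1 y2 ty bal b3 E3 E4 => [y1|] [y2|] // ty bal b3 E3 E4; last first.
  case: x1 b3 E1 E3 E4 bal => // _ E1 E3 E4 bal.
  move: E3; rewrite rule_Nh => -[ev2]; subst v2.
  case: (rule_cases E4) => [[x [ex2 eu2 eb ew2]]|[ex2 ew2 _]]; last first.
    subst x2 w2; case: h2 b2 E2 {ch2} => // _ E2.
    case: h1 bal E1 {ch1} E2 => // _ E1 E2.
    move: E1; rewrite rule_Nh => -[ev]; subst v1.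
    by move: E2; rewrite rule_Nh => -[ew]; subst w1.
  subst x2 u2 w2; rewrite -eb in tw.
  have w1N : w1 = None by move: tw; case: (w1).
  subst w1; case: h1 bal E1 ch1 ch2 E2 => // X bal E1 ch1 ch2 E2.
  case: (rule_cases E1) => [[X' [eX eu1 ebX ev1]]|[//]].
  case: eX => eX; subst X' u1; rewrite -ebX in ev1; subst v1.
  move: E2; rewrite rule_Nu => -[eh2]; subst h2.
  have := landingP (width n) true g X; rewrite -ebX /= => HX.
  have := landingP (width n) false (hop X g) x; rewrite /= in eb; rewrite -eb /= => Hx.
  move: (cu2) => /= /andP[gx gx1].
  have highX z : X < z -> hop X g z.
    move=> lt; have [->|nz] := eqVneq z X.+1; first exact: hop_hi.
    rewrite hop_out //; last by clear -lt; lia.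
    case: (ltnP z (width n)) => [zc|/sg //]; apply: HX; clear -lt nz zc; lia.
  have xX : x < X.
    rewrite ltnNge; apply/negP => le.
    by move: gx1; rewrite highX // ltnS.
  have /andP[_ Xc] := framed_can fr ch1.
  have /andP[x0 _] := framed_can (framed_act fr ch1) cu2.
  have sum : x + X = n.*2.+1.
    apply: (@mirror_outward n _ x X 0 n.*2.+1 dk) => //=.
    - move=> z zx; have [->|nz] := eqVneq z x; first by rewrite hop_lo.
      rewrite hop_out //; last by clear -zx; lia.
      by apply: Hx; clear -zx nz; lia.
    - exact: hop_hi.
    - move=> z zX; have [->|nz] := eqVneq z x.+1; first exact: hop_hi.
      by rewrite hop_out ?highX //; clear -zX xX; lia.
    by move=> nX; rewrite hop_out ?hop_lo //; clear -xX; lia.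
  by rewrite /down_twin /twin; split; clear -sum xX; lia.
rewrite /twin in ty; move/eqP: ty => ty.
case: w1 w2 tw E2 E4 => [w1|] [w2|] // tw E2 E4; last first.
  case: (rule_cases E4) => [[x [_ _ e e']]|[ex2 ev2 _]]; first by rewrite -e in e'.
  subst v2; case: (rule_cases E3) => [[x [_ _ e e']]|[ex1 eu2 _]]; first by rewrite -e in e'.
  case: (rule_cases E2) => [[x [_ _ e e']]|[eh2 ev1 _]]; first by rewrite -ex2 -e' in e.
  subst v1; case: (rule_cases E1) => [[x [_ _ e e']]|[eh1 eu1 _]].
    by rewrite -ex1 -e' in e.
  by subst; rewrite /twin ty eqxx.
case/andP: tw => /eqP tw lw.
case: (rule_cases E4) => [[x4 [ex2 ev2 eb4 ew2]]|[ex2 ev2 n4]].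
  rewrite -eb4 in ew2; case: ew2 => ew2; subst w2 x2 v2.
  have ew1 : w1 = y1 by clear -ty tw; lia.
  subst w1.
  case: (rule_cases E3) => [[x3 [ex1 eu2 eb3 ev2]]|[ex1 eu2 n3]].
    (* The bumps of both letters met on the axis. *)
    subst x1 u2; rewrite -eb3 in ev2; case: ev2 => ev2; subst x4.
    case: (rule_cases E2) => [[z [eh2 ev1 eb2 _]]|[eh2 ev1 n2]]; last first.
      by have := n2 (etrans (esym eh2) ev1); rewrite -eh2.
    subst h2 v1; have := landingP (width n) true (act u1 g) x3; rewrite -eb3 /= => bR.
    case: bR => x3y1 _ ny1 high; have := landingP (width n) false (act h1 g) z; rewrite -eb2 /=.
    move=> [y1z gy1 low].
    have nxz : x3 != z by clear -x3y1 y1z; lia.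
    case: (rule_cases E1) => [[z' [e1 e2 e3 e4]]|[eh1 eu1 _]].
      by rewrite -e3 in e4; case: e4 => e4; rewrite e4 eqxx in nxz.
    subst h1 u1; rewrite /= in eb4 low gy1 high ny1 cu2 dk *.
    set k := hop x3 (hop z g) in dk.
    have := landingP (width n) false k y1; rewrite -[k]/(act (Some x3) (act (Some z) g)) -eb4 /=.
    rewrite -/k => -[y21 ky2 lowk].
    have kx3 : k x3 = false by rewrite /k hop_lo.
    have kx31 : k x3.+1 = true by rewrite /k hop_hi.
    have kout p : x3.+1 < p -> k p = hop z g p by move=> lt; rewrite /k hop_out //; clear -lt; lia.
    have x3y2 : x3 < y2.
      rewrite ltnNge; apply/negP => le.
      have [e|ne] := eqVneq x3 y2; first by rewrite e ky2 in kx3.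
      have e : y1 = x3.+1.
        apply/eqP/negPn/negP => ne1; have H1 : y2 < x3.+1 < y1 by clear -le ne ne1 x3y1; lia.
        by move: (lowk _ H1); rewrite kx31.
      case: dk => _ kc dd; have [ec|nc] := eqVneq x3 n.+1; first by rewrite ec kc in kx3.
      have := dd x3 (width n - x3); rewrite kx3.
      move=> /(_ ltac:(clear -e ty le ne; lia) (elimN eqP nc)).
      have := lowk (width n - x3) ltac:(clear -e ty le ne nc; lia).
      by move=> /negPf ->.
    have y12 : y1 = y2.+1.
      apply/eqP/negPn/negP => ne; have H1 : y2 < y2.+1 < y1 by clear -ne y21; lia.
      have := lowk _ H1; rewrite kout ?ltnS // high //.
      by clear -x3y2 y21; lia.
    have y2n : y2 = n by clear -y12 ty; lia.
    have sum : x3 + z = n.*2.+1.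
      apply: (mirror_centre dk).
      - by clear -x3y2 y2n; lia.
      - by clear -y1z y12 y2n; lia.
      - by rewrite kx3.
      - move=> p Hp; have [->|np] := eqVneq p x3.+1; first exact: kx31.
        by rewrite kout ?high //; clear -Hp np y12 y2n; lia.
      - move=> p Hp; have [->|np] := eqVneq p z.
          by rewrite kout ?hop_lo //; clear -x3y1 y1z; lia.
        rewrite kout; last by clear -Hp x3y2 y2n; lia.
        have := low p; rewrite !hop_out; [apply|clear -Hp np x3y2 y2n; lia..].
        by clear -Hp np y12 y2n; lia.
      by rewrite kout ?hop_hi //; clear -x3y1 y1z; lia.
    by rewrite /down_twin /twin; split; clear -sum x3y1 y1z; lia.
  subst x1 u2.
  case: (rule_cases E2) => [[x [_ _ e e']]|[eh2 ev1 _]].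
    exfalso; rewrite -e in e'; case: e' => e'.
    by have := n3 (congr1 Some e').
  subst h2 v1.
  case: (rule_cases E1) => [[x0 [eh1 eu1 eb1 _]]|[eh1 eu1 n1]]; last first.
    by have := n1 (etrans (esym eh1) eu1); rewrite -eh1.
  subst h1 u1; rewrite /= in eb4 cu2 dk.
  have := landingP (width n) true g x0; rewrite -eb1 /= => -[x0y1 _ gy1 high].
  have := landingP (width n) false (hop y1 (hop x0 g)) x4; rewrite -eb4 /= => -[y2x4 fy2 low].
  move/andP: cu2 => [G4 G4'].
  have Gy1 : hop x0 g y1.+1 = false by rewrite hop_out ?(negPf gy1) //; clear -x0y1; lia.
  have Ghigh p : x0 < p <= y1 -> hop x0 g p.
    move=> Hp; have [->|np] := eqVneq p x0.+1; first exact: hop_hi.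
    by rewrite hop_out ?high //; clear -Hp np; lia.
  have x4y1 : x4 < y1.
    rewrite ltnNge; apply/negP => le.
    have [e|ne] := eqVneq x4 y1.+1; first by rewrite e Gy1 in G4.
    have nx : x4 != y1 by apply/eqP => e; have := n3 (congr1 Some (esym e)).
    by have := low y1.+1; rewrite hop_hi => /(_ ltac:(clear -lw le ne nx; lia)).
  have x40 : x4 < x0.
    rewrite ltnNge; apply/negP => le.
    by move: G4'; rewrite Ghigh //; clear -le x4y1; lia.
  have sum : x4 + x0 = n.*2.+1.
    apply: (@mirror_outward n _ x4 x0 y2 y1 dk) => //.
    - by clear -ty; lia.
    - move=> p Hp; have [->|np] := eqVneq p x4; first by rewrite hop_lo.
      rewrite hop_out //; last by clear -Hp; lia.
      have := low p; rewrite hop_out; [apply; clear -Hp np; lia|clear -Hp x4y1; lia..].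
    - exact: hop_hi.
    - by move=> p Hp; rewrite hop_out ?Ghigh //; clear -Hp x40; lia.
    by move=> nx; rewrite hop_out ?hop_lo //; clear -x40; lia.
  by rewrite /down_twin /twin; split; clear -sum x40; lia.
subst x2 v2.
case: (rule_cases E3) => [[x [ex1 eu2 eb3 ev2]]|[ex1 eu2 n3]].
  subst x1 u2; rewrite -eb3 in ev2; case: ev2 => ey1; subst w2.
  have ew1 : w1 = y2 by clear -ty tw; lia.
  subst w1.
  case: (rule_cases E2) => [[X [eh2 ev1 eb2 _]]|[eh2 ev1 n2]]; last first.
    by have := n2 (etrans (esym eh2) ev1); rewrite -eh2.
  subst h2 v1; have := landingP (width n) true (act u1 g) x; rewrite -eb3 /= => -[xy1 _ _ high].
  have := landingP (width n) false (act h1 g) X; rewrite -eb2 /= => -[y2X gy2 low].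
  have nxX : x != X by clear -xy1 y2X lw; lia.
  case: (rule_cases E1) => [[z' [e1 e2 e3 e4]]|[eh1 eu1 _]].
    by rewrite -e3 in e4; case: e4 => e4; rewrite e4 eqxx in nxX.
  subst h1 u1; rewrite /= in low gy2 high cu2 dk.
  have sum : x + X = n.*2.+1.
    apply: (@mirror_inward n _ x X y1 y2 dk) => //.
    - by clear -ty lw; lia.
    - by rewrite hop_lo.
    - move=> p Hp; have [->|np] := eqVneq p x.+1; first exact: hop_hi.
      by rewrite hop_out ?high //; clear -Hp np; lia.
    - move=> p Hp; rewrite hop_out; [|clear -Hp xy1 lw; lia..].
      have [->|np] := eqVneq p X; first by rewrite hop_lo.
      have := low p; rewrite !hop_out; [apply; clear -Hp np; lia|clear -Hp np xy1 lw; lia..].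
    by rewrite hop_out ?hop_hi //; clear -xy1 y2X lw; lia.
  by rewrite /down_twin /twin; split; clear -sum xy1 y2X lw; lia.
subst x1 u2.
case: (rule_cases E2) => [[x [_ _ e e']]|[eh2 ev1 _]].
  rewrite -e in e'; case: e' => e'; exfalso; have e3 : y1 = w2 by clear -e' ty tw; lia.
  by have := n3 (congr1 Some e3).
subst h2 v1.
case: (rule_cases E1) => [[x [_ _ e e']]|[eh1 eu1 _]].
  rewrite -e in e'; case: e' => e'; exfalso; have e4 : y2 = w2 by clear -e' ty tw; lia.
  by have := n4 (congr1 Some e4).
by subst; rewrite /down_twin /twin ty tw lw eqxx.
Qed.

(** * Grids of blocks *)

Definition flat (us : seq (step * step)) : seq step := flatten [seq [:: u.1; u.2] | u <- us].
(** Pairs as a path of alternating colours. *)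
Fixpoint alt (ps : seq (step * step)) : path :=
  if ps is h :: ps' then (true, h.1) :: (false, h.2) :: alt ps' else [::].

Lemma unzip2_alt ps : unzip2 (alt ps) = flat ps.
Proof. by elim: ps => //= h ps ->. Qed.

Fixpoint block_row (K : nat) (g : config) (u : step * step) (ps : seq (step * step)) :
    seq (step * step) * seq (step * step) * (step * step) :=
  if ps is h :: ps' then
    let: (x, y, w) := block_out K g h u in
    let: (ms, os, v) := block_row K (act h.2 (act h.1 g)) w ps' in
    (x :: ms, y :: os, v)
  else ([::], [::], u).

Lemma block_outP K g h u x y w : can g h.1 -> can (act h.1 g) h.2 ->
  can g u.1 -> can (act u.1 g) u.2 -> block_out K g h u = (x, y, w) ->
  let g' := act h.2 (act h.1 g) in let k := act u.2 (act u.1 g) in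
  [/\ can k y.1 /\ can (act y.1 k) y.2, can g' w.1 /\ can (act w.1 g') w.2,
      act y.2 (act y.1 k) = act w.2 (act w.1 g') &
      act x.2 (act x.1 (act u.1 g)) = act w.1 g' /\
      (can (act u.1 g) x.1 /\ can (act x.1 (act u.1 g)) x.2)].
Proof.
case: h u x y w => h1 h2 [u1 u2] [x1 x2] [y1 y2] [w1 w2] /= ch1 ch2 cu1 cu2.
rewrite /block_out /=.
case E1: (local_rule _ _ g _ _) => [x1' v1]; case E2: (local_rule _ _ (act h1 g) _ _) => [x2' w1'].
case E3: (local_rule _ _ (act u1 g) _ _) => [y1' v2].
case E4: (local_rule _ _ (act x1' _) _ _) => [y2' w2'] [? ? ? ? ? ?].
subst x1' x2' y1' y2' w1' w2'.
have [cv1 cx1 e1] := ruleP ch1 cu1 E1.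
have [cw1 cx2 e2] := ruleP ch2 cv1 E2.
have [cv2 cy1 e3] := ruleP cx1 cu2 E3.
rewrite e1 in cx2 e2.
have [cw2 cy2 e4] := ruleP cx2 cv2 E4; rewrite e3 in cy2 e4.
by rewrite -e2 in cw2 e4; split.
Qed.

Lemma block_rowP K g u ps ms os w : valid g (flat ps) -> can g u.1 -> can (act u.1 g) u.2 ->
  block_row K g u ps = (ms, os, w) ->
  [/\ pass K g u.1 (alt ps) = (alt ms, w.1),
      pass K (act u.1 g) u.2 (alt ms) = (alt os, w.2),
      valid (act u.2 (act u.1 g)) (flat os) /\
      run (act u.2 (act u.1 g)) (flat os) = act w.2 (act w.1 (run g (flat ps))),
      can (run g (flat ps)) w.1 /\ can (act w.1 (run g (flat ps))) w.2
    & size ms = size ps /\ size os = size ps].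
Proof.
elim: ps g u ms os w => [|h ps IH] g u ms os w /=; first by move=> _ cu1 cu2 [<- <- <-].
move=> /and3P[ch1 ch2 vs] cu1 cu2.
case EB: (block_out K g h u) => [[x y] w0]; case EP: (block_row _ _ _ _) => [[ms' os'] w'].
move=> [<- <- <-].
have [[cy1 cy2] [cw1 cw2] e [e' [cx1 cx2]]] := block_outP ch1 ch2 cu1 cu2 EB.
have [p1 p2 [v1 r1] [c1 c2] [s1 s2]] := IH _ _ _ _ _ vs cw1 cw2 EP.
move: EB; rewrite /block_out.
case E1: (local_rule _ _ g _ _) => [x1' v1']; case E2: (local_rule _ _ (act h.1 g) _ _) => [x2' w1'].
case E3: (local_rule _ _ (act u.1 g) _ _) => [y1' v2].
case E4: (local_rule _ _ (act x1' _) _ _) => [y2' w2'] [ex ey ew]; subst x y w0.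
rewrite /= in e e' p1 p2 v1 r1 cy1 cy2 *.
rewrite p1 E3 E4 e' p2 e cy1 cy2 v1 r1 s1 s2.
by split.
Qed.

Lemma dies_alt t ps ms : size ms = size ps -> dies t (alt ps) (alt ms) =
  [seq (if t then dead p.1.1 p.2.1 else dead p.1.2 p.2.2) | p <- zip ps ms].
Proof.
elim: ps ms => [|h ps IH] [|x ms] // [sz]; move: {IH} (IH _ sz); rewrite /dies /=.
by case: t => /= ->.
Qed.

Definition balanced_row (ps ms os : seq (step * step)) : bool :=
  all (fun t => balanced t.1.1 t.1.2 t.2) (zip (zip ps ms) os).

Lemma row_fwd n g u ps ms os w : double n g -> all (twin n) ps -> down_twin n u ->
  valid g (flat ps) -> can g u.1 -> can (act u.1 g) u.2 ->
  block_row (width n) g u ps = (ms, os, w) ->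
  [/\ all (twin n) os, down_twin n w & balanced_row ps ms os].
Proof.
elim: ps g u ms os w => [|h ps IH] g u ms os w dg /=; first by move=> _ pu _ _ _ [<- <- <-].
move=> /andP[th tps] pu /and3P[ch1 ch2 vs] cu1 cu2.
case EB: (block_out _ g h u) => [[x y] w0]; case EP: (block_row _ _ _ _) => [[ms' os'] w'].
move=> [<- <- <-].
have [ty pw bal] := block_fwd dg th pu ch1 ch2 cu1 cu2 EB.
have [_ [cw1 cw2] _ _] := block_outP ch1 ch2 cu1 cu2 EB.
have dg' : double n (act h.2 (act h.1 g)) by apply: double_push => //; case: (h) th.
have [tos pw' bals] := IH _ _ _ _ _ dg' tps pw vs cw1 cw2 EP.
by rewrite /= ty tos /balanced_row /= bal.
Qed.

Lemma row_inv n g u ps ms os w : framed (width n) g ->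
  valid g (flat ps) -> can g u.1 -> can (act u.1 g) u.2 ->
  block_row (width n) g u ps = (ms, os, w) ->
  all (twin n) os -> down_twin n w -> balanced_row ps ms os ->
  double n (act w.2 (act w.1 (run g (flat ps)))) ->
  [/\ all (twin n) ps, down_twin n u & double n g].
Proof.
elim: ps g u ms os w => [|h ps IH] g u ms os w fr /=.
  move=> _ cu1 cu2 [<- <- <-] _ pu _ dg; split=> //.
  by apply: double_pull dg => //; case/andP: pu; case: (u).
move=> /and3P[ch1 ch2 vs] cu1 cu2.
case EB: (block_out _ g h u) => [[x y] w0]; case EP: (block_row _ _ _ _) => [[ms' os'] w'].
move=> [<- <- <-] /= /andP[ty tos] pw; rewrite /balanced_row /= => /andP[bal bals] dF.
have [_ [cw1 cw2] e _] := block_outP ch1 ch2 cu1 cu2 EB.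
have fr' : framed (width n) (act h.2 (act h.1 g)) by do 2 apply: framed_act => //.
have [tps pw0 dg'] := IH _ _ _ _ _ fr' vs cw1 cw2 EP tos pw bals dF.
have dB : double n (act y.2 (act y.1 (act u.2 (act u.1 g)))).
  by rewrite e; apply: double_push => //; case/andP: pw0; case: (w0).
have [th pu dg] := block_inv fr ch1 ch2 cu1 cu2 EB ty pw0 bal dB.
by rewrite th tps.
Qed.

(** The two forms that the deaths of a symmetric grid take, one for each colour. *)
Definition early (m : nat) (ds : seq bitseq) : seq bitseq :=
  flatten [seq [:: d; nseq m false] | d <- ds].
Definition late (m : nat) (ds : seq bitseq) : seq bitseq :=
  flatten [seq [:: nseq m false; d] | d <- ds].

Lemma early_late m ds : nseq m false :: early m ds = rcons (late m ds) (nseq m false).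
Proof. by elim: ds => //= d ds; rewrite /early /late /= => ->. Qed.

(** The condition on blocks in terms of the deaths in the two rows: this is how
    a symmetry of the path becomes a relation between its two colours. *)
Lemma balanced_deaths ps ms os : size ms = size ps -> size os = size ps ->
  balanced_row ps ms os <->
  [/\ dies true (alt ps) (alt ms) = dies false (alt ms) (alt os),
      dies false (alt ps) (alt ms) = nseq (size ps) false
    & dies true (alt ms) (alt os) = nseq (size ps) false].
Proof.
move=> s1 s2; rewrite !dies_alt ?s1 ?s2 // /balanced_row.
elim: ps ms os s1 s2 => [|h ps IH] [|x ms] [|y os] // [s1] [s2] /=.
rewrite /balanced; split.
  move=> /andP[/and3P[/eqP -> /negPf -> /negPf ->]] /(IH _ _ s1 s2)[-> -> ->].
  by [].
move=> [[-> e1] [-> e2] [-> e3]]; rewrite eqxx /=.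
by apply/(IH _ _ s1 s2).
Qed.

(** Symmetry spreads through the grid: within a row of blocks the twins [u] remain
    twins, and below it the path consists of twins again. *)
Lemma grid_fwd n g us ps : double n g -> all (twin n) ps -> all (down_twin n) us ->
  valid g (flat ps) -> valid g (flat us) ->
  exists2 ds, deaths (width n) true g (flat us) (alt ps) = early (size ps) ds &
              deaths (width n) false g (flat us) (alt ps) = late (size ps) ds.
Proof.
elim: us g ps => [|u us IH] g ps dg tps; first by exists [::].
move=> /= /andP[pu pus] vs /and3P[cu1 cu2 vus].
case EP: (block_row (width n) g u ps) => [[ms os] w].
have [p1 p2 [v1 r1] _ [s1 s2]] := block_rowP vs cu1 cu2 EP.
have [tos pw bal] := row_fwd dg tps pu vs cu1 cu2 EP.
have dg' : double n (act u.2 (act u.1 g)).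
  by apply: double_push => //; case/andP: pu; case: (u).
have [ds e1 e2] := IH _ _ dg' tos pus v1 vus.
rewrite p1 /= p2 /= e1 e2 s2.
have [-> -> ->] := (balanced_deaths s1 s2).1 bal.
by exists (dies false (alt ms) (alt os) :: ds).
Qed.

Lemma double_empty n : double n (empty n).
Proof.
split; [exact: framed_empty | exact: leqnn | move=> p q pq np; rewrite /empty; lia].
Qed.

(** The grid read from below, where the empty shape and the path of missing steps are
    symmetric. At the right end of each row of blocks the incoming pair has
    become [None], because the empty shape admits no removal. *)
Lemma grid_inv n g us ps ds : framed (width n) g ->
  valid g (flat ps) -> valid g (flat us) ->
  run g (flat ps) = empty n -> run g (flat us) = empty n ->
  size ds = size us ->
  deaths (width n) true g (flat us) (alt ps) = early (size ps) ds ->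
  deaths (width n) false g (flat us) (alt ps) = late (size ps) ds ->
  all (twin n) ps /\ double n g.
Proof.
elim: us g ps ds => [|u us IH] g ps [|d ds] //= fr.
  move=> vs _ _ eg _ _ _; subst g; split; last exact: double_empty.
  elim: ps vs => //= -[h1 h2] ps IH /and3P[/= c1 + +].
  move: (stuck_can (@stuck_empty n) c1) => -> /= c2.
  by move: (stuck_can (@stuck_empty n) c2) => -> /= /IH.
move=> vs /and3P[cu1 cu2 vus] rs rus [sz].
case EP: (block_row (width n) g u ps) => [[ms os] w].
have [-> /= -> [v1 r1] [cw1 cw2] [s1 s2]] := block_rowP vs cu1 cu2 EP.
rewrite /early /late /= => -[d1 d2 d3] [d4 d5 d6].
rewrite rs in r1 cw1 cw2.
have w1 := stuck_can (@stuck_empty n) cw1; rewrite w1 /= in cw2 r1.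
have w2 := stuck_can (@stuck_empty n) cw2; rewrite w2 /= in r1.
have fr' : framed (width n) (act u.2 (act u.1 g)) by do 2 apply: framed_act => //.
rewrite -s2 in d3 d6.
have [tos dk] := IH _ _ _ fr' v1 vus r1 rus sz d3 d6.
have bal : balanced_row ps ms os.
  by apply/(balanced_deaths s1 s2); rewrite d1 d2 d4 d5.
have pw : down_twin n w by case: (w) w1 w2 => /= ? ? -> ->.
have [|tps pu dg] := row_inv fr vs cu1 cu2 EP tos pw bal; last by [].
by rewrite w1 w2 rs; apply: double_empty.
Qed.

(** * Transposition, and words of twin pairs *)

(** Transposition of shapes. It takes the content x to 2n - x, and reverses the
    boundary with horizontal and vertical edges exchanged. *)
Definition dualc (n : nat) (f : config) : config :=
  fun p => if p < width n then ~~ f (n.*2.+1 - p) else true.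
Definition duals (n : nat) (h : step) : step := omap (fun x => n.*2 - x) h.

Lemma dual_empty n : dualc n (empty n) = empty n.
Proof.
by apply: functional_extensionality => p; rewrite /dualc /empty; case: ifP; lia.
Qed.

Lemma solid_dual n f : solid (width n) (dualc n f).
Proof. by move=> z zc; rewrite /dualc ltnNge zc. Qed.

Lemma dual_can n f h : framed (width n) f -> can f h -> can (dualc n f) (duals n h).
Proof.
case: h => [x|] //= fr cx; have /andP[x0 xc] := framed_can fr cx.
move: cx => /andP[fx fx1]; rewrite /dualc !ifT; [|clear -x0; lia..].
rewrite (_ : _ - _ = x.+1); last by clear -xc; lia.
rewrite (_ : _ - (_ - _).+1 = x); last by clear -xc; lia.
by rewrite fx1 fx.
Qed.

Lemma dual_act n f h : framed (width n) f -> can f h ->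
  act (duals n h) (dualc n f) = dualc n (act h f).
Proof.
case: h => [x|] //= fr cx; have /andP[x0 xc] := framed_can fr cx.
apply: functional_extensionality => p; rewrite /dualc !hopE.
have [lt|ge] := ltnP p (width n).
  have -> : (p == n.*2 - x) = (n.*2.+1 - p == x.+1) by clear -lt x0 xc; lia.
  have -> : (p == (n.*2 - x).+1) = (n.*2.+1 - p == x) by clear -lt x0 xc; lia.
  case E1: (n.*2.+1 - p == x.+1); case E2: (n.*2.+1 - p == x) => //.
  by clear -E1 E2; lia.
have -> : (p == n.*2 - x) = false by clear -ge; lia.
by have -> : (p == (n.*2 - x).+1) = false by clear -ge x0; lia.
Qed.

Lemma dual_landing n f x : framed (width n) f -> can f (Some x) ->
  landing (width n) false (dualc n f) (n.*2 - x) = duals n (landing (width n) true f x).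
Proof.
move=> fr cx; have /andP[x0 xc] := framed_can fr cx.
have := landingP (width n) true f x.
case: (landing (width n) true f x) => [y|] /= H; apply: landingE => /=.
  case: H => xy yK ny H; split.
  - by clear -xy yK; lia.
  - rewrite /dualc ifT; last by clear; lia.
    by rewrite (_ : _ - _ = y.+1) //; clear -yK; lia.
  move=> z Hz; rewrite /dualc ifT; last by clear -Hz; lia.
  by rewrite negbK H //; clear -Hz yK; lia.
move=> z Hz; rewrite /dualc ifT; last by clear -Hz; lia.
by rewrite negbK H //; clear -Hz; lia.
Qed.

Lemma dual_rule n f h u : framed (width n) f -> can f h -> can f u ->
  local_rule (width n) false (dualc n f) (duals n h) (duals n u) =
  (duals n (local_rule (width n) true f h u).1, duals n (local_rule (width n) true f h u).2).
Proof.
case: h u => [x|] [y|] fr cx cy; rewrite ?rule_Nh ?rule_Nu //.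
have [e|nxy] := eqVneq x y; first by rewrite -e !rule_eq dual_landing.
rewrite !rule_neq //.
have := framed_can fr cx; have := framed_can fr cy; clear -nxy; lia.
Qed.

Lemma isSome_duals n h : isSome (duals n h) = isSome h.
Proof. by case: h. Qed.

Lemma dual_spass n f u a : framed (width n) f -> valid f a -> can f u ->
  spass (width n) false (dualc n f) (duals n u) (map (duals n) a) =
  (map (duals n) (spass (width n) true f u a).1, duals n (spass (width n) true f u a).2).
Proof.
elim: a f u => //= h a IH f u fr /andP[ch va] cu.
rewrite dual_rule //; case E: (local_rule (width n) true f h u) => [h' u1] /=.
have [c1 _ _] := ruleP ch cu E.
rewrite dual_act // IH //; last exact: framed_act.
by case: (spass _ _ _ _ _) => [r v].
Qed.

Lemma dual_sdies n a a' : sdies (map (duals n) a) (map (duals n) a') = sdies a a'.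
Proof.
elim: a a' => [|h a IH] [|h' a'] //=; move: (IH a'); rewrite /sdies /= => ->.
by rewrite /dead !isSome_duals.
Qed.

(** Transposition exchanges insertion by rows and by columns. *)
Lemma dual_sdeaths n f us a : framed (width n) f -> valid f a -> valid f us ->
  sdeaths (width n) false (dualc n f) (map (duals n) us) (map (duals n) a) =
  sdeaths (width n) true f us a.
Proof.
elim: us f a => //= u us IH f a fr va /andP[cu vus].
rewrite dual_spass //= dual_sdies dual_act // IH //; first exact: framed_act.
by case E: (spass (width n) true f u a) => [a' v]; have [] := spassP va cu E.
Qed.

Lemma dual_valid n f a : framed (width n) f -> valid f a ->
  valid (dualc n f) (map (duals n) a) /\
  run (dualc n f) (map (duals n) a) = dualc n (run f a).
Proof.
elim: a f => //= h a IH f fr /andP[ch va]; rewrite dual_can // dual_act //=.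
by apply: IH => //; apply: framed_act.
Qed.

Lemma spass_None K t f a : spass K t f None a = (a, None).
Proof. by elim: a f => //= h a IH f; rewrite rule_Nu IH. Qed.

Lemma sdies_self a : sdies a a = nseq (size a) false.
Proof. by elim: a => //= h a; rewrite /sdies /= dead_self => ->. Qed.

Lemma sdeaths_None K t f us a :
  sdeaths K t f (None :: us) a = nseq (size a) false :: sdeaths K t f us a.
Proof. by rewrite /= spass_None /= sdies_self. Qed.

Lemma sdeaths_rcons_None K t f us a :
  sdeaths K t f (rcons us None) a = rcons (sdeaths K t f us a) (nseq (size a) false).
Proof.
elim: us f a => [|u us IH] f a; first by rewrite /= spass_None /= sdies_self.
by rewrite rcons_cons /= IH size_spass.
Qed.

Lemma valid_rcons_None f us : valid f us -> valid f (rcons us None) /\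
  run f (rcons us None) = run f us.
Proof. by move=> v; rewrite -cats1 valid_cat run_cat v. Qed.

(** A step that enters is only lost in a death or by leaving at the end. *)
Lemma no_death K t f u a a' v : valid f a -> can f u ->
  spass K t f u a = (a', v) -> sdies a a' = nseq (size a) false -> v = None -> u = None.
Proof.
elim: a f u a' v => [|h a IH] f u a' v /=; first by move=> _ _ [_ ->].
move=> /andP[ch va] cu; case E: (local_rule K t f h u) => [h' u1].
case E2: (spass K t (act h f) u1 a) => [r w] [<- <-].
rewrite /sdies /= => -[dd ds] wN.
have [c1 _ _] := ruleP ch cu E.
have u1N := IH _ _ _ _ va c1 E2 ds wN; subst u1.
case: (rule_cases E) => [[x [eh eu eb eb']]|[_ <- _]] //.
by move: dd; rewrite eh eb -eb'.
Qed.

(** Along a path down to a stuck shape nothing leaves, so a row without deaths is one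
    into which nothing enters, and this does not depend on the path. *)
Lemma early_transfer K t F f us a1 a2 ds1 : stuck F ->
  valid f a1 -> valid f a2 -> run f a1 = F -> run f a2 = F ->
  valid f us ->
  sdeaths K t f us a1 = early (size a1) ds1 ->
  exists2 ds2, sdeaths K t f us a2 = early (size a2) ds2 & size ds2 = size ds1.
Proof.
move=> sF; elim: ds1 f us a1 a2 => [|d ds1 IH] f us a1 a2 va1 va2 r1 r2.
  by case: us => [|//] _ _; exists [::].
case: us => [|u [|u' us]] //= /and3P[cu cu' vus].
case E1: (spass K t f u a1) => [a1' v1]; case E2: (spass K t f u a2) => [a2' v2] /=.
have [va1' cv1 g1 sz1] := spassP va1 cu E1; have [va2' cv2 g2 sz2] := spassP va2 cu E2.
rewrite r1 in cv1 g1; rewrite r2 in cv2 g2.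
have v1N := stuck_can sF cv1; have v2N := stuck_can sF cv2; subst v1 v2.
case E1': (spass K t (act u f) u' a1') => [b1 w1] /= [_ e1 e2].
have [vb1 cw1 h1 sb1] := spassP va1' cu' E1'.
rewrite g1 in cw1 h1; have w1N := stuck_can sF cw1; subst w1.
rewrite -sz1 in e1; have u'N := no_death va1' cu' E1' e1 erefl; subst u'.
rewrite !spass_None in E1' *; case: E1' => E1'; subst b1.
rewrite /= sdies_self sz2.
rewrite -sz1 in e2.
have [ds2 -> sds] := IH _ _ _ _ va1' va2' g1 g2 vus e2.
by exists (sdies a2 a2' :: ds2); rewrite ?sz2 //= sds.
Qed.

(** In a shape whose rotation is its transpose, consecutive edges have different
    directions, so it is the staircase. *)
Lemma stair_unique n f g : framed (width n) f -> framed (width n) g ->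
  rotc (width n) f = dualc n f -> rotc (width n) g = dualc n g -> f = g.
Proof.
have H h : framed (width n) h -> rotc (width n) h = dualc n h ->
    forall q, q < width n -> h q = odd q.
  move=> [h0 _] e; elim=> [_|q IH lt]; first exact: negPf.
  have := congr1 (fun c => c (n.*2.+1 - q)) e.
  rewrite /rotc /dualc !ifT; [|by clear -lt; lia..].
  rewrite (_ : _ - (_ - q) = q.+1); last by clear -lt; lia.
  rewrite (_ : _ - (_ - q) = q); last by clear -lt; lia.
  by move=> ->; rewrite IH // ltnW.
move=> frf frg ef eg; apply: functional_extensionality => q.
have [lt|ge] := ltnP q (width n); first by rewrite (H f) ?(H g).
by rewrite (proj2 frf) // (proj2 frg).
Qed.

Lemma double_full n : double n (full n).
Proof.
split; [exact: framed_full | by rewrite /full leqnn | ].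
by move=> p q pq np; rewrite /full; clear -pq np; lia.
Qed.

(** As long as a symmetric shape has a corner, it has a corner above the axis, and
    after its removal the mirror image is a corner. *)
Lemma exists_down_twin n g : double n g ->
  exists us, [/\ all (down_twin n) us, valid g (flat us), proper (flat us)
               & run g (flat us) = empty n].
Proof.
have [m] := ubnP (energy (width n) g); elim: m g => // m IH g le dg.
have [fr gc dd] := dg.
case: (boolP [exists x : 'I_(width n), can g (Some (val x))]) => [/existsP[x cx]|/existsPn no].
  have [X [cX nX]] : exists X, can g (Some X) /\ n < X.
    case: x cx => x /= _ cx; case: (ltnP n x) => nx; first by exists x.
    have nxn : x != n.
      by apply/eqP => e; move: cx => /andP[_]; rewrite e gc.
    move: cx => /andP[gx gx1]; exists (n.*2.+1 - x); split; last by clear -nx; lia.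
    rewrite /= (dd x.+1) ?gx1; [|by clear -nx; lia|by clear -nxn; lia].
    by rewrite (dd x) ?gx //; clear -nx; lia.
  have /andP[_ Xc] := framed_can fr cX.
  have cx' : can (hop X g) (Some (n.*2.+1 - X)).
    move: (cX) => /andP[gX gX1].
    have [e|ne] := eqVneq X n.+1.
      have gn2 : ~~ g n.+2 by rewrite -e.
      rewrite e (_ : _ - _ = n); last by clear; lia.
      rewrite /= hop_lo andbT hop_out; [|by clear; lia..].
      by rewrite (dd n.+2) ?gn2 //; clear; lia.
    rewrite can_hop; [|by clear -nX Xc; lia|by clear -nX Xc ne; lia|by clear -nX; lia].
    rewrite /= (dd X.+1) ?gX1; [|by clear -Xc; lia|by clear -nX; lia].
    by rewrite (dd X) ?gX //; [clear -Xc; lia | apply/eqP].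
  have frX := framed_act fr cX.
  have tw : twin n (Some X, Some (n.*2.+1 - X)) by rewrite /twin; clear -Xc; lia.
  have dg' := double_push (a := Some X) (b := Some (n.*2.+1 - X)) dg tw cX cx'.
  have [|us [pus vus prs rus]] := IH _ _ dg'.
    have := energy_hop fr cX; have := energy_hop frX cx'; move: le; rewrite /act.
    by clear; lia.
  exists ((Some X, Some (n.*2.+1 - X)) :: us); split=> //=.
  - by rewrite pus /down_twin tw andbT; clear -nX; lia.
  by apply/and3P; split.
have mono z : g z -> g z.+1.
  move=> gz; apply/negPn/negP => gz1; have cz : can g (Some z) by rewrite /= gz.
  have /andP[_ zc] := framed_can fr cz.
  by move/negP: (no (Ordinal (ltnW zc))); apply.
exists [::]; split=> //=; apply: functional_extensionality => z; rewrite /empty.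
have up d : g (n.+1 + d) by elim: d => [|d IHd]; rewrite ?addn0 // addnS; apply: mono.
have [lt|ge] := ltnP n z; first by rewrite -(subnKC lt) up.
rewrite (dd (width n - z)); [|by clear -ge; lia..].
apply/negbTE; rewrite negbK (_ : width n - z = n.+1 + (n.+1 - z)) ?up //.
by clear -ge; lia.
Qed.

Lemma conn_proper s1 s2 : conn s1 s2 -> proper (unzip2 s1) = proper (unzip2 s2).
Proof.
elim=> {s1 s2} //= [s1 s2 s3 _ -> _ ->|p s1 s2 _ ->|t a b s] //.
by have [-> ->] := isSome_sw a b; rewrite andbCA.
Qed.

Lemma sort_path s t : exists a b, conn s (mk t a ++ mk (~~ t) b).
Proof.
elim: s => [|[t' h] s [a [b cn]]]; first by exists [::], [::]; apply: ConnRefl.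
have [e|ne] := eqVneq t' t.
  by exists (h :: a), b; rewrite e; apply: ConnCons.
have e : t' = ~~ t by case: t t' ne {cn} => -[].
exists (push h a).1, ((push h a).2 :: b).
apply: (ConnTrans (ConnCons _ cn)).
have := conn_cat (push_conn t' h a) (ConnRefl (mk (~~ t) b)).
by rewrite e negbK -catA.
Qed.

(** * Folding at the level of contents *)

Lemma alt_count t ps : count (fun p : bool * step => p.1 == t) (alt ps) = size ps.
Proof. by elim: ps => //= h ps ->; case: t. Qed.

Lemma alt_sizes t ps a b : conn (alt ps) (mk t a ++ mk (~~ t) b) ->
  size a = size ps /\ size b = size ps.
Proof.
move=> cn; have := conn_count t cn; have := conn_count (~~ t) cn.
by rewrite !count_cat !count_mk !alt_count !eqxx; case: t {cn} => /=; lia.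
Qed.

Lemma alt_square n t ps a b b' a' : valid (full n) (flat ps) -> run (full n) (flat ps) = empty n ->
  conn (alt ps) (mk t a ++ mk (~~ t) b) -> conn (alt ps) (mk (~~ t) b' ++ mk t a') ->
  Square t (full n) (empty n) a b b' a'.
Proof.
rewrite -unzip2_alt => v r c1 c2; have [v1 r1] := conn_valid c1 v.
by split; rewrite -?(unzip2_mk2 t (~~ t)) ?r1 //; apply: ConnTrans (conn_sym c1) c2.
Qed.

(** The deaths of a path in both colours, read at the ends of the two sides of
    the square to which it is connected. *)
Lemma square_deaths_snd K t g F us a b b' a' : solid K g -> Square t g F a b b' a' ->
  valid g us -> forall s, conn s (mk t a ++ mk (~~ t) b) -> valid g (unzip2 s) ->
  deaths K (~~ t) g us s = sdeaths K (~~ t) (run g a) (souts K t g us a) b /\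
  deaths K t g us s = sdeaths K t (run g b') (souts K (~~ t) g us b') a'.
Proof.
move=> sg sq vus s cn vs; have [[va vb vb' va'] _] := square_valid sq.
have [vo _ _] := sgridP K t va vus.
have [_ H] := grid_conn sg cn vs vus; rewrite !H.
rewrite deaths_snd ?valid_cat ?va // deaths_fst ?valid_cat ?va //.
by split=> //; apply/esym/(square_deaths_fst sg sq).
Qed.

Lemma size_flat us : size (flat us) = 2 * size us.
Proof. by elim: us => //= u us ->; rewrite mulnS. Qed.

Lemma size_early m ds : size (early m ds) = 2 * size ds.
Proof. by elim: ds => //= d ds IH; rewrite /early /= -/(early m ds) IH mulnS. Qed.

(** For a symmetric path the deaths in the two colours differ by a delay of one row,
    which is undone by an additional empty row before or after. Since transposition
    exchanges the colours, [deaths_inj] identifies the transpose of [W], with the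
    rows that reach it, with [A]. *)
Lemma twin_core n ps us C W B A : all (twin n) ps ->
  valid (full n) (flat ps) -> run (full n) (flat ps) = empty n ->
  all (down_twin n) us -> valid (full n) (flat us) -> run (full n) (flat us) = empty n ->
  conn (alt ps) (mk false C ++ mk true W) -> conn (alt ps) (mk true B ++ mk false A) ->
  let us1 := souts (width n) false (full n) (flat us) C in
  let us3 := souts (width n) true (full n) (flat us) B in
  [/\ A = map (duals n) W, run (full n) B = dualc n (run (full n) C),
      None :: map (duals n) us1 = rcons us3 None &
      exists2 ds, size ds = size us &
        sdeaths (width n) true (run (full n) C) us1 W = early (size W) ds].
Proof.
move=> tps vps rps pus vus rus c1 c2 us1 us3.
have sq := alt_square vps rps c1 c2.
have [[vC vW vB vA] [rW rA]] := square_valid sq.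
have [ds e1 e2] := grid_fwd (double_full n) tps pus vps vus.
have vs : valid (full n) (unzip2 (alt ps)) by rewrite unzip2_alt.
have [/= d1 d2] := square_deaths_snd (proj2 (framed_full n)) sq vus c1 vs.
rewrite e1 -/us1 in d1; rewrite e2 -/us3 in d2.
have [sC sW] := alt_sizes c1; have [sB sA] := alt_sizes c2.
have sds : size ds = size us.
  have := size_sdeaths (width n) true (run (full n) C) us1 W.
  by rewrite -d1 size_souts size_early size_flat => /eqP; rewrite eqn_pmul2l // => /eqP.
have frC := framed_run (framed_full n) vC.
have frB := framed_run (framed_full n) vB.
have [vo1 _ _] := sgridP (width n) false vC vus.
have [vo3 _ _] := sgridP (width n) true vB vus.
have r1 := run_souts (width n) false (@stuck_empty n) vC vus rus.
have r3 := run_souts (width n) true (@stuck_empty n) vB vus rus.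
rewrite -/us1 in r1; rewrite -/us3 in r3.
have [vd rd] := dual_valid frC vW; rewrite rW dual_empty in rd.
have [vd1 rd1] := dual_valid frC vo1; rewrite r1 dual_empty in rd1.
have [vr3 rr3] := valid_rcons_None vo3; rewrite r3 in rr3.
have DD : sdeaths (width n) false (dualc n (run (full n) C)) (None :: map (duals n) us1)
            (map (duals n) W) =
          sdeaths (width n) false (run (full n) B) (rcons us3 None) A.
  rewrite sdeaths_None sdeaths_rcons_None dual_sdeaths // -d1 -d2 size_map sW sA.
  exact: early_late.
have [] := deaths_inj (us1 := None :: map (duals n) us1) (us2 := rcons us3 None)
  (@stuck_empty n) (@solid_dual n _) (proj2 frB) vd vA rd rA vd1 vr3 rd1 rr3 _ _ DD.
- by rewrite size_map sW sA.
- by rewrite size_rcons /= size_map !size_souts.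
move=> ef eu ea; split=> //.
by exists ds; rewrite // -d1 sW.
Qed.

(** Folding on contents: the first step is pushed to the end and put aside together
    with the step then preceding it, which is the last step of the word. *)
Fixpoint fold_pairs (m : nat) (zs : seq step) : seq (step * step) :=
  if m is m'.+1 then
    if zs is y :: zs' then
      let: (r, y') := push y zs' in
      rcons (fold_pairs m' (take (size zs').-1 r)) (last None r, y')
    else [::]
  else [::].

Lemma alt_rcons ps h : alt (rcons ps h) = alt ps ++ [:: (true, h.1); (false, h.2)].
Proof. by elim: ps => //= h' ps ->. Qed.

(** Colour [V] with [false] and [W] with [true]. A first step [y] is pushed through the
    rest of [V] within the evacuation, and then through [W] by switching, where it
    becomes the partner of the last step of [W]. *)
Lemma fold_pairs_conn V W : size V = size W ->
  conn (mk false (evac V) ++ mk true W) (alt (fold_pairs (size V) (V ++ W))).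
Proof.
elim/evac_ind: V W => [|y V IH] W; first by case: W => // _; apply: ConnRefl.
move=> sW; rewrite evac_cons cat_cons /= push_cat.
have := push_conn false (push y V).2 W; have := size_push (push y V).2 W.
case EW: (push (push y V).2 W) => [W1 y2] /= sW1.
case/lastP: W1 EW sW1 => [|W0 u] EW sW1 cn; first by rewrite -sW1 in sW.
have sz : size W0 = size V.
  by move: sW; rewrite -sW1 size_rcons /= => -[].
rewrite -rcons_cat last_rcons.
have -> : take (size (V ++ W)).-1 (rcons ((push y V).1 ++ W0) u) = (push y V).1 ++ W0.
  rewrite -cats1 take_size_cat // !size_cat size_push sz -sW /=; clear; lia.
rewrite alt_rcons /=; have := IH W0; rewrite size_push => /(_ (esym sz)) cn0.
have e1 h l r : mk false (rcons l h) ++ r = mk false l ++ (false, h) :: r.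
  by rewrite /mk map_rcons cat_rcons.
rewrite e1; apply: ConnTrans (conn_cat cn0 (ConnRefl _)).
rewrite -catA; apply: conn_cat (ConnRefl _) _.
by move: cn; rewrite /mk map_rcons cat_rcons.
Qed.

Lemma size_fold_pairs V W : size V = size W -> size (fold_pairs (size V) (V ++ W)) = size V.
Proof.
by move=> e; have [<- _] := alt_sizes (conn_sym (fold_pairs_conn e)); rewrite size_evac.
Qed.

Section Halves.
Variables (n : nat) (V W : seq step).
Hypotheses (cz : complete n (V ++ W)) (sVW : size V = size W).

Lemma fold_valid : valid (full n) (flat (fold_pairs (size V) (V ++ W))) /\
  run (full n) (flat (fold_pairs (size V) (V ++ W))) = empty n.
Proof.
have [+ _ +] := cz; rewrite valid_cat run_cat => /andP[vV vW] rW.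
have [vE rE] := evac_valid vV.
have := @conn_valid _ _ (full n) (fold_pairs_conn sVW).
rewrite unzip2_mk2 unzip2_alt valid_cat run_cat vE rE vW => /(_ isT)[-> ->].
by rewrite rW.
Qed.

(** By [evac_cat] the evacuation of [V ++ W] ends with the result of switching
    evac [V] past [W], and by [evac_rots] it ends with the rotation of [V]. *)
Lemma half_square : exists B,
  Square false (full n) (empty n) (evac V) W B (rots (width n) V) /\
  conn (alt (fold_pairs (size V) (V ++ W))) (mk true B ++ mk false (rots (width n) V)).
Proof.
have [B [A [e sA sB cn]]] := evac_cat false V W.
have eA : A = rots (width n) V.
  move: e; rewrite (evac_rots cz) rots_cat => /eqP; rewrite eqseq_cat.
    by move=> /andP[_ /eqP].
  by rewrite size_rots size_evac sB.
subst A; have cn' : conn (alt (fold_pairs (size V) (V ++ W))) (mk true B ++ mk false (rots (width n) V)).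
  exact: ConnTrans (conn_sym (fold_pairs_conn sVW)) cn.
have [v r] := fold_valid.
by exists B; split=> //; apply: (alt_square v r (conn_sym (fold_pairs_conn sVW)) cn').
Qed.

Lemma twin_fold_antisym : all (twin n) (fold_pairs (size V) (V ++ W)) ->
  rots (width n) V = map (duals n) W.
Proof.
move=> tps; have [us [pus vus _ rus]] := exists_down_twin (double_full n).
have [v r] := fold_valid; have [B [_ cn]] := half_square.
by have [] := twin_core tps v r pus vus rus (conn_sym (fold_pairs_conn sVW)) cn.
Qed.

(** The reference word [us] of twins is sorted by colours in the same way. The shape in the
    middle is the staircase both for it and for the given word ([stair_unique]),
    so that the square formed by its first half [C0] and by [W] shares [C0] with
    the one and [W] with the other. Through this square the rows entering [W] are
    seen to be those entering [W0], which are early by [twin_core]. *)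
Lemma antisym_twin_fold : rots (width n) V = map (duals n) W ->
  all (twin n) (fold_pairs (size V) (V ++ W)).
Proof.
move=> eA; have [us [pus vus prs rus]] := exists_down_twin (double_full n).
have [v r] := fold_valid; have [B [sq cn]] := half_square.
have tus : all (twin n) us by apply: sub_all pus => h /andP[].
have [C0 [W0 c1]] := sort_path (alt us) false.
have [B0 [A0 c2]] := sort_path (alt us) true; rewrite /= in c1 c2.
have [eA0 eB0 ev0 [ds sds ed]] := twin_core tus vus rus pus vus rus c1 c2.
have sq0 := alt_square vus rus c1 c2.
have [[vC0 vW0 vB0 vA0] [rW0 rA0]] := square_valid sq0.
have pCW : proper (C0 ++ W0).
  by rewrite -(unzip2_mk2 false true) -(conn_proper c1) unzip2_alt.
have st0 := square_rotc pCW sq0; rewrite eB0 in st0.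
have [[vC vW vB vA] [rW rA]] := square_valid sq.
have [vV pV rV] := cz; move: vV rV pV; rewrite valid_cat run_cat proper_cat.
move=> /andP[vV _] _ /andP[pV pW]; have [vE rE] := evac_valid vV.
have pEW : proper (evac V ++ W) by rewrite proper_cat evac_proper.
have st := square_rotc pEW sq.
have frC := framed_run (framed_full n) vC; have frC0 := framed_run (framed_full n) vC0.
have [vd rd] := dual_valid frC vW; rewrite rW dual_empty in rd.
have eBd : run (full n) B = dualc n (run (full n) (evac V)).
  by rewrite eA in vA rA; apply: (run_inj vA vd); rewrite rA rd.
rewrite eBd in st; have eC := stair_unique frC frC0 (esym st) (esym st0).
(* The mediating square, formed by C0 and W. *)
have [B1 [A1 cn1]] := cross_exists false C0 W.
have sq1 : Square false (full n) (empty n) C0 W B1 A1.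
  by split=> //; rewrite ?valid_cat ?run_cat -?eC ?vC0.
have stR : stuck (rotc (width n) (full n)) by rewrite rot_full; apply: stuck_empty.
have eB1 := square_snd stR (framed_full n) sq sq1; subst B1.
have [_ eo3 _] := square_fst_out (@stuck_empty n) (proj2 (framed_full n)) vus rus sq1 sq0.
have [_ eo1 _] := square_fst_out (@stuck_empty n) (proj2 (framed_full n)) vus rus
  (square_sym sq) (square_sym sq1).
rewrite /= in eo1 eo3.
have vs : valid (full n) (unzip2 (alt (fold_pairs (size V) (V ++ W)))) by rewrite unzip2_alt.
have [/= d1 d2] := square_deaths_snd (proj2 (framed_full n)) sq vus
  (conn_sym (fold_pairs_conn sVW)) vs.
rewrite eo1 in d1; rewrite eo3 eA eBd in d2.
rewrite -eC in ed; have vo1 := (sgridP (width n) false vC0 vus).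
have [vo _ _] := vo1; rewrite -eC in vo.
have vW0' : valid (run (full n) (evac V)) W0 by rewrite eC.
have rW0' : run (run (full n) (evac V)) W0 = empty n by rewrite eC.
have [ds2 ed2 sds2] := early_transfer (@stuck_empty n) vW0' vW rW0' rW vo ed.
have eL : deaths (width n) false (full n) (flat us) (alt (fold_pairs (size V) (V ++ W))) =
    late (size W) ds2.
  have : nseq (size W) false :: sdeaths (width n) true (run (full n) (evac V))
      (souts (width n) false (full n) (flat us) C0) W =
    rcons (sdeaths (width n) false (dualc n (run (full n) (evac V)))
      (souts (width n) true (full n) (flat us) B0) (map (duals n) W)) (nseq (size W) false).
    rewrite -[in X in rcons _ X](size_map (duals n) W).
    by rewrite -sdeaths_rcons_None -ev0 sdeaths_None size_map dual_sdeaths.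
  rewrite ed2 early_late d2 => /rcons_inj[<-].
  by [].
have sF := size_fold_pairs sVW.
have sds2' : size ds2 = size us by rewrite sds2.
have sFW : size (fold_pairs (size V) (V ++ W)) = size W by rewrite sF.
rewrite ed2 -sFW in d1; rewrite -sFW in eL.
by have [] := grid_inv (framed_full n) v vus r rus sds2' d1 eL.
Qed.

End Halves.

(** * Tableaux and their words of contents *)

Section Tableaux.
Variables (n M : nat).
Implicit Types (T : tableau n M) (D : seq (letter M)) (a b : letter M) (p q : cell n).

(** The usual content j - i, shifted to be the position of the horizontal edge of the
    cell when it is a corner. *)
Definition content p : nat := p.2 + n - p.1.

(** Standard tableaux for the order in which [D] lists the letters, the largest one
    first. *)
Definition standard T D : Prop :=
  [/\ bijective T, uniq D /\ (forall a, a \in D),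
      forall i (j1 j2 : 'I_n.+1), j1 < j2 -> index (T (i, j2)) D < index (T (i, j1)) D
    & forall (i1 i2 : 'I_n) j, i1 < i2 -> index (T (i2, j)) D < index (T (i1, j)) D].

Lemma standard_SYT (lt : rel (letter M)) T D : uniq D -> (forall a, a \in D) ->
  (forall a b, lt a b = (index b D < index a D)) -> SYT lt T <-> standard T D.
Proof.
move=> uD aD ltE; split=> [[bT row col]|[bT _ row col]]; split=> //.
- by move=> i j1 j2 /(row i); rewrite ltE.
- by move=> i1 i2 j /(col i1 i2 j); rewrite ltE.
- by move=> i j1 j2 /(row i); rewrite ltE.
by move=> i1 i2 j /(col i1 i2 j); rewrite ltE.
Qed.

Lemma standard_le T D p q : standard T D -> p.1 <= q.1 -> p.2 <= q.2 ->
  index (T q) D <= index (T p) D.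
Proof.
case: p q => i1 j1 [i2 j2] [_ _ row col] /= le1 le2.
apply: (@leq_trans (index (T (i1, j2)) D)).
  case: (ltngtP i1 i2) le1 => // [lt|e] _; first exact/ltnW/col.
  by rewrite (val_inj e).
case: (ltngtP j1 j2) le2 => // [lt|e] _; first exact/ltnW/row.
by rewrite (val_inj e).
Qed.

Lemma standard_index_inj T D p q : standard T D -> index (T p) D = index (T q) D -> p = q.
Proof.
move=> [bT [uD aD] _ _] e; apply: (bij_inj bT).
by rewrite -(nth_index (T p) (aD (T p))) e nth_index.
Qed.

Lemma standard_lt T D p q : standard T D -> p != q -> p.1 <= q.1 -> p.2 <= q.2 ->
  index (T q) D < index (T p) D.
Proof.
move=> sT npq le1 le2; rewrite ltn_neqAle standard_le // andbT.
by apply: contra_neq npq => /(standard_index_inj sT) ->.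
Qed.

(** A cell between them or diagonally opposite would hold a letter of
    intermediate rank. *)
Lemma consecutive_neighbours T D p q : standard T D ->
  index (T q) D = (index (T p) D).+1 ->
  up_or_left p q = (((content p).+1 == content q) || ((content q).+1 == content p)).
Proof.
case: p q => i j [i' j'] sT e; rewrite /up_or_left /content /=.
have ltj := ltn_ord j; have ltj' := ltn_ord j'.
have lti := ltn_ord i; have lti' := ltn_ord i'.
have npq : (i, j) != (i', j') by apply/eqP => E; rewrite E in e; move: e; clear; lia.
have H1 : ~~ ((i <= i') && (j <= j')).
  apply/negP => /andP[l1 l2]; have := standard_lt sT npq l1 l2.
  by rewrite e; clear; lia.
have H2 : ~~ ((i' < i) && (j' < j)).
  apply/negP => /andP[l1 l2].
  have d1 : (i', j') != (i', j) by apply/eqP => -[] E; rewrite E ltnn in l2.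
  have d2 : (i', j) != (i, j) by apply/eqP => -[] E; rewrite E ltnn in l1.
  have := standard_lt sT d1 (leqnn _) (ltnW l2); have := standard_lt sT d2 (ltnW l1) (leqnn _).
  by rewrite e; clear; lia.
rewrite -!(inj_eq val_inj) /=.
move: (nat_of_ord i) (nat_of_ord j) (nat_of_ord i') (nat_of_ord j') ltj ltj' lti lti' H1 H2.
by clear=> i0 j0 i1 j1; lia.
Qed.

Lemma up_or_left_lt p q : up_or_left p q -> [/\ q != p, q.1 <= p.1 & q.2 <= p.2].
Proof.
case: p q => i j [i' j'] /=; rewrite /up_or_left -pair_eqE /pair_eq /= -!(inj_eq val_inj) /=.
move: (nat_of_ord i) (nat_of_ord j) (nat_of_ord i') (nat_of_ord j') => i0 j0 i1 j1 H.
by split; move: H; clear; lia.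
Qed.

Definition swap_cells T p q : tableau n M := [ffun x => T (tperm p q x)].
Definition place T a : option (cell n) := [pick p | T p == a].

Lemma placeE T p a : injective T -> T p = a -> place T a = Some p.
Proof.
move=> iT e; rewrite /place; case: pickP => [q /eqP eq|/(_ p)]; last by rewrite e eqxx.
by congr Some; apply: iT; rewrite eq.
Qed.

Definition letter_content T a : step := omap content (place T a).
Definition contents T D : seq step := map (letter_content T) D.

Lemma letter_contentE T p a : injective T -> T p = a -> letter_content T a = Some (content p).
Proof. by move=> iT /(placeE iT) e; rewrite /letter_content e. Qed.

(** A Bender-Knuth move: the letters [a] and [b], of consecutive ranks, exchange their
    places in the order; if their cells are neighbours, they also exchange cells. *)
Definition exchange T a b : tableau n M :=
  if place T a is Some p then
    if place T b is Some q then if up_or_left p q then swap_cells T p q else T else T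
  else T.

Lemma index_exchange (D1 D2 : seq (letter M)) a b c :
  uniq (D1 ++ [:: a, b & D2]) ->
  index c (D1 ++ [:: b, a & D2]) =
  index (tperm a b c) (D1 ++ [:: a, b & D2]).
Proof.
rewrite cat_uniq /= !negb_or ?inE ?negb_or => /and3P[_ /and3P[a1 b1 _] /andP[/andP[ab _] _]].
have ba : b != a by rewrite eq_sym.
rewrite !index_cat /=.
case: tpermP => [->|->|/eqP ca /eqP cb].
- by rewrite (negPf a1) (negPf b1) !eqxx (negPf ab) (negPf ba).
- by rewrite (negPf a1) (negPf b1) !eqxx.
by rewrite ![_ == c]eq_sym (negPf ca) (negPf cb).
Qed.

(** If the cells are not neighbours, no other letter lies between the two ranks, so
    that standardness is not affected by the change of order. In both cases the
    effect on the contents is a switch. *)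
Lemma exchange_standard T (D1 D2 : seq (letter M)) a b :
  standard T (D1 ++ [:: a, b & D2]) ->
  [/\ standard (exchange T a b) (D1 ++ [:: b, a & D2]),
      contents (exchange T a b) D1 = contents T D1,
      contents (exchange T a b) D2 = contents T D2 &
      (letter_content (exchange T a b) b, letter_content (exchange T a b) a) =
      sw (letter_content T a) (letter_content T b)].
Proof.
set D := D1 ++ _ => sT; have [bT [uD aD] row col] := sT; have iT := bij_inj bT.
have [T' TK T'K] := bT; set p := T' a; set q := T' b.
have Tp : T p = a by apply: T'K.
have Tq : T q = b by apply: T'K.
have uD' : uniq (D1 ++ [:: b, a & D2]).
  rewrite (perm_uniq (_ : perm_eq _ D)) // perm_cat2l.
  by rewrite (perm_catCA [:: b] [:: a] D2).
have aD' c : c \in D1 ++ [:: b, a & D2].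
  by have := aD c; rewrite /D !mem_cat !inE (orbCA (c == a)).
move: (uD); rewrite cat_uniq /= => /and3P[_ H1 /andP[H2 _]].
have [a1 b1] : a \notin D1 /\ b \notin D1 by move: H1; rewrite !negb_or => /and3P[-> ->].
have [ab a2] : a != b /\ a \notin D2 by move: H2; rewrite inE negb_or => /andP[-> ->].
have b2 : b \notin D2.
  by move: uD; rewrite cat_uniq /= => /and3P[_ _ /and3P[_ ->]].
have ia : index a D = size D1 by rewrite /D index_cat (negPf a1) /= eqxx addn0.
have ib : index b D = (size D1).+1.
  by rewrite /D index_cat (negPf b1) /= (negPf ab) eqxx addn1.
have npq : p != q by apply: contraNneq ab => e; rewrite -Tp -Tq e.
have cons_ : index (T q) D = (index (T p) D).+1 by rewrite Tp Tq ia ib.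
have near := consecutive_neighbours sT cons_.
have exE : exchange T a b = if up_or_left p q then swap_cells T p q else T.
  by rewrite /exchange (placeE iT Tp) (placeE iT Tq).
have cp : letter_content T a = Some (content p) by apply: letter_contentE.
have cq : letter_content T b = Some (content q) by apply: letter_contentE.
rewrite exE; case: ifP => [ul|nul].
  set S := swap_cells T p q.
  have iS : injective S by move=> x y; rewrite !ffunE => /iT/perm_inj.
  have Sp : S p = b by rewrite ffunE tpermL.
  have Sq : S q = a by rewrite ffunE tpermR.
  have rk x : index (S x) (D1 ++ [:: b, a & D2]) = index (T x) D.
    rewrite index_exchange // ffunE.
    case: (tpermP p q x) => [->|->|/eqP xp /eqP xq]; first by rewrite Tp Tq tpermR.
      by rewrite Tp Tq tpermL.
    by rewrite tpermD // -?Tp -?Tq (inj_eq iT) eq_sym.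
  have other c : c != a -> c != b -> letter_content S c = letter_content T c.
    move=> ca cb; have e : T (T' c) = c by apply: T'K.
    rewrite (letter_contentE iT e) (letter_contentE (p := T' c)) //.
    by rewrite ffunE tpermD // (inj_eq (can_inj T'K)) eq_sym.
  split.
  - split=> //.
      by exists (fun c => tperm p q (T' c)) => x; rewrite ffunE ?tpermK ?TK ?tpermK ?T'K.
    + by move=> i j1 j2 lt; rewrite !rk; apply: row.
    by move=> i1 i2 j lt; rewrite !rk; apply: col.
  - apply/eq_in_map => c cD; apply: other.
      by apply: contraNneq a1 => <-.
    by apply: contraNneq b1 => <-.
  - apply/eq_in_map => c cD; apply: other.
      by apply: contraNneq a2 => <-.
    by apply: contraNneq b2 => <-.
  by rewrite (letter_contentE iS Sp) (letter_contentE iS Sq) cp cq sw_near // -near.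
split=> //; last first.
  by rewrite cp cq sw_far //; move: nul; rewrite near => /norP[].
have rk x : index (T x) (D1 ++ [:: b, a & D2]) =
    if x == p then (size D1).+1 else if x == q then size D1 else index (T x) D.
  rewrite index_exchange //.
  case: eqP => [->|/eqP xp]; first by rewrite Tp tpermL.
  case: eqP => [->|/eqP xq]; first by rewrite Tq tpermR.
  by rewrite tpermD // -?Tp -?Tq (inj_eq iT) eq_sym.
have key (x y : cell n) : x != y -> x.1 <= y.1 -> x.2 <= y.2 ->
    (x = q -> y = p -> up_or_left p q) ->
    index (T y) (D1 ++ [:: b, a & D2]) < index (T x) (D1 ++ [:: b, a & D2]).
  move=> nxy l1 l2 H; have := standard_lt sT nxy l1 l2; rewrite !rk.
  have inj z : z != p -> z != q -> index (T z) D != size D1 /\ index (T z) D != (size D1).+1.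
    move=> zp zq; rewrite -ib -ia -Tp -Tq; split.
      by apply: contra_neq zp => /(standard_index_inj sT).
    by apply: contra_neq zq => /(standard_index_inj sT).
  have [xp|nxp] := eqVneq x p; have [yp|nyp] := eqVneq y p.
  - by rewrite xp yp eqxx in nxy.
  - rewrite xp Tp ia; have [yq|nyq] := eqVneq y q; first by rewrite yq Tq ib; clear; lia.
    by have [] := inj y nyp nyq; clear; lia.
  - rewrite yp Tp ia; have [xq|nxq] := eqVneq x q.
      by have := H xq yp; rewrite nul.
    by have [] := inj x nxp nxq; clear; lia.
  have [xq|nxq] := eqVneq x q; have [yq|nyq] := eqVneq y q.
  - by rewrite xq yq eqxx in nxy.
  - by rewrite xq Tq ib; have [] := inj y nyp nyq; clear; lia.
  - by rewrite yq Tq ib; have [] := inj x nxp nxq; clear; lia.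
  by [].
have between (x y z : cell n) : x != z -> z != y ->
    x.1 <= z.1 -> z.1 <= y.1 -> x.2 <= z.2 -> z.2 <= y.2 ->
    x = q -> y = p -> False.
  move=> n1 n2 l1 l2 l3 l4 xq yp; have := standard_lt sT n1 l1 l3.
  have := standard_lt sT n2 l2 l4; rewrite xq yp Tp Tq ia ib; clear; lia.
split=> //.
  move=> i j1 j2 lt; apply: key => //=; [|exact: ltnW|].
    by apply/eqP => -[] E; rewrite E ltnn in lt.
  move=> xq yp; rewrite -xq -yp /up_or_left /= eqxx /=.
  have [e|ne] := eqVneq j1.+1 (val j2); first by rewrite ?e ?eqxx ?orbT.
  have jc : j1.+1 < n.+1 by have := ltn_ord j2; move: lt; clear; lia.
  exfalso; apply: (between (i, j1) (i, j2) (i, Ordinal jc)) => //=.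
  - by apply/eqP => -[] E; have := congr1 val E; rewrite /=; clear; lia.
  - by apply/eqP => -[] E; move: ne; rewrite -E /= eqxx.
move=> i1 i2 j lt; apply: key => //=; [|exact: ltnW|].
  by apply/eqP => -[] E; rewrite E ltnn in lt.
move=> xq yp; rewrite -xq -yp /up_or_left /= eqxx /=.
have [e|ne] := eqVneq i1.+1 (val i2); first by rewrite ?e ?eqxx ?orbT.
have ic : i1.+1 < n by have := ltn_ord i2; move: lt; clear; lia.
exfalso; apply: (between (i1, j) (i2, j) (Ordinal ic, j)) => //=.
- by apply/eqP => -[] E; have := congr1 val E; rewrite /=; clear; lia.
- by apply/eqP => -[] E; move: ne; rewrite -E /= eqxx.
Qed.

End Tableaux.

(** * The word of a tableau empties the rectangle *)

Lemma card_below m k : k <= m -> #|[set i : 'I_m | i < k]| = k.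
Proof.
move=> le; rewrite cardsE -sum1_card -(big_ord_widen m (fun=> 1)) //.
by rewrite sum_nat_const card_ord muln1.
Qed.

Lemma initial_segment m (A : {set 'I_m}) (j : 'I_m) :
  (forall j1 j2 : 'I_m, j1 <= j2 -> j2 \in A -> j1 \in A) -> (j \in A) = (j < #|A|).
Proof.
move=> down; apply/idP/idP => [jA|].
  have <- := card_below (ltn_ord j); apply: subset_leq_card.
  by apply/subsetP => i; rewrite inE ltnS => /down; apply.
apply: contraTT => jA; rewrite -leqNgt.
have <- := card_below (ltnW (ltn_ord j)); apply: subset_leq_card.
by apply/subsetP => i iA; rewrite inE ltnNge; apply: contra jA => ji; apply: down iA.
Qed.

(** Apart from position 0, the zeros are the vertical edges at the ends of the rows, whose
    lengths are [lam]. *)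
Definition shape_config (n : nat) (lam : 'I_n -> nat) : config :=
  fun z => ~~ ((z == 0) || [exists i : 'I_n, z == lam i + (n - i)]).

Lemma shape_config_remove n (lam lam' : 'I_n -> nat) (i0 : 'I_n) :
  (forall i i' : 'I_n, i <= i' -> lam i' <= lam i) ->
  (forall i' : 'I_n, i0 < i' -> lam i' < lam i0) -> 0 < lam i0 ->
  (forall i, lam' i = if i == i0 then (lam i0).-1 else lam i) ->
  let x := (lam i0).-1 + (n - i0) in
  can (shape_config lam) (Some x) /\ hop x (shape_config lam) = shape_config lam'.
Proof.
move=> mono strict pos lamE x; have i0n := ltn_ord i0.
have neq (i : 'I_n) : i != i0 -> lam i + (n - i) != x /\ lam i + (n - i) != x.+1.
  rewrite -(inj_eq val_inj) /= => ne; have := ltn_ord i; rewrite /x.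
  case: (ltngtP i i0) ne => // [lt|gt] _.
    by have := mono i i0 (ltnW lt); move: pos lt i0n; clear; lia.
  by have := strict i gt; move: pos gt i0n; clear; lia.
have xE : lam i0 + (n - i0) = x.+1 by rewrite /x; move: pos; clear; lia.
have x0 : x != 0 by rewrite /x; move: i0n; clear; lia.
split.
  rewrite /= /shape_config negbK (negPf x0) /=; apply/andP; split.
    apply/existsPn => i; have [->|ne] := eqVneq i i0; first by rewrite xE; clear; lia.
    by rewrite eq_sym; case: (neq i ne).
  by apply/existsP; exists i0; rewrite xE.
apply: functional_extensionality => z; rewrite hopE /shape_config.
have [->|zx] := eqVneq z x.
  apply/esym/negbTE; rewrite negbK (negPf x0); apply/existsP; exists i0.
  by rewrite lamE eqxx.
have [->|zx1] := eqVneq z x.+1.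
  apply/esym/negP => /existsP[i]; rewrite lamE.
  have [->|ne] := eqVneq i i0; first by rewrite -/x; clear; lia.
  by rewrite eq_sym (negPf (proj2 (neq i ne))).
congr (~~ (_ || _)); apply: eq_existsb => i; rewrite lamE.
have [->|//] := eqVneq i i0.
by rewrite xE -/x (negPf zx) (negPf zx1).
Qed.

Section Complete.
Variables (n M : nat).
Implicit Types (T : tableau n M) (D : seq (letter M)).

Definition row_length T D (t : nat) (i : 'I_n) : nat :=
  #|[set j : 'I_n.+1 | t <= index (T (i, j)) D]|.

Lemma row_lengthP T D t i j : standard T D ->
  (t <= index (T (i, j)) D) = (j < row_length T D t i).
Proof.
move=> sT; rewrite -initial_segment ?inE // => j1 j2 le; rewrite !inE => /leq_trans; apply.
exact: (standard_le (p := (i, j1)) (q := (i, j2)) sT).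
Qed.

Lemma row_length_bound T D t i : row_length T D t i <= n.+1.
Proof. by rewrite -[X in _ <= X]card_ord; apply: max_card. Qed.

Lemma row_length_step T D t p : standard T D -> index (T p) D = t ->
  let lam := row_length T D t in
  [/\ lam p.1 = p.2.+1,
      forall i' : 'I_n, p.1 < i' -> lam i' < lam p.1
    & forall i, row_length T D t.+1 i = if i == p.1 then (lam p.1).-1 else lam i].
Proof.
case: p => i0 j0 sT e lam /=.
have lam0 : lam i0 = j0.+1.
  apply/eqP; rewrite eqn_leq; apply/andP; split; last first.
    by rewrite /lam -row_lengthP // e.
  rewrite leqNgt; apply/negP => lt.
  have jb : j0.+1 < n.+1 by apply: leq_trans lt (row_length_bound T D t i0).
  have := row_lengthP t i0 (Ordinal jb) sT; rewrite /= -/(lam i0) lt => H.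
  have := @standard_lt n M T D (i0, j0) (i0, Ordinal jb) sT; rewrite e => /(_ _ _ _).
  have ne : (i0, j0) != (i0, Ordinal jb).
    by apply/eqP => -[] /(congr1 val) /=; clear; lia.
  by move=> /(_ ne (leqnn _) (leqnSn _)); rewrite ltnNge H.
split=> //.
  move=> i' lt; rewrite lam0 ltnS leqNgt; apply/negP => lt'.
  have := row_lengthP t i' j0 sT; rewrite -/(lam i') lt' => H.
  have ne : (i0, j0) != (i', j0) by apply/eqP => -[] E; rewrite E ltnn in lt.
  have := standard_lt sT ne (ltnW lt) (leqnn _).
  by rewrite e ltnNge H.
move=> i; have [->|ne] := eqVneq i i0.
  rewrite lam0 /=; apply/eqP; rewrite eqn_leq leqNgt; apply/andP; split.
    by rewrite -row_lengthP // e -ltnNge.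
  rewrite leqNgt; apply/negP => lt.
  have jb : row_length T D t.+1 i0 < n.+1 by apply: leq_trans lt (ltnW (ltn_ord _)).
  have := row_lengthP t.+1 i0 (Ordinal jb) sT; rewrite ltnn => /negbT; rewrite -ltnNge ltnS => le.
  have ne : (i0, Ordinal jb) != (i0, j0).
    by apply/eqP => -[] /(congr1 val) /= E; move: lt; rewrite E ltnn.
  by have := standard_lt sT ne (leqnn _) (ltnW lt); rewrite e ltnNge le.
apply: eq_card => j; rewrite !inE ltn_neqAle andb_idl // => _.
apply: contra_neq ne => E; have := @standard_index_inj n M T D (i, j) (i0, j0) sT.
by rewrite e E => /(_ erefl)[].
Qed.

(** The cells of letters of rank at least [t] form a shape at each time [t], and
    between two times one of its corners is removed. *)
Lemma standard_complete T D : standard T D -> complete n (contents T D).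
Proof.
move=> sT; have [bT [uD aD] _ _] := sT; have iT := bij_inj bT; have [T' TK T'K] := bT.
have prop : proper (contents T D).
  rewrite /proper /contents all_map; apply/allP => a _ /=.
  by rewrite (letter_contentE (p := T' a)).
have main t : t <= size D ->
    valid (shape_config (row_length T D t)) (contents T (drop t D)) /\
    run (shape_config (row_length T D t)) (contents T (drop t D)) =
    shape_config (row_length T D (size D)).
  move=> le; rewrite -(subKn le); move: (size D - t) (leq_subr t (size D)) => k.
  elim: k => [|k IH] lek; first by rewrite subn0 drop_size.
  have lt : size D - k.+1 < size D by move: lek; clear; lia.
  have sS : (size D - k.+1).+1 = size D - k by move: lek; clear; lia.
  set t' := size D - k.+1 in lt sS *; have a0 : letter M.
    by case: (D) lt => // a; clear.
  rewrite (drop_nth a0 lt) sS /=; set a := nth a0 D t'.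
  have e : index (T (T' a)) D = t' by rewrite T'K /a index_uniq.
  have [l0 strict step] := row_length_step sT e.
  rewrite (letter_contentE (p := T' a)) //.
  have mono (i i' : 'I_n) : i <= i' -> row_length T D t' i' <= row_length T D t' i.
    move=> le'; apply: subset_leq_card; apply/subsetP => j; rewrite !inE => /leq_trans; apply.
    exact: (standard_le (p := (i, j)) (q := (i', j)) sT).
  have pos : 0 < row_length T D t' (T' a).1 by rewrite l0.
  have := shape_config_remove mono strict pos step; rewrite l0 /= sS.
  have -> : (T' a).2 + (n - (T' a).1) = content (T' a).
    by rewrite /content addnBA // ltnW.
  move=> [c1 e1]; have [v r] := IH (ltnW lek).
  by rewrite /act e1 v r /= andbT; split.
have [v r] := main 0 (leq0n _); rewrite drop0 in v r.
have e0 : shape_config (row_length T D 0) = full n.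
  apply: functional_extensionality => z; rewrite /shape_config /full.
  have l0 i : row_length T D 0 i = n.+1.
    rewrite /row_length -[RHS]card_ord; apply: eq_card => j; by rewrite !inE.
  apply/idP/idP.
    rewrite negb_or => /andP[z0 /existsPn H].
    case: (leqP z n.+1) => zn; first by move: z0; clear; lia.
    case: (leqP (width n) z) => zw; first by rewrite orbT.
    have ib : width n - z.+1 < n by move: zn zw; clear; lia.
    have := H (Ordinal ib); rewrite l0 /=; move: zn zw; clear; lia.
  move=> H; rewrite negb_or; apply/andP; split; first by move: H; clear; lia.
  apply/existsPn => i; rewrite l0; have := ltn_ord i; move: H; clear; lia.
have eN : shape_config (row_length T D (size D)) = empty n.
  apply: functional_extensionality => z; rewrite /shape_config /empty.
  have l0 i : row_length T D (size D) i = 0.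
    rewrite /row_length; apply: eq_card0 => j; rewrite !inE leqNgt index_mem.
    by rewrite aD.
  apply/idP/idP.
    rewrite negb_or => /andP[z0 /existsPn H]; rewrite ltnNge; apply/negP => zn.
    have ib : n - z < n by move: z0 zn; clear; lia.
    have := H (Ordinal ib); rewrite l0 /=; move: z0 zn; clear; lia.
  move=> H; rewrite negb_or; apply/andP; split; first by move: H; clear; lia.
  apply/existsPn => i; rewrite l0; have := ltn_ord i; move: H; clear; lia.
by rewrite e0 in v r; split; rewrite // r eN.
Qed.

End Complete.

(** * Slides as sequences of exchanges *)

Section Sliding.
Variables (n M : nat).
Implicit Types (T : tableau n M) (D : seq (letter M)) (a b : letter M) (p q : cell n).

Fixpoint carry T a (bs : seq (letter M)) : tableau n M :=
  if bs is b :: bs' then carry (exchange T a b) a bs' else T.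

Lemma contents_cat T D1 D2 : contents T (D1 ++ D2) = contents T D1 ++ contents T D2.
Proof. exact: map_cat. Qed.

Lemma carry_standard T D1 a bs D2 : standard T (D1 ++ a :: bs ++ D2) ->
  [/\ standard (carry T a bs) (D1 ++ bs ++ a :: D2),
      contents (carry T a bs) D1 = contents T D1,
      contents (carry T a bs) D2 = contents T D2 &
      (contents (carry T a bs) bs, letter_content (carry T a bs) a) =
      push (letter_content T a) (contents T bs)].
Proof.
elim: bs T D1 => [|b bs IH] T D1 /= sT; first by split.
have [sE e1 e2 e3] := exchange_standard sT.
have sE' : standard (exchange T a b) ((D1 ++ [:: b]) ++ a :: bs ++ D2) by rewrite -catA.
have [sC f1 f2 f3] := IH _ _ sE'.
move: e2 f1; rewrite !contents_cat => /eqP; rewrite eqseq_cat ?size_map // => /andP[/eqP g1 /eqP g2].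
move=> /eqP; rewrite eqseq_cat ?size_map // => /andP[/eqP h1 /eqP [h2]].
split.
- by rewrite -catA in sC.
- by rewrite h1 e1.
- by rewrite f2 g2.
case: (sw _ _) e3 => z1 y1 [<- <-].
by rewrite -g1; case: (push _ _) f3 => r y2 [<- <-]; rewrite h2.
Qed.

Lemma lt_unfolded_asym a b : lt_unfolded a b -> ~~ lt_unfolded b a.
Proof. by case: a b => i [] [j []]; rewrite /lt_unfolded //=; clear; lia. Qed.

Lemma slide_stepE k T p : injective T -> T p = (k, true) ->
  slide_step k T = if [pick q | slide_target k T p q] is Some q then swap_cells T p q else T.
Proof.
move=> iT Tp; rewrite /slide_step; case: pickP => [p1 /eqP Tp1|/(_ p)]; last by rewrite Tp eqxx.
by have -> : p1 = p by apply: iT; rewrite Tp1.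
Qed.

(** The slide interchanges [(k, true)] with the largest active letter above or to the left.
    Passing the active letters in decreasing order instead, nothing happens to the
    cells until the letter passed is in a neighbouring cell; this is the first
    such letter, hence the target of the slide. The bound [m] on the number of
    steps is sufficient because each step decreases the sum of the coordinates. *)
Lemma slide_carry k T D1 bs D2 p m : T p = (k, true) ->
  standard T (D1 ++ (k, true) :: bs ++ D2) ->
  (forall c, active k c -> c \in D1 ++ bs) -> all (active k) bs ->
  pairwise (fun b c => lt_unfolded c b) bs -> p.1 + p.2 <= m ->
  iter m (slide_step k) T = carry T (k, true) bs.
Proof.
elim: bs T D1 p m => [|b bs IH] T D1 p m Tp sT act_in act_all pw le /=.
  have kD1 : (k, true) \notin D1.
    by case: (sT) => _ [uD _] _ _; move: uD; rewrite cat_uniq /= => /and3P[_ /norP[]].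
  have [bT [uD aD] _ _] := sT; have iT := bij_inj bT.
  suff st : slide_step k T = T by elim: m {le} => //= m ->.
  rewrite (slide_stepE iT Tp); case: pickP => // q /and3P[ul ac _].
  have [nqp l1 l2] := up_or_left_lt ul.
  have := standard_lt sT nqp l1 l2; rewrite Tp.
  have := act_in _ ac; rewrite cats0 => inD.
  rewrite !index_cat inD /= eqxx (negPf kD1) addn0 => lt; move: inD.
  by rewrite -index_mem => /ltnW; rewrite leqNgt lt.
have kD1 : (k, true) \notin D1.
  by case: (sT) => _ [uD _] _ _; move: uD; rewrite cat_uniq /= => /and3P[_ /norP[]].
have [bT [uD aD] _ _] := sT; have iT := bij_inj bT; have [T' TK T'K] := bT.
set q := T' b; have Tq : T q = b by apply: T'K.
have exE : exchange T (k, true) b = if up_or_left p q then swap_cells T p q else T.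
  by rewrite /exchange (placeE iT Tp) (placeE iT Tq).
have [sE _ _ _] := exchange_standard sT.
have sE' : standard (exchange T (k, true) b) ((D1 ++ [:: b]) ++ (k, true) :: bs ++ D2).
  by rewrite -catA.
have act_in' c : active k c -> c \in (D1 ++ [:: b]) ++ bs by rewrite -catA; apply: act_in.
move: act_all pw => /= /andP[acb act_all] /andP[gtb pw].
move: sE'; rewrite exE; case: ifP => [ul|nul] sE'; last exact: (IH _ (D1 ++ [:: b]) p).
have notD1 s : up_or_left p s -> active k (T s) -> T s \in b :: bs.
  move=> uls acs; have := act_in _ acs; rewrite mem_cat => /orP[inD|//].
  have [nsp l1 l2] := up_or_left_lt uls.
  have := standard_lt sT nsp l1 l2; rewrite Tp !index_cat inD /= eqxx.
  rewrite (negPf kD1) addn0 => lt; move: inD; rewrite -index_mem => /ltnW.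
  by rewrite leqNgt lt.
have tq : slide_target k T p q.
  rewrite /slide_target ul Tq acb /=; apply/forallP => s; apply/implyP => /andP[uls acs].
  have := notD1 s uls acs; rewrite inE => /orP[/eqP ->|inb].
    by apply/negP => lt; have := lt_unfolded_asym lt; rewrite lt.
  by apply: lt_unfolded_asym; apply: (allP gtb).
have stE : slide_step k T = swap_cells T p q.
  rewrite (slide_stepE iT Tp); case: pickP => [s|/(_ q)]; last by rewrite tq.
  move=> /and3P[uls acs /forallP/(_ q)]; rewrite ul Tq acb /= => nlt.
  have := notD1 s uls acs; rewrite inE => /orP[/eqP es|inb].
    by have -> : s = q by apply: iT; rewrite es Tq.
  by move: nlt; rewrite (allP gtb).
have lt : q.1 + q.2 < p.1 + p.2.
  by move: ul; rewrite /up_or_left => /orP[] /andP[/eqP e1 /eqP e2];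
     rewrite -e1 -e2 ?addSn ?addnS.
case: m le => [|m] le; first by case: (q.1 + q.2) lt (leq_trans lt le).
rewrite iterSr stE; apply: (IH _ (D1 ++ [:: b]) q) => //.
  by rewrite ffunE tpermR.
by rewrite -ltnS; apply: leq_trans lt le.
Qed.

(** The list is increasing and contains all elements of the alphabet from its head on.
    Such lists remain to be folded at each stage. *)
Fixpoint upper_segment (ks : seq 'I_M) : Prop :=
  if ks is k :: ks' then (forall j : 'I_M, (j \in ks') = (k < j)) /\ upper_segment ks' else True.

(** The letters in decreasing order before the folding, and below those in decreasing
    order after it. *)
Definition unfolded (ks : seq 'I_M) : seq (letter M) :=
  [seq (k, true) | k <- ks] ++ rev [seq (k, false) | k <- ks].
Fixpoint folded (ks : seq 'I_M) : seq (letter M) :=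
  if ks is k :: ks' then folded ks' ++ [:: (k, false); (k, true)] else [::].

Lemma unfolded_cons k ks :
  unfolded (k :: ks) = (k, true) :: unfolded ks ++ [:: (k, false)].
Proof. by rewrite /unfolded /= rev_cons -cats1 catA. Qed.

Lemma mem_unfolded ks (c : letter M) : (c \in unfolded ks) = (c.1 \in ks).
Proof.
have inj (s : bool) : injective (fun k : 'I_M => (k, s)) by move=> x y [].
rewrite mem_cat mem_rev; case: c => j [] /=.
  rewrite (mem_map (inj true)); case: (j \in ks) => //=.
  by apply/negbTE/mapP => -[].
rewrite (mem_map (inj false)); case: (j \in ks) => //=; rewrite ?orbT ?orbF //.
by apply/negbTE/mapP => -[].
Qed.

Lemma mem_folded ks (c : letter M) : (c \in folded ks) = (c.1 \in ks).
Proof.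
elim: ks => //= k ks IH; rewrite mem_cat IH !inE orbC; case: c {IH} => j [] /=;
  by rewrite !xpair_eqE ?andbT ?andbF ?orbF ?orFb.
Qed.

Lemma unfolded_pairwise ks : upper_segment ks ->
  pairwise (fun b c => lt_unfolded c b) (unfolded ks).
Proof.
elim: ks => // k ks IH [gt gk]; rewrite unfolded_cons /= all_cat pairwise_cat IH // andbT /=.
rewrite !andbT; apply/andP; split.
  by apply/allP => -[j []]; rewrite mem_unfolded /= gt /lt_unfolded //=.
rewrite allrel1r; apply/allP => -[j []]; rewrite mem_unfolded /= gt /lt_unfolded //=.
Qed.

Lemma folded_pairwise ks : upper_segment ks -> pairwise (fun b c => lt_folded c b) (folded ks).
Proof.
elim: ks => // k ks IH [gt gk] /=; rewrite pairwise_cat IH //= andbT.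
apply/andP; split; last by rewrite /lt_folded /= eqxx orbT.
apply/allrelP => -[j b] c; rewrite mem_folded gt /= => lt.
by rewrite !inE => /orP[] /eqP ->; rewrite /lt_folded /= lt.
Qed.

Lemma flat_rcons ps h : flat (rcons ps h) = flat ps ++ [:: h.1; h.2].
Proof. by rewrite /flat map_rcons flatten_rcons. Qed.

(** One slide is a passage of [(k, true)] through all letters still to be folded, after
    which [(k, false)] and [(k, true)] are the two smallest letters; they form the last
    pair of [fold_pairs]. *)
Lemma fold_standard ks T D2 : upper_segment ks -> standard T (unfolded ks ++ D2) ->
  let T' := foldl (fun T k => slide k T) T ks in
  [/\ standard T' (folded ks ++ D2),
      contents T' (folded ks) = flat (fold_pairs (size ks) (contents T (unfolded ks)))
    & contents T' D2 = contents T D2].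
Proof.
elim: ks T D2 => [|k ks IH] T D2; first by split.
move=> [gt gk]; rewrite unfolded_cons -[size _]/(size ks).+1.
rewrite -[(_ :: _) ++ D2]/((k, true) :: (_ ++ D2)) => sT.
set bs := unfolded ks ++ [:: (k, false)] in sT *.
have [bT [uD aD] _ _] := sT; have iT := bij_inj bT; have [T' TK T'K] := bT.
have slE : slide k T = carry T (k, true) bs.
  apply: (@slide_carry k T [::] bs D2 (T' (k, true))) => //.
  - move=> [j b] ac; rewrite cat0s mem_cat mem_unfolded gt inE /=.
    move: ac; rewrite /active /=; case: b => [->//|].
    by rewrite leq_eqVlt => /orP[/eqP e|->//]; rewrite (val_inj e) eqxx orbT.
  - apply/allP => -[j b]; rewrite /bs mem_cat mem_unfolded gt inE /active /=.
    case: b => [/orP[//|/eqP[]//]|/orP[/ltnW//|/eqP[->]]]; exact: leqnn.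
  - rewrite /bs pairwise_cat unfolded_pairwise //= andbT allrel1r.
    apply/allP => -[j []]; rewrite mem_unfolded /= gt /lt_unfolded //=.
  by rewrite leq_add // ltnW.
have [/= sC _ e2 e3] := carry_standard (D1 := [::]) sT.
rewrite -slE in sC e2 e3; rewrite /bs -catA /= in sC.
have [sF f1 f2] := IH _ _ gk sC.
rewrite /= -catA /=; split=> //; last by case: f2 => _ _ ->.
rewrite contents_cat f1 -e3 /=.
case: f2 => f2 f3 _; rewrite f2 f3 flat_rcons /bs !contents_cat !last_cat /=.
rewrite size_cat /= addn1 /= take_size_cat //.
by rewrite !size_cat /contents !size_map.
Qed.

End Sliding.

Lemma upper_segment_enum M : upper_segment (enum 'I_M).
Proof.
have H (l : seq 'I_M) : map val l = iota (M - size l) (size l) -> size l <= M -> upper_segment l.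
  elim: l => //= k l IH [ek el] le; have e1 : (M - (size l).+1).+1 = M - size l.
    by move: le; clear; lia.
  rewrite e1 in el; split; last exact: IH (ltnW le).
  move=> j; rewrite -(mem_map val_inj) el mem_iota (ek : nat_of_ord k = _).
  by have := ltn_ord j; move: le; rewrite /=; clear; lia.
by apply: H; rewrite size_enum_ord // subnn val_enum_ord.
Qed.

Lemma pairwise_index (T : eqType) (r : rel T) (s : seq T) a b : pairwise r s ->
  (forall a b, r a b -> ~~ r b a) -> a \in s -> b \in s ->
  r a b = (index a s < index b s).
Proof.
move=> /(pairwiseP a) pw asym ia ib.
have H c d : c \in s -> d \in s -> index c s < index d s -> r c d.
  move=> ic id lt; have := pw (index c s) (index d s).
  by rewrite !inE !index_mem !nth_index //; apply.
apply/idP/idP => [rab|]; last exact: H.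
have [//|lt|e] := ltngtP (index a s) (index b s).
  by have := asym _ _ rab; rewrite H.
have ab : a = b by rewrite -(nth_index a ia) e nth_index.
by move: (rab) (asym _ _ rab); rewrite ab => ->.
Qed.

Lemma lt_folded_asym M (a b : letter M) : lt_folded a b -> ~~ lt_folded b a.
Proof. by case: a b => i [] [j []]; rewrite /lt_folded -!(inj_eq val_inj) /=; clear; lia. Qed.

Lemma unfolded_SYT n M (T : tableau n M) :
  SYT (@lt_unfolded M) T <-> standard T (unfolded (enum 'I_M)).
Proof.
have pw := unfolded_pairwise (upper_segment_enum M).
have mem a : a \in unfolded (enum 'I_M) by rewrite mem_unfolded mem_enum.
apply: standard_SYT => //.
  apply: pairwise_uniq pw => a; apply/negP => lt.
  by have := lt_unfolded_asym lt; rewrite lt.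
move=> a b; rewrite -(pairwise_index pw) // => c d; exact: lt_unfolded_asym.
Qed.

Lemma folded_SYT n M (T : tableau n M) :
  SYT (@lt_folded M) T <-> standard T (folded (enum 'I_M)).
Proof.
have pw := folded_pairwise (upper_segment_enum M).
have mem a : a \in folded (enum 'I_M) by rewrite mem_folded mem_enum.
apply: standard_SYT => //.
  apply: pairwise_uniq pw => a; apply/negP => lt.
  by have := lt_folded_asym lt; rewrite lt.
move=> a b; rewrite -(pairwise_index pw) // => c d; exact: lt_folded_asym.
Qed.

(** * Reading the two symmetries off the contents *)

Lemma content_bounds n (p : cell n) : 0 < content p <= n.*2.
Proof.
case: p => i j; rewrite /content /=; have := ltn_ord i; have := ltn_ord j.
by move: (nat_of_ord i) (nat_of_ord j) => a b; clear; lia.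
Qed.

Lemma card_between m a b : b <= m -> #|[set i : 'I_m | a <= i < b]| = b - a.
Proof.
move=> le; have [lt|ge] := leqP a b; last first.
  apply/eqP; rewrite (eqP (_ : b - a == 0)) ?cards_eq0; last by move: ge; clear; lia.
  by apply/eqP/setP => i; rewrite !inE; move: ge; clear; lia.
have -> : [set i : 'I_m | a <= i < b] = [set i : 'I_m | i < b] :\: [set i : 'I_m | i < a].
  by apply/setP => i; rewrite !inE -leqNgt andbC.
rewrite cardsD (setIidPr _) ?card_below //; first exact: leq_trans lt le.
by apply/subsetP => i; rewrite !inE => /leq_trans; apply.
Qed.

Lemma diagonal_card n x a b : b <= n -> n <= a + x -> b + x <= n.*2.+1 ->
  #|[set q : cell n | (content q == x) && (a <= q.1 < b)]| = b - a.
Proof.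
move=> bn ax bx; rewrite -(card_between a bn).
rewrite -(card_in_imset (f := fun q : cell n => q.1)).
  apply: eq_card => i; rewrite !inE; apply/imsetP/idP => [[q + ->]|lt].
    by rewrite inE => /andP[].
  have jb : i + x - n < n.+1 by move: lt bx ax; clear; lia.
  exists (i, Ordinal jb) => //; rewrite inE /= lt andbT /content /=.
  by have := ltn_ord i; move: lt bx ax; clear; lia.
move=> [i j] [i' j']; rewrite !inE /content /= => /andP[/eqP e _] /andP[/eqP e' _] ei.
congr pair => //; apply: val_inj => /=; move: e e'; rewrite ei.
by have := ltn_ord i'; clear; lia.
Qed.

Section Depth.
Variables (n M : nat) (lt : rel (letter M)) (T : tableau n M) (D : seq (letter M)).
Hypotheses (sT : standard T D) (ltE : forall a b, lt a b = (index b D < index a D)).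
Implicit Types p q : cell n.

Lemma diagonal_order p q : content q = content p -> lt (T q) (T p) = (q.1 < p.1).
Proof.
have H r s : content r = content s -> r.1 < s.1 -> index (T s) D < index (T r) D.
  move=> e l; apply: standard_lt => //; last 2 first.
  - exact: ltnW.
  - move: e l; rewrite /content; have := ltn_ord s.1; have := ltn_ord s.2.
    by move: (ltn_ord r.1); clear; lia.
  by apply: contraTneq l => ->; rewrite ltnn.
move=> e; rewrite ltE; have [l|l|ei] := ltngtP q.1 p.1; first exact: H.
  by apply/negbTE; rewrite -leqNgt ltnW // H.
have -> : q = p; last by rewrite ltnn.
case: q p e ei => i j [i' j'] /=; rewrite /content /= => e /val_inj ei; subst i'.
congr pair; apply: val_inj => /=; move: e; have := ltn_ord i; clear; lia.
Qed.

(** The cells to the upper left on the same diagonal hold smaller letters, and they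
    continue up to the border of the rectangle. Together with the content this
    number determines the cell. *)
Lemma depth p : minn p.1 p.2 = #|[set q | (content q == content p) && lt (T q) (T p)]|.
Proof.
have := @diagonal_card n (content p) (p.1 - minn p.1 p.2) p.1.
have l1 := ltn_ord p.1; have l2 := ltn_ord p.2.
rewrite subKn ?geq_minl // => <-; first last.
- by rewrite /content; move: l1 l2; clear; lia.
- by rewrite /content; move: l1 l2; clear; lia.
- exact: ltnW.
apply: eq_card => q; rewrite !inE; case: eqP => //= e; rewrite diagonal_order //.
case: q p l1 l2 e => i j [i' j'] /= l1 l2; rewrite /content /=.
by have := ltn_ord i; move: l1 l2; clear; lia.
Qed.

Lemma codepth p :
  minn (n.-1 - p.1) (n - p.2) = #|[set q | (content q == content p) && lt (T p) (T q)]|.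
Proof.
have := @diagonal_card n (content p) p.1.+1 (p.1.+1 + minn (n.-1 - p.1) (n - p.2)).
have l1 := ltn_ord p.1; have l2 := ltn_ord p.2.
rewrite addKn => <-; first last.
- by rewrite /content; move: l1 l2; clear; lia.
- by rewrite /content; move: l1 l2; clear; lia.
- by move: l1 l2; clear; lia.
apply: eq_card => q; rewrite !inE; case: eqP => //= e; rewrite diagonal_order //.
case: q p l1 l2 e => i j [i' j'] /= l1 l2; rewrite /content /=.
by have := ltn_ord i; have := ltn_ord j; move: l1 l2; clear; lia.
Qed.

End Depth.

Lemma lt_unfolded_index M (a b : letter M) :
  lt_unfolded a b = (index b (unfolded (enum 'I_M)) < index a (unfolded (enum 'I_M))).
Proof.
rewrite -(pairwise_index (unfolded_pairwise (upper_segment_enum M))) ?mem_unfolded ?mem_enum //.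
by move=> c d; apply: lt_unfolded_asym.
Qed.

Lemma lt_folded_index M (a b : letter M) :
  lt_folded a b = (index b (folded (enum 'I_M)) < index a (folded (enum 'I_M))).
Proof.
rewrite -(pairwise_index (folded_pairwise (upper_segment_enum M))) ?mem_folded ?mem_enum //.
by move=> c d; apply: lt_folded_asym.
Qed.

(** The reflection reverses the diagonals, and takes the first cell of one to the last
    cell of another. If the contents correspond, then the letters before k on its
    diagonal correspond to those after k' on its own, so [depth] and [codepth] agree. *)
Lemma antidiagonal_contents n M (T : tableau n M) : SYT (@lt_unfolded M) T ->
  AST T <-> forall p q k, T p = (k, false) -> T q = (k, true) -> content q = (content p).+1.
Proof.
move=> hT; have sT := proj1 (unfolded_SYT T) hT.
have [bT _ _] := hT; have iT := bij_inj bT; have [P TP PT] := bT.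
split=> [[_ ast] [i j] q k Tp Tq|con].
  have [r [c [er ec Trc]]] := ast i.+1 j.+1 k (ex_intro _ i (ex_intro _ j (And3 erefl erefl Tp))).
  have -> : q = (r, c) by apply: iT; rewrite Trc.
  rewrite /content /=; have := ltn_ord i; have := ltn_ord j; move: er ec; clear; lia.
split=> // _ _ k [r [c [<- <- Trc]]].
have e (j : 'I_M) : content (P (j, true)) = (content (P (j, false))).+1.
  by apply: con (PT _) (PT _).
have dp := depth sT (@lt_unfolded_index M) (r, c).
have cp := codepth sT (@lt_unfolded_index M) (P (k, true)).
have card_eq : minn r c = minn (n.-1 - (P (k, true)).1) (n - (P (k, true)).2).
  rewrite cp dp Trc PT.
  set J := [set j : 'I_M | (content (P (j, false)) == content (r, c)) && (j < k)].
  have Pi b : injective (fun j : 'I_M => P (j, b)).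
    by move=> j j' /(can_inj PT)[].
  have Prc : P (k, false) = (r, c) by rewrite -Trc TP.
  transitivity #|J|.
    rewrite -(card_imset _ (Pi false)); apply: eq_card => q; rewrite inE.
    apply/andP/imsetP => [[/eqP cq]|[j + ->]].
      case Tq: (T q) => [j [//|]] /= ; rewrite /lt_unfolded /= => lt.
      by exists j; rewrite ?inE -?Tq ?TP // ?cq ?eqxx.
    by rewrite inE => /andP[-> lt]; rewrite PT.
  rewrite -(card_imset _ (Pi true)); apply: eq_card => q; rewrite inE.
  apply/imsetP/andP => [[j + ->]|[/eqP cq]].
    rewrite inE => /andP[/eqP cj lt]; rewrite PT; split=> //.
    by rewrite !e cj Prc.
  case Tq: (T q) => [j [|//]] /=; rewrite /lt_unfolded /= => lt.
  exists j; last by rewrite -Tq TP.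
  by rewrite inE lt andbT -Prc -eqSS -!e -cq -Tq TP.
have := e k; have -> : P (k, false) = (r, c) by rewrite -Trc TP.
case EP: (P (k, true)) card_eq => [r' c'] /= card_eq ec.
exists r', c'; rewrite -EP PT; split=> //; move: card_eq ec; rewrite /content /=;
  move: (ltn_ord r) (ltn_ord c) (ltn_ord r') (ltn_ord c'); clear; lia.
Qed.

(** If the contents correspond, then the letters before k on its diagonal correspond to
    those before k' on its own: for each smaller pair, one element lies on the first
    diagonal if and only if the other one lies on the second. In the other direction, a
    letter above the axis is the image of the letter in the reflected cell. *)
Lemma diagonal_contents n M (T : tableau n M) : SYT (@lt_folded M) T ->
  DST T <-> forall p q k, T p = (k, false) -> T q = (k, true) -> content p + content q = n.*2.+1.
Proof.
move=> hT; have sT := proj1 (folded_SYT T) hT.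
have [bT _ _] := hT; have iT := bij_inj bT; have [P TP PT] := bT.
split=> [[_ dst]|con].
  have lower (r : 'I_n) (c : 'I_n.+1) k b q : c <= r -> T (r, c) = (k, b) ->
      T q = (k, ~~ b) -> q.1 = c :> nat /\ q.2 = r.+1 :> nat.
    move=> le Trc Tq.
    have [r' [c' [er ec T']]] :=
      dst r.+1 c.+1 k b le (ex_intro _ r (ex_intro _ c (And3 erefl erefl Trc))).
    have -> : q = (r', c') by apply: iT; rewrite T'.
    by split; [case: er | move: ec; rewrite addn1 => -[]].
  have main p q k b : T p = (k, b) -> T q = (k, ~~ b) -> content p + content q = n.*2.+1.
    case: p => r c Tp Tq; have [le|lt] := leqP c r.
      have [e1 e2] := lower r c k b q le Tp Tq.
      by rewrite /content e1 e2 /=; have := ltn_ord r; move: le; clear; lia.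
    have rb : r < n.+1 by rewrite ltnS ltnW.
    have cb : c.-1 < n by have := ltn_ord c; move: lt; clear; lia.
    case T0: (T (Ordinal cb, Ordinal rb)) => [k0 b0].
    have le0 : Ordinal rb <= Ordinal cb by rewrite /=; move: lt; clear; lia.
    have [e1 e2] := lower _ _ k0 b0 (P (k0, ~~ b0)) le0 T0 (PT _).
    have EP : P (k0, ~~ b0) = (r, c).
      case: (P _) e1 e2 => r1 c1 /= e1 e2; congr pair; apply: val_inj => //=.
      by rewrite e2; move: lt; clear; lia.
    have := PT (k0, ~~ b0); rewrite EP Tp => -[ek eb].
    have -> : q = (Ordinal cb, Ordinal rb).
      by apply: iT; rewrite Tq T0 ek eb negbK.
    by rewrite /content /=; have := ltn_ord c; have := ltn_ord r; move: lt; clear; lia.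
  by move=> p q k Tp Tq; apply: main Tp Tq.
split=> // i0 j0 k b le0 [r [c [er ec Trc]]]; move: le0; rewrite -er -ec ltnS => le.
clear er ec i0 j0.
have e (a : letter M) : content (P a) + content (P (a.1, ~~ a.2)) = n.*2.+1.
  case: a => j [] /=; last exact: con (PT _) (PT _).
  by rewrite addnC; apply: con (PT _) (PT _).
pose A x := [set q : cell n | (content q == x) && ((T q).1 < k)].
have le_A x y : x + y = n.*2.+1 -> #|A x| <= #|A y|.
  move=> xy; have Ji : injective (fun q => P ((T q).1, ~~ (T q).2)).
    move=> q q' /(can_inj PT) [e1 e2]; apply: iT; move: e1 e2.
    by case: (T q) (T q') => a s [a' s'] /= -> /negb_inj ->.
  rewrite -(card_imset _ Ji); apply/subset_leq_card/subsetP => _ /imsetP[q + ->].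
  rewrite !inE PT /= => /andP[/eqP cq ->]; rewrite andbT.
  by rewrite -(eqn_add2l x) xy -cq -{1}(TP q) e.
have depthA (s : bool) : minn (P (k, s)).1 (P (k, s)).2 = #|A (content (P (k, s)))|.
  rewrite (depth sT (@lt_folded_index M)); apply: eq_card => q; rewrite !inE PT.
  case: eqP => //= cq; rewrite /lt_folded /=; case: (ltnP _ k) => //= _.
  apply/negP => /and3P[/eqP ek q2 s2].
  have := e (k, s); rewrite /= (_ : P (k, ~~ s) = q).
    2: by rewrite -ek s2 -q2 -surjective_pairing TP.
  by rewrite cq; clear; lia.
have Prc : P (k, b) = (r, c) by rewrite -Trc TP.
have card_eq : minn r c = minn (P (k, ~~ b)).1 (P (k, ~~ b)).2.
  have := depthA b; rewrite Prc /= => ->; rewrite depthA.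
  have := e (k, b); rewrite /= Prc => eb.
  by apply/eqP; rewrite eqn_leq !le_A // addnC.
have := e (k, b); rewrite /= Prc; case EP: (P _) card_eq => [r' c'] /= card_eq ec.
exists r', c'; rewrite -EP PT; split=> //; move: card_eq ec le; rewrite /content /=;
  move: (ltn_ord r) (ltn_ord c) (ltn_ord r') (ltn_ord c'); clear; lia.
Qed.

(** * The equivalence *)

Lemma antisym_contents n M (T : tableau n M) : SYT (@lt_unfolded M) T ->
  AST T <-> rots (width n) (contents T [seq (k, true) | k <- enum 'I_M]) =
            map (duals n) (contents T (rev [seq (k, false) | k <- enum 'I_M])).
Proof.
move=> hT; have [bT _ _] := hT; have iT := bij_inj bT; have [P TP PT] := bT.
apply: iff_trans (antidiagonal_contents hT) _.
have inks (k : 'I_M) : k \in enum 'I_M by rewrite mem_enum.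
move: (enum 'I_M) inks => ks inks; rewrite /rots /contents !map_rev -!map_comp.
have key k : (rot_step (width n) (letter_content T (k, true)) ==
    duals n (letter_content T (k, false))) =
    (content (P (k, true)) == (content (P (k, false))).+1).
  rewrite !(letter_contentE iT (PT _)) /= -[_ == _]/(_ == _ :> nat).
  have := content_bounds (P (k, true)); have := content_bounds (P (k, false)).
  by move: (content _) (content _) => a b; clear; lia.
split=> [con|/(can_inj revK)/eq_in_map eqs p q k Tp Tq].
  congr rev; apply/eq_in_map => k _; apply/eqP => /=.
  by rewrite key; apply/eqP/con; apply: PT.
have := eqs k (inks k) => /= /eqP; rewrite key => /eqP.
by rewrite -Tp -Tq !TP.
Qed.

Lemma all_twin_flat n M (T : tableau n M) (ks : seq 'I_M) us : size us = size ks ->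
  contents T (folded ks) = flat us ->
  all (twin n) us =
  all (fun k => twin n (letter_content T (k, false), letter_content T (k, true))) ks.
Proof.
elim: ks us => [|k ks IH] us; first by case: us.
case/lastP: us => // us [h1 h2]; rewrite size_rcons flat_rcons contents_cat => -[sz].
have se : size (contents T (folded ks)) = size (flat us).
  rewrite size_map; elim: (ks) (us) sz => [|a l IHl] [|u us'] //= [] /IHl.
  by rewrite size_cat /= => ->; rewrite addn2.
move/eqP; rewrite eqseq_cat // => /andP[/eqP e1 /eqP [e2 e3]].
by rewrite all_rcons (IH _ sz e1) /= e2 e3.
Qed.

Theorem theorem4p4 (n M : nat) (hn : 1 <= n) (hM : M = (n * (n + 1)) %/ 2)
    (T : tableau n M) (hT : SYT (@lt_unfolded M) T) :
  AST T <-> DST (fold T).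
Proof.
set ks := enum 'I_M.
have sT := proj1 (unfolded_SYT T) hT; have cz := standard_complete sT.
have := @fold_standard n M ks T [::] (upper_segment_enum M); rewrite !cats0 => /(_ sT).
rewrite -/(fold T) => -[sF cF _].
have inks k : k \in ks by rewrite mem_enum.
have hF := proj2 (folded_SYT (fold T)) sF; have [bF _ _] := hF.
have iF := bij_inj bF; have [P TP PT] := bF.
set V := contents T [seq (k, true) | k <- ks].
set W := contents T (rev [seq (k, false) | k <- ks]).
have eVW : contents T (unfolded ks) = V ++ W by rewrite -contents_cat.
have sV : size V = size ks by rewrite !size_map.
have sW : size V = size W by rewrite !size_map size_rev !size_map.
rewrite -/ks eVW in cz; rewrite -/ks eVW -sV in cF.
have eq1 : AST T <-> all (twin n) (fold_pairs (size V) (V ++ W)).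
  apply: iff_trans (antisym_contents hT) _; split.
    exact: antisym_twin_fold.
  exact: twin_fold_antisym.
apply: iff_trans eq1 _; apply: iff_sym; apply: iff_trans (diagonal_contents hF) _.
rewrite (all_twin_flat _ cF) ?size_fold_pairs //.
have key k : twin n (letter_content (fold T) (k, false), letter_content (fold T) (k, true)) =
    (content (P (k, false)) + content (P (k, true)) == n.*2.+1).
  by rewrite !(letter_contentE iF (PT _)).
split=> [tw|/allP tw p q k Tp Tq].
  by apply/allP => k _; rewrite key; apply/eqP/(tw _ _ k); apply: PT.
by have := tw k (inks k); rewrite key -Tp -Tq !TP => /eqP.
Qed.
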